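(* Let $\theta>0$, let $F:\mathbb{C}\to\mathbb{R}$ be a (Borel measurable) function, and let $(z_j)_{j\ge1}$ be i.i.d. $S^1$-valued random variables. Assume that $$V_N:=\theta\sum_{k=1}^Nk\,\mathbb{E}[(\Delta_k(F,Z_{k,1}))^2]$$ tends to infinity as $N\to\infty$. Assume further that there exists $p>\max\{\frac1\theta,2\}$ such that $$\sum_{k=1}^Nk^{p-1}\,\mathbb{E}[|\Delta_k(F,Z_{k,1})|^p]=o(V_N^{p/2})\qquad(N\to\infty).$$ Then $$\left(\frac{\operatorname{Tr}(F)-E_N}{\sqrt{V_N}}\right)_{N\ge1}$$ converges in distribution to a standard Gaussian random variable, where $E_N:=\theta\sum_{k=1}^N\mathbb{E}[\Delta_k(F,Z_{k,1})]$.
   Context: $\mathfrak{S}_N$ is the symmetric group on $N$ objects, identified with permutation matrices via $\sigma\mapsto(\delta_{i,\sigma(j)})_{1\le i,j\le N}$. The classical Ewens measure with parameter $\theta>0$ gives $\sigma\in\mathfrak{S}_N$ a probability proportional to $\theta^{T(\sigma)}$, where $T(\sigma)$ is the number of cycles of $\sigma$. Random matrices: $M=\operatorname{diag}(z_1,\dots,z_N)\cdot\sigma$, where $\sigma\in\mathfrak{S}_N$ is distributed according to the classical Ewens measure with parameter $\theta$ and $(z_j)_{j\ge1}$ is an i.i.d. sequence with values in the unit circle $S^1$, independent of $\sigma$. $\operatorname{Tr}(F):=\sum_{k=1}^NF(\omega_k)$, $\omega_1,\dots,\omega_N$ being the eigenvalues of $M$ with multiplicity. For $k\ge1$ and $y\in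 S^1$, $\Delta_k(F,y):=\frac1k\sum_{\omega^k=y}F(\omega)$. $Z_{k,1}$ is a random variable equal in law to $\prod_{j=1}^kz_j$. *)

(* Defs.v *)
From HB Require Import structures.
From mathcomp Require Import all_boot all_order all_algebra all_fingroup.
From mathcomp Require Import all_classical all_reals all_analysis.
From mathcomp Require Export complex.

Set Implicit Arguments.
Unset Strict Implicit.
Unset Printing Implicit Defensive.

Import Order.TTheory GRing.Theory Num.Theory.
Import numFieldNormedType.Exports.

Local Open Scope classical_set_scope.
Local Open Scope ring_scope.

(* The complex numbers with the Borel sigma-algebra. [R[i]^o] carries the      *)
(* topology of the modulus; the carrier of [borelC R] is convertible to [R[i]]. *)
Definition borelC (R : realType) : measurableType _ :=
  g_sigma_algebraType (@open R[i]^o : set (set R[i]^o)).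

Section Probability.
Context (R : realType) (d : measure_display) (T : measurableType d)
  (P : probability T R).

Definition eq_in_law d' (T' : measurableType d') (X Y : T -> T') : Prop :=
  forall B, measurable B -> P (X @^-1` B) = P (Y @^-1` B).

Definition mutually_independent d' (T' : measurableType d')
    (X : nat -> T -> T') : Prop :=
  forall (s : seq nat) (B : nat -> set T'), uniq s ->
    (forall j, measurable (B j)) ->
    P (\big[setI/setT]_(j <- s) (X j @^-1` B j)) =
    (\prod_(j <- s) P (X j @^-1` B j))%E.

Definition iid d' (T' : measurableType d') (X : nat -> T -> T') : Prop :=
  (forall j, eq_in_law (X j) (X 0%N)) /\ mutually_independent X.

Definition sigma_of_seq d' (T' : measurableType d')
    (X : nat -> T -> T') : set (set T) :=
  <<s \bigcup_j preimage_set_system setT (X j) measurable >>.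

(* [Y] takes values in a finite (discrete) type. *)
Definition independent_of_seq (S : finType) d' (T' : measurableType d')
    (Y : T -> S) (X : nat -> T -> T') : Prop :=
  forall (s : set S) (A : set T), sigma_of_seq X A ->
    P ((Y @^-1` s) `&` A) = (P (Y @^-1` s) * P A)%E.

(* Convergence of the distribution functions at every continuity point of the *)
(* limiting one; [X] is required to be a sequence of random variables.        *)
Definition cvg_in_distribution (X : nat -> T -> R)
    (mu : set R -> \bar R) : Prop :=
  (forall N, measurable_fun [set: T] (X N)) /\
  forall x : R, {for x, continuous (fun y : R => mu `]-oo, y]%classic)} ->
    P [set t | X N t <= x] @[N --> \oo] --> mu `]-oo, x]%classic.

End Probability.

Section Ewens.
Context (R : realType).

(* [porbits s] also contains the singleton cycles of the fixed points. *)
Definition ncycles (n : nat) (s : 'S_n) : nat := #|porbits s|.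

Definition ewens (theta : R) (n : nat) (s : 'S_n) : R :=
  theta ^+ ncycles s / \sum_(t : 'S_n) theta ^+ ncycles t.

Definition ewens_distributed d (T : measurableType d) (P : probability T R)
    (theta : R) (n : nat) (sigma : T -> 'S_n) : Prop :=
  forall s : 'S_n, measurable (sigma @^-1` [set s]) /\
    P (sigma @^-1` [set s]) = (ewens theta s)%:E.

End Ewens.

Section Matrices.
Context (R : realType).

(* mathcomp's [perm_mx s] has entries [s i == j], the transposed convention. *)
Definition permutation_matrix (n : nat) (s : 'S_n) : 'M[R[i]]_n :=
  \matrix_(i < n, j < n) (i == s j)%:R.

Definition modified_permutation_matrix (n : nat) (z : 'I_n -> R[i]) (s : 'S_n)
    : 'M[R[i]]_n :=
  diag_mx (\row_(j < n) z j) *m permutation_matrix s.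

Definition eigenvalues (n : nat) (A : 'M[R[i]]_n) : seq R[i] :=
  sval (closed_field_poly_normal (char_poly A)).

Definition Tr (F : R[i] -> R) (n : nat) (A : 'M[R[i]]_n) : R :=
  \sum_(w <- eigenvalues A) F w.

(* For [0 < k] the sum ranges over a finite set: the support restriction       *)
(* built into the notation discards only vanishing terms.                      *)
Definition Delta (k : nat) (F : R[i] -> R) (y : R[i]) : R :=
  k%:R^-1 * \sum_(w \in [set w : R[i] | w ^+ k = y]) F w.

End Matrices.

Section Normalization.
Context (R : realType) (d : measure_display) (T : measurableType d)
  (P : probability T R) (theta : R) (F : R[i] -> R) (Z : nat -> T -> R[i]).

Definition variance_seq (N : nat) : \bar R :=
  (theta%:E * \sum_(1 <= k < N.+1)
     k%:R%:E * 'E_P[fun t => (Delta k F (Z k t) ^+ 2)%R])%E.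

Definition moment_seq (p : R) (N : nat) : \bar R :=
  (\sum_(1 <= k < N.+1)
     (k%:R `^ (p - 1))%:E * 'E_P[fun t => (`|Delta k F (Z k t)| `^ p)%R])%E.

Definition mean_seq (N : nat) : \bar R :=
  (theta%:E * \sum_(1 <= k < N.+1) 'E_P[fun t => Delta k F (Z k t)])%E.

End Normalization.

(* Main.v *)
Require Import Defs.
From mathcomp Require Import all_boot all_order all_algebra all_fingroup all_field.
From mathcomp Require Import all_classical all_reals all_analysis.
From mathcomp Require Import measurable_realfun.
From mathcomp Require Import ring lra zify.

Set Implicit Arguments.
Unset Strict Implicit.
Unset Printing Implicit Defensive.

Import Order.TTheory GRing.Theory Num.Theory.
Import numFieldNormedType.Exports.

(** The matrix splits along the cycles of the permutation: its characteristic
    polynomial is the product over the cycles [c] of [X^k - y], where [k] is the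
    length of [c] and [y] the product of the [z_j] along it ([Tr_cycles]). Hence
    the trace is a sum over the cycles of [X_k := k * Delta_k(F, y)], and given
    the cycle lengths these contributions are independent, the one of a cycle
    of length [k] being distributed as [k * Delta_k(F, Z_k)]. The mean of a test
    function [f] of the trace is therefore [ewens_op n f 0], an average over the
    Ewens measure of iterated convolutions with the laws of the [X_k]
    ([mean_linear_stat]); the rest of the argument is about this operator.

    Removing the cycle of a marked point gives the recursion [ewens_op_rec],
    which is the Feller coupling in analytic form, and has two consequences.
    First, permutations of different sizes can be compared: if cycles longer
    than [N] do not contribute, then size [N] may be replaced by an arbitrarily
    large size at the cost of [feller_error] ([ewens_op_limit]). Second, the
    size-bias identity [palm] expresses the mean of [x f x] through means of
    [f (x + X_k)] over smaller permutations. In the limit of large sizes the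
    weights of this identity become [theta / k], those of independent Poisson
    numbers of cycles, and a Taylor expansion turns it into the Stein identity
    of a Gaussian variable with mean [ewens_mean] and variance
    [ewens_variance] ([stein_inequality]).

    Two error terms remain. The Taylor remainder is a Lindeberg term, small by
    the moment condition of order [p > 2] ([lindeberg_le]). The cost
    [feller_error] of changing the size is a weighted first moment; Young's
    inequality with exponents [p] and [q = p / (p - 1)] separates the moments
    from the weights, and the [q]-th powers of the weights have bounded averages
    because [p > theta^-1] ([wgt_ratio_powR_bound], [feller_error_le]).

    So the standardized trace satisfies Stein's identity in the limit
    ([stein_cvg]), for test functions that are bounded and Lipschitz together
    with their product by [y]. The same inequality with zero derivative term
    gives tightness ([stein_tight]). As Stein's equation is solved with compact
    support for right-hand sides of compact support and zero Gaussian mean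
    ([stein_solution]), a truncation argument yields convergence of the means of
    Lipschitz functions ([near_gauss]) and then of the distribution functions
    ([cvg_cdf]). *)

Local Open Scope ring_scope.

(** * Inserting a point into a permutation *)

Section Insertion.

Lemma porbit_sub (T : finType) (s : {perm T}) (A : {set T}) x :
  x \in A -> (forall y, y \in A -> s y \in A) -> porbit s x \subset A.
Proof.
move=> xA sA; apply/fintype.subsetP => y /porbitP[i ->]; rewrite permX.
by elim: i => [//|i IH] /=; exact: sA.
Qed.

Lemma porbit_next (T : finType) (s : {perm T}) x y :
  y \in porbit s x -> s y \in porbit s x.
Proof.
move=> /porbitP[i ->]; apply/porbitP; exists i.+1.
by rewrite !permX iterS.
Qed.

(** The new point precedes [y] in the cycle of [y]; it is a fixed point when
    [y = ord0]. *)
Definition insert0 n (s : 'S_n) (y : 'I_n.+1) : 'S_n.+1 :=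
  (lift0_perm s * tperm ord0 y)%g.

Lemma insert0_0 n (s : 'S_n) y : insert0 s y ord0 = y.
Proof. by rewrite permM lift0_perm0 tpermL. Qed.

Lemma insert0_lift n (s : 'S_n) y j :
  insert0 s y (lift ord0 j) =
    if lift ord0 (s j) == y then ord0 else lift ord0 (s j).
Proof.
rewrite permM lift0_perm_lift; case: eqP => [->|/eqP neq]; first by rewrite tpermR.
by rewrite tpermD // eq_sym.
Qed.

Lemma lift0_perm_inj n : injective (@lift0_perm n).
Proof.
move=> s s' ss'; apply/permP => k; apply: (@lift_inj _ ord0).
by rewrite -!lift0_perm_lift ss'.
Qed.

Lemma insert0_bij n : bijective (fun u : 'S_n * 'I_n.+1 => insert0 u.1 u.2).
Proof.
apply: inj_card_bij; last by rewrite card_prod card_ord !card_Sn factS mulnC.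
move=> [s y] [s' y'] /= eqss; have eqy : y = y'.
  by rewrite -(insert0_0 s y) eqss insert0_0.
by move: eqss; rewrite eqy => /mulIg/lift0_perm_inj ->.
Qed.

Lemma porbit_lift0 n (s : 'S_n) y j :
  (forall i, y = lift ord0 i -> i \notin porbit s j) ->
  porbit (insert0 s y) (lift ord0 j) = lift ord0 @: porbit s j.
Proof.
move=> yj; have step k : k \in porbit s j ->
    insert0 s y (lift ord0 k) = lift ord0 (s k).
  move=> kj; rewrite insert0_lift; case: eqP => // eqy.
  by have := yj _ (esym eqy); rewrite porbit_next.
apply/eqP; rewrite finset.eqEsubset; apply/andP; split.
  apply: porbit_sub; first by apply: imset_f; exact: porbit_id.
  by move=> _ /imsetP[k kj ->]; rewrite step //; apply/imset_f/porbit_next.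
apply/fintype.subsetP => _ /imsetP[k /porbitP[i ->] ->].
elim: i => [|i IH]; first by rewrite perm1 porbit_id.
by rewrite expgSr permM -step ?mem_porbit //; exact: porbit_next.
Qed.

Lemma porbit_insert0_0 n (s : 'S_n) : porbit (insert0 s ord0) ord0 = [set ord0].
Proof.
apply/eqP; rewrite finset.eqEsubset finset.sub1set porbit_id andbT.
by apply: porbit_sub => [|y]; rewrite !inE // => /eqP ->; rewrite insert0_0.
Qed.

Lemma porbit_insert0_lift n (s : 'S_n) i :
  porbit (insert0 s (lift ord0 i)) ord0 = ord0 |: (lift ord0 @: porbit s i).
Proof.
set t := insert0 _ _; apply/eqP; rewrite finset.eqEsubset; apply/andP; split.
  apply: porbit_sub => [|y]; first by rewrite !inE eqxx.
  rewrite !inE => /orP[/eqP->|/imsetP[k ki ->]].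
    by rewrite insert0_0 imset_f ?porbit_id ?orbT.
  rewrite insert0_lift; case: ifP => _ //.
  by apply/orP; right; apply/imset_f/porbit_next.
apply/fintype.subsetP => y; rewrite !inE => /orP[/eqP->|]; first exact: porbit_id.
move=> /imsetP[_ /porbitP[k ->] ->]; rewrite permX.
elim: k => [|k IH] /=.
  by rewrite -(insert0_0 s (lift ord0 i)); apply: porbit_next; exact: porbit_id.
have := porbit_next IH; rewrite insert0_lift (inj_eq lift_inj); case: ifP => // /eqP -> _.
by rewrite -(insert0_0 s (lift ord0 i)); apply: porbit_next; exact: porbit_id.
Qed.

Definition other_cycles (T : finType) (s : {perm T}) x : {set {set T}} :=
  porbits s :\ porbit s x.

Lemma other_cyclesP (T : finType) (s : {perm T}) x (C : {set T}) :
  reflect (exists2 j, C = porbit s j & x \notin porbit s j)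
          (C \in other_cycles s x).
Proof.
apply: (iffP idP) => [|[j -> xj]].
  rewrite !inE => /andP[+ /imsetP[j _ eqC]]; rewrite eqC => neq.
  by exists j => //; rewrite -eq_porbit_mem eq_sym.
by rewrite !inE eq_sym eq_porbit_mem xj; exact: imset_f.
Qed.

Lemma other_cycles_insert0_0 n (s : 'S_n) :
  other_cycles (insert0 s ord0) ord0 = (fun C : {set 'I_n} => lift ord0 @: C) @: porbits s.
Proof.
have orb j : porbit (insert0 s ord0) (lift ord0 j) = lift ord0 @: porbit s j.
  by apply: porbit_lift0 => i /eqP; rewrite -(inj_eq val_inj).
apply/finset.setP => C; apply/other_cyclesP/imsetP.
  move=> [j ->]; case: (unliftP ord0 j) => [k ->|->]; last by rewrite porbit_id.
  by rewrite orb => _; exists (porbit s k) => //; exact: imset_f.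
move=> [_ /imsetP[j _ ->] ->]; exists (lift ord0 j); first by rewrite orb.
by rewrite orb; apply/negP => /imsetP[k _ /eqP]; rewrite -(inj_eq val_inj).
Qed.

Lemma other_cycles_insert0_lift n (s : 'S_n) i :
  other_cycles (insert0 s (lift ord0 i)) ord0 =
  (fun C : {set 'I_n} => lift ord0 @: C) @: other_cycles s i.
Proof.
have orb j : i \notin porbit s j ->
    porbit (insert0 s (lift ord0 i)) (lift ord0 j) = lift ord0 @: porbit s j.
  by move=> ij; apply: porbit_lift0 => i' /lift_inj <-.
apply/finset.setP => C; apply/other_cyclesP/imsetP.
  move=> [j ->]; case: (unliftP ord0 j) => [k ->|->]; last by rewrite porbit_id.
  rewrite porbit_sym porbit_insert0_lift !inE /= mem_imset; last exact: lift_inj.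
  rewrite porbit_sym => /negP ik; have {}ik : i \notin porbit s k by apply/negP.
  by exists (porbit s k); [apply/other_cyclesP; exists k|exact: orb].
move=> [_ /other_cyclesP[j -> ij] ->]; exists (lift ord0 j); first by rewrite orb.
by rewrite orb //; apply/negP => /imsetP[k _ /eqP]; rewrite -(inj_eq val_inj).
Qed.

Lemma card_other_cycles (T : finType) (s : {perm T}) x :
  #|porbits s| = (#|other_cycles s x|).+1.
Proof. by rewrite (cardsD1 (porbit s x)) imset_f. Qed.

Lemma big_porbits (R : Type) (idx : R) (op : Monoid.com_law idx) (T : finType)
    (s : {perm T}) x (B : {set T} -> R) :
  \big[op/idx]_(C in porbits s) B C =
  op (B (porbit s x)) (\big[op/idx]_(C in other_cycles s x) B C).
Proof.
rewrite (bigD1 (porbit s x)) ?imset_f //=; congr (op _ _).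
by apply: eq_bigl => C; rewrite !inE andbC.
Qed.

Lemma imset_lift_inj n : injective (fun C : {set 'I_n} => lift ord0 @: C).
Proof. by apply: imset_inj; exact: lift_inj. Qed.

Lemma card_imset_lift n (C : {set 'I_n}) : #|lift ord0 @: C| = #|C|.
Proof. by apply: card_imset; exact: lift_inj. Qed.

Lemma ncycles_insert0_0 n (s : 'S_n) : ncycles (insert0 s ord0) = (ncycles s).+1.
Proof.
rewrite /ncycles (card_other_cycles _ ord0) other_cycles_insert0_0 card_imset //.
exact: imset_lift_inj.
Qed.

Lemma ncycles_insert0_lift n (s : 'S_n) i :
  ncycles (insert0 s (lift ord0 i)) = ncycles s.
Proof.
rewrite /ncycles (card_other_cycles _ ord0) other_cycles_insert0_lift card_imset.
  by rewrite -card_other_cycles.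
exact: imset_lift_inj.
Qed.

End Insertion.

(** * Sums over permutations by cycle lengths *)

Section CycleType.

Definition card_seq (T : finType) (Q : {set {set T}}) : seq nat :=
  map (fun C : {set T} => #|C|) (enum Q).

Definition cycle_type n (s : 'S_n) : seq nat := card_seq (porbits s).

Lemma card_seq_imset (T T' : finType) (f : {set T} -> {set T'}) (Q : {set {set T}}) :
  injective f -> (forall C, #|f C| = #|C|) ->
  perm_eq (card_seq (f @: Q)) (card_seq Q).
Proof.
move=> inj_f card_f; have perm_fQ : perm_eq (enum (f @: Q)) (map f (enum Q)).
  apply: uniq_perm; rewrite ?enum_uniq ?map_inj_uniq ?enum_uniq // => C.
  rewrite mem_enum; apply/imsetP/mapP => -[D DQ ->]; exists D => //.
    by rewrite mem_enum.
  by rewrite -mem_enum.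
apply: perm_trans (perm_map _ perm_fQ) _; rewrite -map_comp.
by rewrite (eq_map (g := fun C : {set T} => #|C|)).
Qed.

Lemma cycle_type_split n (s : 'S_n) x :
  perm_eq (cycle_type s) (#|porbit s x| :: card_seq (other_cycles s x)).
Proof.
have p : perm_eq (enum (porbits s)) (porbit s x :: enum (other_cycles s x)).
  apply: uniq_perm; rewrite /= ?enum_uniq ?mem_enum ?setD11 //.
  move=> C; rewrite inE !mem_enum !inE; case: eqP => [->|] //=.
  exact: imset_f.
exact: perm_map p.
Qed.

Context (R : comNzRingType) (theta : R).

Definition perm_invariant (U : Type) (Phi : seq nat -> U) :=
  forall l l', perm_eq l l' -> Phi l = Phi l'.

Definition cycle_sum n (Phi : seq nat -> R) : R :=
  \sum_(s : 'S_n) theta ^+ ncycles s * Phi (cycle_type s).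

Definition marked_sum n (x : 'I_n) (Psi : nat -> seq nat -> R) : R :=
  \sum_(s : 'S_n) theta ^+ ncycles s *
     Psi #|porbit s x| (card_seq (other_cycles s x)).

Lemma porbitJ (T : finType) (s t : {perm T}) x :
  porbit (s ^ t)%g (t x) = t @: porbit s x.
Proof.
apply/finset.setP => y; apply/porbitP/imsetP.
  move=> [i ->]; exists ((s ^+ i)%g x); first exact: mem_porbit.
  by rewrite -conjXg permJ.
by move=> [_ /porbitP[i ->] ->]; exists i; rewrite -conjXg permJ.
Qed.

Lemma other_cyclesJ (T : finType) (s t : {perm T}) x :
  other_cycles (s ^ t)%g (t x) = (fun C : {set T} => t @: C) @: other_cycles s x.
Proof.
apply/finset.setP => C; apply/other_cyclesP/imsetP.
  move=> [j ->]; rewrite -{1 2}[j](permKV t) porbitJ mem_imset; last exact: perm_inj.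
  by move=> xj; exists (porbit s (t^-1%g j)) => //; apply/other_cyclesP; eexists.
move=> [_ /other_cyclesP[j -> xj] ->]; exists (t j); rewrite porbitJ //.
by rewrite mem_imset //; exact: perm_inj.
Qed.

(** Conjugation by a transposition exchanges the marked points and preserves the
    cycle lengths. *)
Lemma marked_sum_eq n (x y : 'I_n) Psi :
  (forall a, perm_invariant (Psi a)) -> marked_sum x Psi = marked_sum y Psi.
Proof.
move=> PsiP; pose t := tperm y x.
rewrite /marked_sum (reindex_inj (@conjg_inj _ t)) /=; apply: eq_bigr => s _.
have eqx : x = t y by rewrite tpermL.
have inj_t : injective (fun C : {set 'I_n} => t @: C) by apply/imset_inj/perm_inj.
congr (_ ^+ _ * _).
  by rewrite /ncycles !(card_other_cycles _ x) {1}eqx other_cyclesJ (card_imset _ inj_t)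
    -!card_other_cycles.
rewrite {1 2}eqx porbitJ card_imset; last exact: perm_inj.
apply: PsiP; rewrite other_cyclesJ; apply: card_seq_imset => // C.
by apply: card_imset; exact: perm_inj.
Qed.

Lemma cycle_sum_marked n (x : 'I_n) Phi : perm_invariant Phi ->
  cycle_sum n Phi = marked_sum x (fun a l => Phi (a :: l)).
Proof.
by move=> PhiP; apply: eq_bigr => s _; rewrite (PhiP _ _ (cycle_type_split s x)).
Qed.

(** Delete the marked point: either it was a fixed point, or its cycle becomes
    one shorter and the point that it preceded is marked instead. *)
Lemma marked_sumS n Psi : (forall a, perm_invariant (Psi a)) ->
  marked_sum (@ord0 n) Psi =
  theta * cycle_sum n (Psi 1%N) + \sum_(i < n) marked_sum i (fun a => Psi a.+1).
Proof.
move=> PsiP; rewrite /marked_sum (reindex _ (onW_bij _ (insert0_bij n))) /=.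
rewrite -(pair_bigA _ (fun (s : 'S_n) (y : 'I_n.+1) => theta ^+ ncycles (insert0 s y) *
  Psi #|porbit (insert0 s y) (@ord0 n)| (card_seq (other_cycles (insert0 s y) (@ord0 n))))) /=.
under eq_bigr do rewrite big_ord_recl.
rewrite big_split /=; congr (_ + _).
  rewrite mulr_sumr; apply: eq_bigr => s _.
  rewrite ncycles_insert0_0 exprS -mulrA porbit_insert0_0 cards1.
  rewrite (PsiP _ _ (cycle_type s)) // other_cycles_insert0_0.
  by apply: card_seq_imset; [exact: imset_lift_inj|exact: card_imset_lift].
rewrite exchange_big /=; apply: eq_bigr => i _; apply: eq_bigr => s _.
rewrite ncycles_insert0_lift porbit_insert0_lift cardsU1.
have -> : ord0 \notin lift ord0 @: porbit s i.
  by apply/negP => /imsetP[k _ /eqP]; rewrite -(inj_eq val_inj).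
rewrite card_imset_lift add1n; congr (_ * _); apply: PsiP.
rewrite other_cycles_insert0_lift.
by apply: card_seq_imset; [exact: imset_lift_inj|exact: card_imset_lift].
Qed.

(** Repeating the deletion strips off the whole cycle of the marked point. *)
Lemma marked_sumE n (x : 'I_n.+1) Psi : (forall a, perm_invariant (Psi a)) ->
  marked_sum x Psi =
  theta * \sum_(a < n.+1) (n ^_ a)%:R * cycle_sum (n - a) (Psi a.+1).
Proof.
elim: n x Psi => [|n IH] x Psi PsiP; rewrite (marked_sum_eq x ord0 PsiP) marked_sumS //.
  by rewrite big_ord0 big_ord1 addr0 mul1r.
rewrite (eq_bigr (fun=> theta * \sum_(a < n.+1) (n ^_ a)%:R *
    cycle_sum (n - a) (Psi a.+2))); last by move=> i _; exact: IH.
rewrite sumr_const card_ord -mulr_natl [in RHS]big_ord_recl /= ffactn0 mul1r subn0 mulrDr.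
congr (_ + _); rewrite mulrCA mulr_sumr; congr (_ * _); apply: eq_bigr => a _.
by rewrite /bump /= add1n mulrA -natrM subSS ffactSS.
Qed.

Theorem cycle_sumS n Phi : perm_invariant Phi ->
  cycle_sum n.+1 Phi =
  theta * \sum_(a < n.+1) (n ^_ a)%:R * cycle_sum (n - a) (fun l => Phi (a.+1 :: l)).
Proof.
move=> PhiP; rewrite (cycle_sum_marked ord0) //; apply: marked_sumE => a l l' ll'.
by apply: PhiP; rewrite perm_cons.
Qed.

Lemma cycle_sum1S n :
  cycle_sum n.+1 (fun=> 1) = (theta + n%:R) * cycle_sum n (fun=> 1).
Proof.
rewrite (cycle_sum_marked ord0) // marked_sumS // mulrDl; congr (_ + _).
case: n => [|n]; first by rewrite big_ord0 mul0r.
rewrite (eq_bigr (fun=> cycle_sum n.+1 (fun=> 1))).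
  by rewrite sumr_const card_ord mulr_natl.
by move=> i _; rewrite (cycle_sum_marked i).
Qed.

End CycleType.

(** * The spectrum of a modified permutation matrix *)

Section CycleDeterminant.

(** Elimination of the first row and column, the step of the induction that
    contracts a cycle. *)
Lemma det_schur (K : fieldType) n (M : 'M[K]_(1 + n)) (x : K) :
  M ord0 ord0 = x -> x != 0 ->
  \det M = x * \det (drsubmx M - x^-1 *: (dlsubmx M *m ursubmx M)).
Proof.
move=> Mx x0.
have ulM : ulsubmx M = x%:M.
  by rewrite [LHS]mx11_scalar !mxE !lshift0 Mx.
have {1}-> : M = block_mx 1%:M 0 (x^-1 *: dlsubmx M) 1%:M *m
    block_mx x%:M (ursubmx M) 0 (drsubmx M - x^-1 *: (dlsubmx M *m ursubmx M)).
  rewrite mulmx_block !mul1mx !mul0mx !addr0 mul_mx_scalar scalerA mulfV // scale1r.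
  by rewrite -scalemxAl addrC subrK -{1}[M]submxK ulM.
by rewrite det_mulmx det_lblock det_ublock !det1 !mul1r det_scalar1.
Qed.

Definition cycle_mx (K : fieldType) n (x : K) (b : 'I_n -> K) (s : 'S_n) : 'M[K]_n :=
  \matrix_(i, j) (x *+ (i == j) - b i *+ (i == s j)).

(** By induction on the number of points: eliminating an inserted point is a
    Schur complement, which contracts its cycle and multiplies the two
    neighbouring weights. *)
Lemma det_cycle_mx (K : fieldType) n (x : K) (b : 'I_n -> K) (s : 'S_n) :
  x != 0 ->
  \det (cycle_mx x b s) =
  \prod_(C in porbits s) (x ^+ #|C| - \prod_(i in C) b i).
Proof.
move=> x0; elim: n b s => [|n IH] b s.
  by rewrite det_mx00 big_pred0 // => C; apply/imsetP => -[[]].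
have [g _ gK] := insert0_bij n; rewrite -(gK s); move: (g s) => [{gK}s y] /=.
have prod_other (Q : {set {set 'I_n}}) :
    \prod_(C in (fun C : {set 'I_n} => lift ord0 @: C) @: Q)
      (x ^+ #|C| - \prod_(i in C) b i) =
    \prod_(C in Q) (x ^+ #|C| - \prod_(i in C) b (lift ord0 i)).
  rewrite big_imset /=; last by move=> ? ? _ _; exact: imset_lift_inj.
  apply: eq_bigr => C _; rewrite card_imset_lift; congr (_ - _).
  by rewrite big_imset // => ? ? _ _; exact: lift_inj.
rewrite (big_porbits _ _ ord0); case: (unliftP ord0 y) => [i|] ->.
- rewrite other_cycles_insert0_lift prod_other porbit_insert0_lift.
  rewrite cardsU1 big_setU1 /=; last first.
    by apply/negP => /imsetP[k _ /eqP]; rewrite -(inj_eq val_inj).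
  have -> : ord0 \notin lift ord0 @: porbit s i.
    by apply/negP => /imsetP[k _ /eqP]; rewrite -(inj_eq val_inj).
  rewrite card_imset_lift add1n exprS big_imset /=; last by move=> ? ? _ _; exact: lift_inj.
  pose M : 'M[K]_(1 + n) := cycle_mx x b (insert0 s (lift ord0 i)).
  rewrite -/M (det_schur (x := x)) //; last first.
    by rewrite mxE eqxx insert0_0 /= subr0.
  (* the neighbour of the inserted point absorbs its weight *)
  pose b' (k : 'I_n) := if k == i then b ord0 * b (lift ord0 i) / x else b (lift ord0 k).
  have -> : drsubmx M - x^-1 *: (dlsubmx M *m ursubmx M) = cycle_mx x b' s.
    apply/matrixP => k j; rewrite !mxE big_ord1 !mxE !lshift0 !rshift1.
    have -> : (0 : 'I_n.+1) = ord0 by exact: val_inj.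
    rewrite insert0_0 !insert0_lift !(inj_eq lift_inj) /b'.
    have l0 (m : 'I_n) : (ord0 == lift ord0 m) = false by rewrite (negbTE (neq_lift _ _)).
    have l0' (m : 'I_n) : (lift ord0 m == ord0) = false by rewrite eq_sym.
    rewrite l0 l0'.
    case: (eqVneq (s j) i) => [->|sji].
      rewrite eqxx l0'.
      by case: (eqVneq k i) => [->|_]; rewrite /= ?mulr0n ?mulr1n; [field|ring].
    rewrite l0 (inj_eq lift_inj) !mulr0n !subr0 mulr0 mulr0 subr0.
    case: (eqVneq k (s j)) => [->|_]; last by rewrite !mulr0n.
    by rewrite (negbTE sji).
  rewrite IH (big_porbits _ _ i) mulrA; congr (_ * _).
    rewrite mulrBr; congr (_ - _).
    rewrite (bigD1 i) ?porbit_id //= [in RHS](bigD1 i) ?porbit_id //= {1}/b' eqxx.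
    rewrite (eq_bigr (fun k => b (lift ord0 k))); last by move=> k /andP[_ /negbTE]; rewrite /b' => ->.
    by field.
  apply: eq_bigr => C /other_cyclesP[j -> ij]; congr (_ - _).
  apply: eq_bigr => k kj; rewrite /b'; case: eqP => // eki.
  by rewrite -eki kj in ij.
rewrite other_cycles_insert0_0 prod_other porbit_insert0_0 cards1 big_set1 expr1.
have -> : cycle_mx x b (insert0 s ord0) =
    @block_mx _ 1 n 1 n (x - b ord0)%:M 0 0
    (cycle_mx x (fun k => b (lift ord0 k)) s).
  have l0 (m : 'I_n) : (ord0 == lift ord0 m) = false by rewrite (negbTE (neq_lift _ _)).
  have l0' (m : 'I_n) : (lift ord0 m == ord0) = false by rewrite eq_sym.
  have e0 : (0 : 'I_n.+1) = ord0 by exact: val_inj.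
  rewrite -[LHS](@submxK _ 1 n 1 n); congr (@block_mx _ 1 n 1 n _ _ _ _); apply/matrixP => k j.
  - by rewrite !mxE !ord1 !lshift0 e0 insert0_0 eqxx.
  - by rewrite !mxE !ord1 lshift0 rshift1 e0 insert0_lift l0' !l0 !mulr0n subr0.
  - by rewrite !mxE !ord1 lshift0 rshift1 e0 insert0_0 !l0' !mulr0n subr0.
  - by rewrite !mxE !rshift1 insert0_lift l0' !(inj_eq lift_inj).
by rewrite (@det_lblock _ 1 n) det_scalar1 IH.
Qed.

Lemma horner_char_poly (K : comNzRingType) n (A : 'M[K]_n) x :
  (char_poly A).[x] = \det (x%:M - A).
Proof.
rewrite -[LHS]/(horner_eval x (char_poly A)) -det_map_mx; congr (\det _).
by apply/matrixP => i j; rewrite !mxE /= /horner_eval !hornerE hornerMn hornerX.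
Qed.

(** Schur complements divide by [x], so the determinant formula is first obtained
    at nonzero points. *)
Lemma poly_eq_nonzero (K : numFieldType) (p q : {poly K}) :
  (forall x, x != 0 -> p.[x] = q.[x]) -> p = q.
Proof.
move=> pq; apply/eqP; rewrite -subr_eq0; apply/negPn/negP => r0.
pose xs : seq K := [seq i.+1%:R | i <- iota 0 (size (p - q))].
have : (size xs < size (p - q)%R)%N.
  apply: max_poly_roots => //.
    apply/allP => _ /mapP[i _ ->]; rewrite /root !hornerE pq ?subrr //.
  by rewrite map_inj_uniq ?iota_uniq // => i j /eqP; rewrite eqr_nat => /eqP[].
by rewrite size_map size_iota ltnn.
Qed.

End CycleDeterminant.

Section Trace.
Context (R : realType).
Local Notation C := R[i].

Lemma char_poly_modified n (z : 'I_n -> C) (s : 'S_n) :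
  char_poly (modified_permutation_matrix z s) =
  \prod_(c in porbits s) ('X^#|c| - (\prod_(i in c) z i)%:P).
Proof.
apply: poly_eq_nonzero => x x0; rewrite horner_char_poly.
rewrite -[RHS]/(horner_eval x _) rmorph_prod /=.
rewrite (eq_bigr (fun c : {set 'I_n} => x ^+ #|c| - \prod_(i in c) z i)); last first.
  by move=> c _; rewrite /horner_eval !hornerE ?hornerXn.
rewrite -det_cycle_mx //; congr (\det _); apply/matrixP => i j.
rewrite !mxE (bigD1 i) //= big1 ?addr0 => [|k /negbTE ki].
  by rewrite !mxE eqxx mulr1n mulr_natr.
by rewrite !mxE eq_sym ki mulr0n mul0r.
Qed.

(** The derivative vanishes at most at [0], which is not a root; so the roots are
    simple. *)
Lemma roots_Xn_sub (k : nat) (y : C) (rs : seq C) : (0 < k)%N -> y != 0 ->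
  'X^k - y%:P = \prod_(w <- rs) ('X - w%:P) ->
  uniq rs /\ forall w, (w \in rs) = (w ^+ k == y).
Proof.
move=> k0 y0 eqp; split; last first.
  by move=> w; rewrite -root_prod_XsubC -eqp /root !hornerE ?hornerXn subr_eq0.
rewrite -separable_prod_XsubC -eqp unlock.
rewrite derivB derivC subr0 derivXn -scaler_nat coprimepZr ?pnatr_eq0 -?lt0n //.
apply: coprimep_expr; rewrite coprimepX.
by rewrite /root !hornerE ?hornerXn expr0n eqn0Ngt k0 /= sub0r oppr_eq0.
Qed.

Lemma Delta_roots (F : C -> R) (k : nat) (y : C) (rs : seq C) :
  (0 < k)%N -> uniq rs -> (forall w, (w \in rs) = (w ^+ k == y)) ->
  k%:R * Delta k F y = \sum_(w <- rs) F w.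
Proof.
move=> k0 urs mem_rs; rewrite /Delta mulrA mulfV ?pnatr_eq0 -?lt0n // mul1r.
rewrite [RHS]fsbig_seq //.
have E : [set w : C | w ^+ k = y]%classic = [set` rs]%classic.
  apply/seteqP; split => w /=; first by rewrite mem_rs => ->.
  by rewrite mem_rs => /eqP.
by rewrite E.
Qed.

(** Each cycle contributes the [k] distinct roots of [X^k - y], and the sum of [F]
    over them is [k * Delta_k(F, y)]. *)
Lemma Tr_cycles (F : C -> R) n (z : 'I_n -> C) (s : 'S_n) :
  (forall i, z i != 0) ->
  Tr F (modified_permutation_matrix z s) =
  \sum_(c in porbits s) #|c|%:R * Delta #|c| F (\prod_(i in c) z i).
Proof.
move=> z0; pose rts (c : {set 'I_n}) := sval (closed_field_poly_normal ('X^#|c| - (\prod_(i in c) z i)%:P)).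
pose Q := enum (porbits s).
have card_gt0 (c : {set 'I_n}) : c \in porbits s -> (0 < #|c|)%N.
  by move=> /imsetP[x _ ->]; rewrite lt0n card_porbit_neq0.
have rtsE (c : {set 'I_n}) : c \in porbits s ->
    'X^#|c| - (\prod_(i in c) z i)%:P = \prod_(w <- rts c) ('X - w%:P).
  move=> cs; rewrite /rts; case: closed_field_poly_normal => r /= {1}->.
  by rewrite lead_coefXnsubC ?scale1r // card_gt0.
have : perm_eq (eigenvalues (modified_permutation_matrix z s)) (flatten (map rts Q)).
  apply: prod_XsubC_eq; rewrite big_flatten big_map /=.
  transitivity (char_poly (modified_permutation_matrix z s)).
    rewrite /eigenvalues; case: closed_field_poly_normal => r /= ->.
    by rewrite (monicP (char_poly_monic _)) scale1r.
  by rewrite char_poly_modified big_enum /=; apply: eq_bigr => c /rtsE.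
move=> pe; rewrite /Tr (perm_big _ pe) big_flatten big_map /= big_enum /=.
apply: eq_bigr => c cs; apply/esym.
have prod0 : \prod_(i in c) z i != 0 by apply/prodf_neq0 => i _; exact: z0.
have [u mem] := roots_Xn_sub (card_gt0 c cs) prod0 (rtsE c cs).
by apply: Delta_roots; rewrite ?card_gt0.
Qed.

End Trace.

Local Open Scope classical_set_scope.
Local Open Scope ring_scope.

(** * Borel functions of a complex variable *)

Section BorelComplex.
Context (R : realType).
Local Open Scope complex_scope.
Local Open Scope ring_scope.
Local Notation C := R[i].
Local Notation Re := (@complex.Re R).
Local Notation Im := (@complex.Im R).

Lemma normc_ReIm (z : C) : `|z| = (Num.sqrt (Re z ^+ 2 + Im z ^+ 2))%:C.
Proof. exact: normc_def. Qed.

Lemma norm_Re_le (z : C) : `|Re z| <= Num.sqrt (Re z ^+ 2 + Im z ^+ 2).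
Proof. by rewrite -sqrtr_sqr ler_wsqrtr // lerDl sqr_ge0. Qed.

Lemma norm_Im_le (z : C) : `|Im z| <= Num.sqrt (Re z ^+ 2 + Im z ^+ 2).
Proof. by rewrite -sqrtr_sqr ler_wsqrtr // lerDr sqr_ge0. Qed.

Lemma norm_le_ReIm (z : C) :
  Num.sqrt (Re z ^+ 2 + Im z ^+ 2) <= `|Re z| + `|Im z|.
Proof.
rewrite -[leRHS]ger0_norm ?addr_ge0 // -sqrtr_sqr ler_wsqrtr // sqrrD !real_normK ?num_real //.
by rewrite addrAC lerDl mulrn_wge0 // mulr_ge0.
Qed.

Lemma open_borelC (U : set C) : @open C^o U -> measurable (U : set (borelC R)).
Proof. by move=> oU; apply: sub_sigma_algebra. Qed.

(** Balls in [R[i]] have complex radii; only the real ones matter. *)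
Lemma openC_ball (U : set C) :
  @open C^o U <-> forall x, U x -> exists2 e : R, 0 < e &
    forall y, Num.sqrt (Re (x - y) ^+ 2 + Im (x - y) ^+ 2) < e -> U y.
Proof.
rewrite openE; split=> [+ x Ux|+ x Ux] => /(_ x Ux).
  rewrite /interior => /nbhs_ballP[e /= e0 eU].
  move: e0 eU; rewrite ltcE /= => /andP[/eqP ime re].
  exists (Re e) => // y; rewrite -ltcR -normc_ReIm => yx; apply: eU.
  rewrite /ball /= /ball_ /= (lt_le_trans yx) // lecE /= ime eqxx.
  exact: lexx.
move=> [e e0 eU]; apply/nbhs_ballP; exists e%:C => /=; first by rewrite ltcR.
by move=> y; rewrite /ball /= /ball_ /= normc_ReIm ltcR; exact: eU.
Qed.

Lemma measurable_Re : measurable_fun setT (Re : borelC R -> R).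
Proof.
move=> mD; apply: (measurability _ (RGenOInfty.measurableE R)) => //.
move=> _ [_ [r ->] <-]; rewrite setTI; apply: open_borelC; apply/openC_ball => x /=.
rewrite in_itv /= andbT => rx; exists (Re x - r); first by rewrite subr_gt0.
move=> y /(le_lt_trans (norm_Re_le _)); rewrite in_itv /= andbT.
by case: x y rx => [a b] [c d] /= rx /ltr_normlP[]; lra.
Qed.

Lemma measurable_Im : measurable_fun setT (Im : borelC R -> R).
Proof.
move=> mD; apply: (measurability _ (RGenOInfty.measurableE R)) => //.
move=> _ [_ [r ->] <-]; rewrite setTI; apply: open_borelC; apply/openC_ball => x /=.
rewrite in_itv /= andbT => rx; exists (Im x - r); first by rewrite subr_gt0.
move=> y /(le_lt_trans (norm_Im_le _)); rewrite in_itv /= andbT.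
by case: x y rx => [a b] [c d] /= rx /ltr_normlP[]; lra.
Qed.

Definition rational_box (q : rat * rat * nat) : set C :=
  [set z | `|Re z - ratr q.1.1| < q.2.+1%:R^-1 /\ `|Im z - ratr q.1.2| < q.2.+1%:R^-1].

(** The plane is second countable: this is what lets a complex function be
    tested for measurability on its coordinates. *)
Lemma open_rational_box (U : set C) : @open C^o U ->
  U = \bigcup_(q in [set q | rational_box q `<=` U]) rational_box q.
Proof.
move=> /openC_ball oU; apply/seteqP; split => [z Uz|z [q /= qU qz]]; last exact: qU.
have [e e0 eU] := oU _ Uz.
have [n ne] : exists n, n.+1%:R^-1 < e / 4.
  have e4 : 0 < e / 4 by lra.
  have [n _ /(_ n (leqnn n))] := near_infty_natSinv_lt (PosNum e4).
  by exists n.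
have n0 : 0 < n.+1%:R^-1 :> R by rewrite invr_gt0.
have near_rat (x r : R) : 0 < r -> exists q : rat, `|x - ratr q| < r.
  move=> r0; have [|q] := @rat_in_itvoo R (x - r) (x + r); first by lra.
  rewrite in_itv /= => qx; exists q; move: (ratr q : R) qx => q' /andP[? ?].
  by apply/ltr_normlP; split; lra.
have [a az] := near_rat (Re z) _ n0; have [b bz] := near_rat (Im z) _ n0.
exists (a, b, n) => //= w [/= aw bw]; apply: eU.
apply: le_lt_trans (norm_le_ReIm _) _.
case: z w {Uz oU} az bz aw bw => [z1 z2] [w1 w2] /=.
move: (n.+1%:R^-1 : R) (ratr a : R) (ratr b : R) ne => r a' b' ne.
move=> /ltr_normlP[? ?] /ltr_normlP[? ?] /ltr_normlP[? ?] /ltr_normlP[? ?].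
have : `|z1 - w1| < 2 * r by apply/ltr_normlP; split; lra.
have : `|z2 - w2| < 2 * r by apply/ltr_normlP; split; lra.
by lra.
Qed.

Lemma countable_bigcup_measurable d (T : measurableType d) (I : countType)
    (D : set I) (A : I -> set T) :
  (forall i, measurable (A i)) -> measurable (\bigcup_(i in D) A i).
Proof.
move=> mA; pose B n := if unpickle n is Some i then (if i \in D then A i else set0) else set0.
have -> : \bigcup_(i in D) A i = \bigcup_n B n.
  apply/seteqP; split => [t [i Di At]|t [n _]].
    by exists (pickle i) => //; rewrite /B pickleK mem_set.
  by rewrite /B; case: unpickle => // i; case: ifPn => // /set_mem Di At; exists i.
apply: bigcupT_measurable => n; rewrite /B; case: unpickle => [i|]; last exact: measurable0.
by case: ifP.
Qed.

Context d (T : measurableType d).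

Lemma measurable_complex (f : T -> borelC R) :
  measurable_fun setT (fun t => Re (f t)) ->
  measurable_fun setT (fun t => Im (f t)) -> measurable_fun setT f.
Proof.
move=> mRe mIm mD; apply: (@measurability _ _ _ (borelC R) setT f (@open C^o) erefl) => //.
move=> _ [U oU <-]; rewrite setTI (open_rational_box oU) preimage_bigcup.
apply: countable_bigcup_measurable => -[[a b] n].
have mlt (g : T -> R) c e : measurable_fun setT g -> measurable [set t | `|g t - c| < e].
  move=> mg; have -> : [set t | `|g t - c| < e] = (fun t => `|g t - c|) @^-1` `]-oo, e[%classic.
    by apply/seteqP; split => t /=; rewrite in_itv.
  rewrite -[X in measurable X]setTI; by apply: (measurableT_comp (@normr_measurable R setT) _) => //; exact: measurable_funB.
have -> : f @^-1` rational_box (a, b, n) =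
  [set t | `|Re (f t) - ratr a| < n.+1%:R^-1] `&` [set t | `|Im (f t) - ratr b| < n.+1%:R^-1] by [].
by apply: measurableI; apply: mlt.
Qed.

Lemma measurable_Re_comp (f : T -> borelC R) :
  measurable_fun setT f -> measurable_fun setT (fun t => Re (f t)).
Proof. by move=> mf; exact: measurableT_comp measurable_Re mf. Qed.

Lemma measurable_Im_comp (f : T -> borelC R) :
  measurable_fun setT f -> measurable_fun setT (fun t => Im (f t)).
Proof. by move=> mf; exact: measurableT_comp measurable_Im mf. Qed.

Lemma measurable_mulC (f g : T -> borelC R) :
  measurable_fun setT f -> measurable_fun setT g ->
  measurable_fun setT (fun t => (f t : C) * g t : borelC R).
Proof.
move=> mf mg; have ReM (x y : C) : Re (x * y) = Re x * Re y - Im x * Im y.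
  by case: x y => [? ?] [? ?].
have ImM (x y : C) : Im (x * y) = Re x * Im y + Im x * Re y.
  by case: x y => [? ?] [? ?].
apply: measurable_complex.
  under [X in measurable_fun _ X]eq_fun do rewrite ReM.
  by apply: measurable_funB; apply: measurable_funM;
    do ?[exact: measurable_Re_comp|exact: measurable_Im_comp].
under [X in measurable_fun _ X]eq_fun do rewrite ImM.
by apply: measurable_funD; apply: measurable_funM;
  do ?[exact: measurable_Re_comp|exact: measurable_Im_comp].
Qed.

End BorelComplex.

(** * A Borel branch of the root *)

Section Root.
Context (R : realType).
Local Notation C := R[i].
Local Notation Re := (@complex.Re R).
Local Notation Im := (@complex.Im R).

Definition modulus (z : C) : R := Num.sqrt (Re z ^+ 2 + Im z ^+ 2).

(** The half-angle formula [tan (a / 2) = y / (r + x)] fails only on the closed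
    negative real axis. *)
Definition argument (z : C) : R :=
  if modulus z + Re z == 0 then pi else 2 * atan (Im z / (modulus z + Re z)).

Definition polar (r a : R) : C := Complex (r * cos a) (r * sin a).

Lemma modulus_eq0 (z : C) : modulus z = 0 -> z = 0.
Proof.
case: z => x y /eqP; rewrite /modulus /= sqrtr_eq0 => xy.
have /eqP : x ^+ 2 + y ^+ 2 = 0 by apply/eqP; rewrite eq_le xy addr_ge0 ?sqr_ge0.
by rewrite paddr_eq0 ?sqr_ge0 // !sqrf_eq0 => /andP[/eqP -> /eqP ->].
Qed.

Lemma polar_arg (z : C) : z != 0 -> z = polar (modulus z) (argument z).
Proof.
move=> z0; have r0 : modulus z != 0.
  by apply: contraNneq z0 => /modulus_eq0 ->.
have r2 : modulus z ^+ 2 = Re z ^+ 2 + Im z ^+ 2.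
  by rewrite sqr_sqrtr // addr_ge0 ?sqr_ge0.
have rx : - modulus z <= Re z by have := norm_Re_le z; rewrite ler_norml => /andP[].
move: r0 r2 rx; rewrite /argument; move: (modulus z) => r.
case: z {z0} => x y /= r0 r2 rx; case: eqP => [rx0|/eqP rx0].
  have y0 : y = 0.
    apply/eqP; rewrite -sqrf_eq0 -[_ ^+ 2](addKr (x ^+ 2)) -r2; apply/eqP.
    by have -> : x = - r by [lra]; ring.
  by rewrite /polar cospi sinpi y0 mulr0 mulrN1; congr Complex; lra.
set t := y / (r + x).
have t1 : 0 < 1 + t ^+ 2 by rewrite ltr_pwDl // sqr_ge0.
have c2 : cos (atan t) ^+ 2 = (r + x) / (2 * r).
  rewrite cos_atan exprVn sqr_sqrtr; last exact: ltW.
  have -> : 1 + t ^+ 2 = 2 * r / (r + x).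
    have y2 : y ^+ 2 = (r - x) * (r + x) by rewrite -subr_sqr r2; ring.
    by rewrite /t exprMn y2; field.
  by rewrite invf_div.
have cs : sin (atan t) = t * cos (atan t).
  rewrite -{2}(atanK t) /tan mulfVK //.
  by rewrite cos_atan invr_neq0 // gt_eqF // sqrtr_gt0.
rewrite /polar [2 * _]mulr_natl cos_mulr2n sin_mulr2n.
have -> : cos (atan t) * sin (atan t) = t * cos (atan t) ^+ 2 by rewrite cs; ring.
rewrite c2 /t; congr Complex; by field; rewrite r0.
Qed.

Lemma polar_exp (r a : R) k : polar r a ^+ k = polar (r ^+ k) (a *+ k).
Proof.
elim: k => [|k IH]; first by rewrite !expr0 mulr0n /polar cos0 sin0 mulr1 mulr0.
rewrite !exprS IH mulrS /polar cosD sinD; apply/eqP; rewrite eq_complex /=.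
by apply/andP; split; apply/eqP; ring.
Qed.

(** A Borel branch of the [k]-th root, from polar coordinates. *)
Definition kroot (k : nat) (z : C) : C :=
  polar (modulus z `^ k%:R^-1) (argument z / k%:R).

Lemma kroot_exp k z : (0 < k)%N -> z != 0 -> kroot k z ^+ k = z.
Proof.
move=> k0 z0; have kR : k%:R != 0 :> R by rewrite pnatr_eq0 -lt0n.
rewrite [RHS]polar_arg // polar_exp; congr polar.
  by rewrite -powR_mulrn ?powR_ge0 // -powRrM mulVf // powRr1 // sqrtr_ge0.
by rewrite -[LHS]mulr_natr divfK.
Qed.

Lemma measurable_modulus : measurable_fun setT (modulus : borelC R -> R).
Proof.
have m2 (f : borelC R -> R) : measurable_fun setT f -> measurable_fun setT (fun z => f z ^+ 2).
  by move=> mf; exact: measurable_funX.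
apply: measurableT_comp => //; first exact: (continuous_measurable_fun (@sqrt_continuous R)).
by apply: measurable_funD; apply: m2; [exact: measurable_Re|exact: measurable_Im].
Qed.

Lemma measurable_argument : measurable_fun setT (argument : borelC R -> R).
Proof.
have mden : measurable_fun setT (fun z : borelC R => modulus z + Re z).
  by apply: measurable_funD; [exact: measurable_modulus|exact: measurable_Re].
apply: measurable_fun_ifT => //; first exact: measurable_fun_eqr.
apply: measurable_funM => //; apply: (@measurableT_comp _ _ _ _ R R atan).
  by apply: continuous_measurable_fun => x; exact: continuous_atan.
apply: measurable_funM; first exact: measurable_Im.
rewrite (_ : (fun z => _) = fun z : borelC R => (modulus z + Re z) `^ (-1)).
  by apply: (measurableT_comp (measurable_powR _)).
apply/funext => z; rewrite powR_inv1 // -lerBlDl sub0r.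
by have := norm_Re_le z; rewrite ler_norml => /andP[].
Qed.

Lemma measurable_kroot k : measurable_fun setT (kroot k : borelC R -> borelC R).
Proof.
have mr : measurable_fun setT (fun z : borelC R => modulus z `^ k%:R^-1).
  by apply: (measurableT_comp (measurable_powR _)); exact: measurable_modulus.
have ma : measurable_fun setT (fun z : borelC R => argument z / k%:R).
  by apply: measurable_funM => //; exact: measurable_argument.
have mcos : measurable_fun setT (cos : R -> R).
  by apply: continuous_measurable_fun => x; exact: continuous_cos.
have msin : measurable_fun setT (sin : R -> R).
  by apply: continuous_measurable_fun => x; exact: continuous_sin.
by apply: measurable_complex; apply: measurable_funM => //; exact: measurableT_comp ma.
Qed.

(** For [y != 0] the solutions of [w^k = y] are a Borel root of [y] times the
    [k]-th roots of unity, so the average is a finite sum of Borel functions. *)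
Lemma measurable_Delta (F : C -> R) k : (0 < k)%N ->
  measurable_fun setT (F : borelC R -> R) ->
  measurable_fun setT (Delta k F : borelC R -> R).
Proof.
move=> k0 mF; have kR : k%:R != 0 :> R by rewrite pnatr_eq0 -lt0n.
have [us us1] : exists us : seq C, 'X^k - 1%:P = \prod_(w <- us) ('X - w%:P).
  have [us] := closed_field_poly_normal ('X^k - 1%:P : {poly C}).
  by rewrite lead_coefXnsubC // scale1r; exists us.
have [uus mem_us] := roots_Xn_sub k0 (oner_neq0 C) us1.
have DeltaE (z : C) : Delta k F z =
    k%:R^-1 * if modulus z == 0 then F 0 else \sum_(u <- us) F (kroot k z * u).
  apply: (mulfI kR); rewrite [RHS]mulrA mulfV // mul1r; case: ifPn => [/eqP/modulus_eq0 -> | rz].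
    rewrite (Delta_roots _ (rs := [:: 0])) ?big_seq1 //.
    by move=> w; rewrite inE expf_eq0 k0.
  have z0 : z != 0.
    by apply: contraNneq rz => ->; rewrite /modulus /= expr0n /= addr0 sqrtr0.
  have rho0 : kroot k z != 0.
    by apply: contra_neq (z0) => r0; rewrite -(kroot_exp k0 z0) r0 expr0n gtn_eqF.
  rewrite (Delta_roots _ (rs := [seq kroot k z * u | u <- us])) ?big_map //.
    by rewrite map_inj_uniq // => u v; exact: mulfI.
  move=> w; apply/mapP/eqP => [[u + ->]|wk].
    by rewrite mem_us => /eqP uk; rewrite exprMn uk mulr1 kroot_exp.
  exists (w / kroot k z); last by rewrite mulrC divfK.
  by rewrite mem_us expr_div_n wk kroot_exp // divff.
rewrite (_ : Delta k F = fun z => k%:R^-1 *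
    if modulus z == 0 then F 0 else \sum_(u <- us) F (kroot k z * u)); last first.
  by apply/funext => z; exact: DeltaE.
apply: measurable_funM => //; apply: measurable_fun_ifT => //.
  by apply: measurable_fun_eqr => //; exact: measurable_modulus.
apply: measurable_sum => u; apply: (measurableT_comp mF).
by apply: measurable_mulC => //; exact: measurable_kroot.
Qed.

End Root.

(** * Expectations of real functions *)

Section RealExpectation.
Context d (T : measurableType d) (R : realType) (P : probability T R).
Implicit Types f g : T -> R.

Definition L1 f := P.-integrable setT (EFin \o f).
Definition mean f : R := \int[P]_t f t.

Lemma L1_measurable f : L1 f -> measurable_fun setT f.
Proof. by move=> /integrableP[mf _]; exact/measurable_EFinP. Qed.

Lemma L1D f g : L1 f -> L1 g -> L1 (fun t => f t + g t).
Proof. by move=> mf mg; exact: (@integrableD _ _ _ _ _ measurableT _ _ mf mg). Qed.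

Lemma L1B f g : L1 f -> L1 g -> L1 (fun t => f t - g t).
Proof. by move=> mf mg; exact: (@integrableB _ _ _ _ _ measurableT _ _ mf mg). Qed.

Lemma L1Z c f : L1 f -> L1 (fun t => c * f t).
Proof. by move=> mf; exact: (@integrableZl _ _ _ _ _ measurableT c _ mf). Qed.

Lemma L1_cst c : L1 (fun=> c).
Proof. exact: finite_measure_integrable_cst. Qed.

Lemma L1_norm f : L1 f -> L1 (fun t => `|f t|).
Proof. by move=> /integrable_norm. Qed.

Lemma L1_le f g : measurable_fun setT f -> L1 g -> (forall t, `|f t| <= g t) -> L1 f.
Proof.
move=> mf ig fg; apply: le_integrable ig => //; first exact/measurable_EFinP.
by move=> t _ /=; rewrite lee_fin (le_trans (fg t)) // ler_norm.
Qed.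

Lemma L1_bounded f c : measurable_fun setT f -> (forall t, `|f t| <= c) -> L1 f.
Proof. by move=> mf fc; apply: (@L1_le f (fun=> c)) => //; exact: L1_cst. Qed.

Lemma L1_sum (I : Type) (s : seq I) (Q : pred I) (h : I -> T -> R) :
  (forall i, L1 (h i)) -> L1 (fun t => \sum_(i <- s | Q i) h i t).
Proof.
move=> hi; elim: s => [|i s IH].
  rewrite (_ : (fun t => _) = fun=> 0); first exact: L1_cst.
  by apply/funext => t; rewrite big_nil.
rewrite (_ : (fun t => _) = fun t => (if Q i then h i t else 0) +
    \sum_(j <- s | Q j) h j t); last first.
  by apply/funext => t; rewrite big_cons; case: ifP; rewrite ?add0r.
by apply: L1D => //; case: (Q i) => //; exact: L1_cst.
Qed.

Lemma meanD f g : L1 f -> L1 g -> mean (fun t => f t + g t) = mean f + mean g.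
Proof. by move=> mf mg; exact: RintegralD. Qed.

Lemma meanB f g : L1 f -> L1 g -> mean (fun t => f t - g t) = mean f - mean g.
Proof. by move=> mf mg; exact: RintegralB. Qed.

Lemma meanZ c f : L1 f -> mean (fun t => c * f t) = c * mean f.
Proof. by move=> mf; exact: RintegralZl. Qed.

Lemma mean_cst c : mean (fun=> c) = c.
Proof.
rewrite /mean -[X in Rintegral _ _ X]/(cst c) Rintegral_cst //.
by rewrite [X in fine X]probability_setT mulr1.
Qed.

Lemma mean_sum (I : Type) (s : seq I) (Q : pred I) (h : I -> T -> R) :
  (forall i, L1 (h i)) ->
  mean (fun t => \sum_(i <- s | Q i) h i t) = \sum_(i <- s | Q i) mean (h i).
Proof.
move=> hi; elim: s => [|i s IH].
  rewrite big_nil (_ : (fun t => _) = fun=> 0) ?mean_cst //.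
  by apply/funext => t; rewrite big_nil.
rewrite big_cons -IH; case: ifPn => Qi; last first.
  by congr mean; apply/funext => t; rewrite big_cons (negbTE Qi).
rewrite -meanD //; last exact: L1_sum.
by congr mean; apply/funext => t; rewrite big_cons Qi.
Qed.

Lemma mean_le f g : L1 f -> L1 g -> (forall t, f t <= g t) -> mean f <= mean g.
Proof. by move=> mf mg fg; exact: le_Rintegral. Qed.

Lemma mean_ge0 f : (forall t, 0 <= f t) -> 0 <= mean f.
Proof. by move=> f0; apply: Rintegral_ge0. Qed.

Lemma norm_mean_le f g : L1 f -> L1 g -> (forall t, `|f t| <= g t) -> `|mean f| <= mean g.
Proof.
move=> mf mg fg; apply: (le_trans (le_normr_Rintegral _ mf)) => //.
by apply: mean_le => //; exact: L1_norm.
Qed.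

Lemma mean_EFin f : L1 f -> (mean f)%:E = (\int[P]_t (f t)%:E)%E.
Proof. by move=> mf; rewrite /mean /Rintegral fineK //; exact: integrable_fin_num. Qed.

End RealExpectation.

Section Fubini.
Context d (T : measurableType d) d' (T' : measurableType d') (R : realType).
Context (P : probability T R) (P' : probability T' R).

Lemma integrable_prod_le (G : T * T' -> R) (A : T -> R) (B : T' -> R) :
  measurable_fun setT G -> L1 P A -> L1 P' B ->
  (forall u, `|G u| <= A u.1 + B u.2) ->
  (P \x P')%E.-integrable setT (EFin \o G).
Proof.
move=> mG iA iB GAB.
have iA1 : (P \x P')%E.-integrable setT (fun u => (A u.1)%:E).
  apply/(integrable12ltyP _).
    by apply: (measurableT_comp (measurable_int _ iA)) => //; exact: measurable_fst.
  rewrite /=; under eq_integral do rewrite integral_cst // [X in (_ * X)%E]probability_setT mule1.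
  by case/integrableP : iA.
have iB1 : (P \x P')%E.-integrable setT (fun u => (B u.2)%:E).
  apply/(integrable12ltyP _).
    by apply: (measurableT_comp (measurable_int _ iB)) => //; exact: measurable_snd.
  by rewrite /= integral_cst // [X in (_ * X)%E]probability_setT mule1; case/integrableP : iB.
apply: le_integrable (integrableD measurableT iA1 iB1) => //.
  exact/measurable_EFinP.
by move=> u _ /=; rewrite lee_fin (le_trans (GAB u)) // ler_norm.
Qed.

Lemma mean_swap (G : T * T' -> R) (A : T -> R) (B : T' -> R) :
  measurable_fun setT G -> L1 P A -> L1 P' B ->
  (forall u, `|G u| <= A u.1 + B u.2) ->
  mean P (fun t => mean P' (fun t' => G (t, t'))) =
  mean P' (fun t' => mean P (fun t => G (t, t'))).
Proof.
move=> mG iA iB GAB; have iG := integrable_prod_le mG iA iB GAB.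
have i1 t : L1 P' (fun t' => G (t, t')).
  apply: (L1_le _ (L1D (L1_cst P' (A t)) iB)) => [|t']; last exact: GAB (t, t').
  by apply: measurableT_comp mG _.
have i2 t' : L1 P (fun t => G (t, t')).
  apply: (L1_le _ (L1D iA (L1_cst P (B t')))) => [|t]; last exact: GAB (t, t').
  by apply: measurableT_comp mG _.
rewrite /mean {1 3}/Rintegral; congr fine.
under eq_integral do rewrite -[(_%:E)]/((mean P' _)%:E) mean_EFin //.
under [RHS]eq_integral do rewrite -[(_%:E)]/((mean P _)%:E) mean_EFin //.
exact: (Fubini iG).
Qed.

Lemma mean_prod (G : T * T' -> R) (A : T -> R) (B : T' -> R) :
  measurable_fun setT G -> L1 P A -> L1 P' B ->
  (forall u, `|G u| <= A u.1 + B u.2) ->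
  (\int[P \x P']_u (G u)%:E)%E = (mean P (fun t => mean P' (fun t' => G (t, t'))))%:E.
Proof.
move=> mG iA iB GAB; have iG := integrable_prod_le mG iA iB GAB.
have i1 t : L1 P' (fun t' => G (t, t')).
  apply: (L1_le _ (L1D (L1_cst P' (A t)) iB)) => [|t']; last exact: GAB (t, t').
  by apply: measurableT_comp mG _.
rewrite -integral12_prod_meas1 // mean_EFin.
  by apply: eq_integral => t _; rewrite mean_EFin.
rewrite /L1; apply: eq_integrable (integrable_fubini_F iG) => //.
by move=> t _ /=; rewrite mean_EFin.
Qed.

End Fubini.

(** * Independence and joint laws *)

Section Independence.
Context d (T : measurableType d) (R : realType) (P : probability T R).

Lemma indep_lambda_system (B : set T) : measurable B ->
  lambda_system setT [set A | measurable A /\ P (A `&` B) = (P A * P B)%E].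
Proof.
move=> mB; have finP A : measurable A -> P A \is a fin_num by move=> mA; exact: fin_num_measure.
split => //=.
- by split=> //; rewrite setTI probability_setT mul1e.
- move=> A C CA [mA PA] [mC PC]; split; first exact: measurableD.
  have -> : (A `\` C) `&` B = (A `&` B) `\` (C `&` B).
    apply/seteqP; split => t /= [[At Ct] Bt]; first by split => // -[].
    by split => //; split => // Ct'; apply: Bt.
  rewrite !measureD //; try (by rewrite ltey_eq finP //; exact: measurableI);
    try exact: measurableI.
  have -> : A `&` B `&` (C `&` B) = C `&` B.
    by apply/seteqP; split => [t [_ []]|t [Ct Bt]] //; split => //; split => //; exact: CA.
  have -> : A `&` C = C by apply/seteqP; split => [t []//|t Ct]; split => //; exact: CA.
  transitivity (P (A `&` B) - P (C `&` B))%E; first by [].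
  by rewrite PA PC muleBl ?finP // fin_num_adde_defr // finP.
- move=> F ndF mF; have mFn n : measurable (F n) by have [] := mF n.
  have mU : measurable (\bigcup_n F n) by exact: bigcupT_measurable.
  split => //; rewrite setI_bigcupl.
  have c1 := nondecreasing_cvg_mu (mu := P) mFn mU ndF.
  have c2 : P (F n `&` B) @[n --> \oo] --> P (\bigcup_n (F n `&` B)).
    apply: nondecreasing_cvg_mu; first by move=> n; exact: measurableI.
      by apply: bigcupT_measurable => n; exact: measurableI.
    by move=> m n mn; apply/subsetPset; apply: setSI; apply/subsetPset; exact: ndF.
  apply/esym/(cvg_unique _ _ c2) => //.
  have -> : (fun n => P (F n `&` B)) = (fun n => P (F n) * P B)%E.
    by apply/funext => n; have [] := mF n.
  by apply: cvgeZr => //; exact: finP.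
Qed.

(** By the pi-lambda theorem, applied to each factor in turn. *)
Lemma indep_generated (G1 G2 : set (set T)) :
  setI_closed G1 -> setI_closed G2 ->
  G1 `<=` measurable -> G2 `<=` measurable ->
  (forall A B, G1 A -> G2 B -> P (A `&` B) = (P A * P B)%E) ->
  forall A B, <<s G1 >> A -> <<s G2 >> B -> P (A `&` B) = (P A * P B)%E.
Proof.
move=> I1 I2 m1 m2 P12.
have ms1 : <<s G1 >> `<=` measurable.
  exact: smallest_sub (sigma_algebra_measurable T) m1.
have step1 B : G2 B -> forall A, <<s G1 >> A -> P (A `&` B) = (P A * P B)%E.
  move=> G2B; have mB := m2 _ G2B.
  have /(_ _)H := @lambda_system_subset _ G1 I1 setT _ (indep_lambda_system mB).
  move=> A sA; have [] := H _ _ A sA; first by move=> C GC; split; [exact: m1|exact: P12].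
    by [].
  by [].
move=> A B sA; have mA := ms1 _ sA.
have /(_ _)H := @lambda_system_subset _ G2 I2 setT _ (indep_lambda_system mA).
move=> sB; have [||_] := H _ _ B sB => [C GC|//|].
  by split; [exact: m2|rewrite setIC step1 // muleC].
by rewrite setIC muleC.
Qed.

Definition indep_fun d1 d2 (T1 : measurableType d1) (T2 : measurableType d2)
    (Y1 : T -> T1) (Y2 : T -> T2) :=
  forall A B, measurable A -> measurable B ->
    P (Y1 @^-1` A `&` Y2 @^-1` B) = (P (Y1 @^-1` A) * P (Y2 @^-1` B))%E.

Lemma mean_distribution d1 (T1 : measurableType d1) (Y : {RV P >-> T1}) (f : T1 -> R) c :
  measurable_fun setT f -> (forall y, `|f y| <= c) ->
  mean (distribution P Y) f = mean P (fun t => f (Y t)).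
Proof.
move=> mf fc; rewrite /mean /Rintegral integral_distribution //.
  exact: measurableT_comp.
by apply: (@L1_bounded _ _ _ P _ c) => //; exact: measurableT_comp.
Qed.

Section JointLaw.
Context d1 d2 (T1 : measurableType d1) (T2 : measurableType d2).
Context (Y1 : T -> T1) (Y2 : T -> T2).
Hypotheses (mY1 : measurable_fun setT Y1) (mY2 : measurable_fun setT Y2).
Hypothesis Y12 : indep_fun Y1 Y2.

Let W1 : {RV P >-> T1} := mfun_Sub (mem_set mY1).
Let W2 : {RV P >-> T2} := mfun_Sub (mem_set mY2).
Let mW : measurable_fun setT (fun t => (Y1 t, Y2 t)).
Proof. exact: measurable_fun_pair. Qed.
Let W : {RV P >-> (T1 * T2)%type} := mfun_Sub (mem_set mW).

(** The product measure is determined by its values on rectangles. *)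
Lemma joint_law (A : set (T1 * T2)) : measurable A ->
  P ((fun t => (Y1 t, Y2 t)) @^-1` A) =
  (distribution P W1 \x distribution P W2)%E A.
Proof.
move=> mA; apply/esym.
exact: (@product_measure_unique _ _ _ _ _ (distribution P W1) (distribution P W2)
  (distribution P W)).
Qed.

(** One of two independent variables is integrated out first. *)
Lemma mean_indep (g : T1 * T2 -> R) c :
  measurable_fun setT g -> (forall y, `|g y| <= c) ->
  mean P (fun t => g (Y1 t, Y2 t)) =
  mean P (fun t => mean P (fun t' => g (Y1 t, Y2 t'))).
Proof.
move=> mg gc; pose mu1 := distribution P W1; pose mu2 := distribution P W2.
have gc' (u : T1 * T2) : `|g u| <= (fun=> c) u.1 + (fun=> 0) u.2 by rewrite addr0.
have ig := integrable_prod_le mg (L1_cst mu1 c) (L1_cst mu2 0) gc'.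
rewrite -[LHS]/(mean P (fun t => g (W t))) -(@mean_distribution _ _ W g c) //.
rewrite {1}/mean {1}/Rintegral.
rewrite (eq_measure_integral (mu1 \x mu2)%E) => [|A mA _]; last exact: joint_law.
rewrite (mean_prod mg (L1_cst mu1 c) (L1_cst mu2 0) gc') /=.
have i1 y : measurable_fun setT (fun y' => g (y, y')) by exact: measurableT_comp mg _.
rewrite (@mean_distribution _ _ W1 _ c).
- congr mean; apply/funext => t; rewrite (@mean_distribution _ _ W2 _ c) //; exact: i1.
- have := measurable_fubini_F ig; rewrite (_ : fubini_F _ _ = EFin \o fun y => mean mu2 (fun y' => g (y, y'))).
    by move/measurable_EFinP.
  apply/funext => y /=; rewrite mean_EFin //; apply: (@L1_bounded _ _ _ _ _ c) => //; exact: i1.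
- move=> y; rewrite -[leRHS](mean_cst mu2 c); apply: norm_mean_le => //; last exact: L1_cst.
  by apply: (@L1_bounded _ _ _ _ _ c) => //; exact: i1.
Qed.

End JointLaw.

Lemma joint_law_eq d1 d2 (T1 : measurableType d1) (T2 : measurableType d2)
    (Y1 Y1' : T -> T1) (Y2 Y2' : T -> T2) :
  measurable_fun setT Y1 -> measurable_fun setT Y2 ->
  measurable_fun setT Y1' -> measurable_fun setT Y2' ->
  indep_fun Y1 Y2 -> indep_fun Y1' Y2' ->
  eq_in_law P Y1 Y1' -> eq_in_law P Y2 Y2' ->
  eq_in_law P (fun t => (Y1 t, Y2 t)) (fun t => (Y1' t, Y2' t)).
Proof.
move=> m1 m2 m1' m2' i i' e1 e2 A mA; rewrite (joint_law m1 m2 i mA).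
have mW : measurable_fun setT (fun t => (Y1' t, Y2' t)) by exact: measurable_fun_pair.
apply: (@product_measure_unique _ _ _ _ _ _ _
  (distribution P (mfun_Sub (mem_set mW) : {RV P >-> (T1 * T2)%type}))) => // B C mB mC.
transitivity (P (Y1' @^-1` B `&` Y2' @^-1` C)); first by [].
by rewrite i' // -e1 // -e2.
Qed.

End Independence.

(** * Lipschitz functions and convolutions *)

Section Lipschitz.
Context (R : realType).
Implicit Types f g : R -> R.

Definition lip (L : R) f := forall x y, `|f x - f y| <= L * `|x - y|.

Lemma lip_ge0 L f : lip L f -> 0 <= L.
Proof.
by move=> /(_ 1 0); rewrite subr0 normr1 mulr1; apply: le_trans.
Qed.

Lemma lip_continuous L f : lip L f -> continuous f.
Proof.
move=> Lf x; have L0 := lip_ge0 Lf; apply/cvgrPdist_lt => e e0.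
have L1 : 0 < L + 1 by lra.
apply/nbhs_ballP; exists (e / (L + 1)) => /=; first by rewrite divr_gt0.
move=> y; rewrite /ball /= => xy; apply: (le_lt_trans (Lf x y)).
apply: (@le_lt_trans _ _ ((L + 1) * `|x - y|)); first by rewrite ler_wpM2r // lerDl.
by rewrite mulrC -ltr_pdivlMr.
Qed.

Lemma lip_measurable L f : lip L f -> measurable_fun setT f.
Proof. by move=> /lip_continuous; exact: continuous_measurable_fun. Qed.

Lemma lip_shift L f a : lip L f -> lip L (fun x => f (x + a)).
Proof. by move=> Lf x y; rewrite (le_trans (Lf _ _)) // opprD addrACA subrr addr0. Qed.

Lemma lip_le L f x y : lip L f -> `|f (x + y)| <= `|f x| + L * `|y|.
Proof.
move=> Lf; have := Lf (x + y) x; rewrite addrAC subrr add0r => Lxy.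
by rewrite -[f (x + y)](subrK (f x)) addrC (le_trans (ler_normD _ _)) // lerD2l.
Qed.

Lemma lipD L L' f g : lip L f -> lip L' g -> lip (L + L') (fun x => f x + g x).
Proof.
move=> Lf Lg x y; rewrite opprD addrACA mulrDl (le_trans (ler_normD _ _)) //.
by apply: lerD; [exact: Lf|exact: Lg].
Qed.

Lemma lipZ c L f : lip L f -> lip (`|c| * L) (fun x => c * f x).
Proof. by move=> Lf x y; rewrite -mulrBr normrM -mulrA ler_wpM2l. Qed.

Lemma lip_cst c : lip 0 (fun=> c).
Proof. by move=> x y; rewrite subrr normr0 mul0r. Qed.

End Lipschitz.

Section Convolution.
Context d (T : measurableType d) (R : realType) (P : probability T R).
Context (X : nat -> T -> R).
Hypothesis iX : forall k, L1 P (X k).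
Implicit Types f g : R -> R.

(** These operators replace sums of independent variables distributed as the
    [X k], so that no such family has to be constructed. *)
Definition convolve k f (x : R) : R := mean P (fun t => f (x + X k t)).

Definition convolve_seq (ks : seq nat) f : R -> R := foldr convolve f ks.

Let mX k : measurable_fun setT (X k). Proof. exact: L1_measurable (iX k). Qed.

Lemma lip_measurable_shift L f k x : lip L f -> measurable_fun setT (fun t => f (x + X k t)).
Proof.
move=> Lf; apply: (measurableT_comp (lip_measurable Lf)).
exact: measurable_funD.
Qed.

Lemma lip_L1 L f k x : lip L f -> L1 P (fun t => f (x + X k t)).
Proof.
move=> Lf; apply: (L1_le (lip_measurable_shift k x Lf)
  (L1D (L1_cst P `|f x|) (L1Z L (L1_norm (iX k))))) => t.
exact: lip_le.
Qed.

Lemma convolve_lip L f k : lip L f -> lip L (convolve k f).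
Proof.
move=> Lf x y; rewrite -meanB; [|exact: lip_L1 Lf|exact: lip_L1 Lf].
rewrite -[leRHS](mean_cst P); apply: norm_mean_le.
- by apply: L1B; exact: lip_L1 Lf.
- exact: L1_cst.
- by move=> t; exact: lip_shift.
Qed.

Lemma convolve_seq_lip L f ks : lip L f -> lip L (convolve_seq ks f).
Proof. by move=> Lf; elim: ks => //= k ks IH; exact: convolve_lip. Qed.

Lemma convolve_bound L f k c : lip L f -> (forall x, `|f x| <= c) ->
  forall x, `|convolve k f x| <= c.
Proof.
move=> Lf fc x; rewrite -[leRHS](mean_cst P); apply: norm_mean_le => //.
- exact: lip_L1 Lf.
- exact: L1_cst.
Qed.

Lemma convolve_seq_bound L f ks c : lip L f -> (forall x, `|f x| <= c) ->
  forall x, `|convolve_seq ks f x| <= c.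
Proof.
move=> Lf fc; elim: ks => //= k ks IH.
by apply: (convolve_bound (L := L)) => //; exact: convolve_seq_lip.
Qed.

Lemma convolve_shift k f a x : convolve k (fun y => f (y + a)) x = convolve k f (x + a).
Proof. by congr mean; apply/funext => t; rewrite addrAC. Qed.

Lemma convolve_seq_shift ks f a x : convolve_seq ks (fun y => f (y + a)) x = convolve_seq ks f (x + a).
Proof.
elim: ks x => //= k ks IH x; rewrite -convolve_shift; congr (convolve k _ x).
by apply/funext => y; exact: IH.
Qed.

Lemma convolveD L L' f g k x : lip L f -> lip L' g ->
  convolve k (fun y => f y + g y) x = convolve k f x + convolve k g x.
Proof. by move=> Lf Lg; rewrite /convolve meanD //; [exact: lip_L1 Lf|exact: lip_L1 Lg]. Qed.

Lemma convolveZ L c f k x : lip L f -> convolve k (fun y => c * f y) x = c * convolve k f x.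
Proof. by move=> Lf; rewrite /convolve meanZ //; exact: lip_L1 Lf. Qed.

Lemma convolve_seqD L L' f g ks x : lip L f -> lip L' g ->
  convolve_seq ks (fun y => f y + g y) x = convolve_seq ks f x + convolve_seq ks g x.
Proof.
move=> Lf Lg; elim: ks x => //= k ks IH x.
rewrite -(@convolveD L L') //; try exact: convolve_seq_lip.
by congr (convolve k _ x); apply/funext => y; exact: IH.
Qed.

Lemma convolve_seqZ L c f ks x : lip L f -> convolve_seq ks (fun y => c * f y) x = c * convolve_seq ks f x.
Proof.
move=> Lf; elim: ks x => //= k ks IH x.
rewrite -(@convolveZ L) //; last exact: convolve_seq_lip.
by congr (convolve k _ x); apply/funext => y; exact: IH.
Qed.

(** Fubini's theorem; it lets a cycle type be treated as a multiset. *)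
Lemma convolve_comm L f j k : lip L f -> convolve j (convolve k f) = convolve k (convolve j f).
Proof.
move=> Lf; apply/funext => x.
pose G (u : T * T) := f (x + X j u.1 + X k u.2).
have mG : measurable_fun setT G.
  apply: (measurableT_comp (lip_measurable Lf)).
  apply: measurable_funD; first apply: measurable_funD => //.
    by apply: (measurableT_comp (mX j)); exact: measurable_fst.
  by apply: (measurableT_comp (mX k)); exact: measurable_snd.
have iA : L1 P (fun t => `|f x| + L * `|X j t|).
  exact: (L1D (L1_cst P _) (L1Z L (L1_norm (iX j)))).
have iB : L1 P (fun t => L * `|X k t|).
  exact: (L1Z L (L1_norm (iX k))).
rewrite /convolve [LHS](mean_swap mG iA iB); last first.
  move=> u /=; rewrite (le_trans (lip_le _ _ Lf)) // lerD2r.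
  exact: lip_le.
congr mean; apply/funext => t; congr mean; apply/funext => t'.
by rewrite /G /= addrAC.
Qed.

Lemma convolve_seq_perm L f ks ks' : lip L f -> perm_eq ks ks' -> convolve_seq ks f = convolve_seq ks' f.
Proof.
move=> Lf; have rot_front k l1 l2 : convolve_seq (l1 ++ k :: l2) f = convolve k (convolve_seq (l1 ++ l2) f).
  elim: l1 => //= a l1 ->; apply: (convolve_comm (L := L)); exact: convolve_seq_lip.
elim: ks ks' => [|k ks IH] ks'; first by rewrite perm_sym => /perm_nilP ->.
move=> pk; have /splitPr kks' : k \in ks' by rewrite -(perm_mem pk) mem_head.
case: kks' pk => l1 l2; rewrite -[k :: l2]cat1s perm_sym perm_catCA perm_sym /= perm_cons => pk.
by rewrite rot_front /= (IH _ pk).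
Qed.

End Convolution.

(** * Averages over Ewens permutations *)

Section EwensOperator.
Context d (T : measurableType d) (R : realType) (P : probability T R).
Context (theta : R) (theta_gt0 : 0 < theta).
Context (X : nat -> T -> R).
Hypothesis iX : forall k, L1 P (X k).
Implicit Types f g : R -> R.

(** The [n]-th coefficient of [(1 - x) ^ (- theta)]. *)
Definition wgt (n : nat) : R := \prod_(i < n) ((theta + i%:R) / i.+1%:R).

Lemma wgt0 : wgt 0 = 1. Proof. by rewrite /wgt big_ord0. Qed.

Lemma wgtS n : wgt n.+1 = wgt n * ((theta + n%:R) / n.+1%:R).
Proof. by rewrite /wgt big_ord_recr. Qed.

Lemma wgt_gt0 n : 0 < wgt n.
Proof.
by apply: prodr_gt0 => i _; rewrite divr_gt0 ?ltr0n // ltr_wpDr.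
Qed.

Lemma cycle_sum1 n : cycle_sum theta n (fun=> 1) = n`!%:R * wgt n.
Proof.
elim: n => [|n IH].
  rewrite wgt0 mulr1 /cycle_sum (big_pred1 1%g) => [|s]; last first.
    by apply/esym/eqP/permP => -[].
  rewrite mulr1 /ncycles (_ : porbits _ = finset.set0) ?cards0 //.
  by apply/finset.setP => C; rewrite inE; apply/imsetP => -[[]].
rewrite cycle_sum1S IH wgtS factS natrM; field.
by rewrite ?natr1 ?nat1r pnatr_eq0.
Qed.

(** The mean of [f (x + S)], where [S] is the sum over the cycles of an Ewens
    permutation of independent contributions, distributed as [X k] for a cycle
    of length [k]. *)
Definition ewens_op n f (x : R) : R :=
  \sum_(s : 'S_n) ewens theta s * convolve_seq P X (cycle_type s) f x.

Lemma ewens_norm_gt0 n : 0 < \sum_(t : 'S_n) theta ^+ ncycles t.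
Proof.
rewrite (bigD1 1%g) //= ltr_wpDr ?exprn_gt0 //.
by apply: sumr_ge0 => t _; rewrite exprn_ge0 // ltW.
Qed.

Lemma ewens_sumE n (Phi : seq nat -> R) :
  n`!%:R * wgt n * (\sum_(s : 'S_n) ewens theta s * Phi (cycle_type s)) =
  cycle_sum theta n Phi.
Proof.
rewrite mulr_sumr; apply: eq_bigr => s _; rewrite mulrA; congr (_ * _).
have -> : n`!%:R * wgt n = \sum_(t : 'S_n) theta ^+ ncycles t.
  by rewrite -cycle_sum1 /cycle_sum; apply: eq_bigr => t _; rewrite mulr1.
by rewrite /ewens mulrCA mulfV ?mulr1 // gt_eqF // ewens_norm_gt0.
Qed.

Lemma ewens_sum1 n : \sum_(s : 'S_n) ewens theta s = 1 :> R.
Proof. by rewrite /ewens -mulr_suml mulfV // gt_eqF // ewens_norm_gt0. Qed.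

Lemma ewens_ge0 n (s : 'S_n) : 0 <= ewens theta s :> R.
Proof. by rewrite divr_ge0 ?exprn_ge0 // ltW // ewens_norm_gt0. Qed.

Lemma convolve_ewens_op L k f n x : lip L f ->
  convolve P X k (ewens_op n f) x =
  \sum_(s : 'S_n) ewens theta s * convolve_seq P X (k :: cycle_type s) f x.
Proof.
move=> Lf; have iE (s : 'S_n) : L1 P (fun t => convolve_seq P X (cycle_type s) f (x + X k t)).
  by apply: (lip_L1 iX _ _ (L := L)); exact: convolve_seq_lip.
rewrite /convolve /ewens_op mean_sum => [|s]; last exact: L1Z.
by apply: eq_bigr => s _; rewrite meanZ.
Qed.

(** Splitting off the cycle of a marked point: the weights [wgt] describe its
    length as in the Feller coupling. *)
Lemma ewens_op_rec L f n x : lip L f ->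
  n.+1%:R * wgt n.+1 * ewens_op n.+1 f x =
  theta * \sum_(a < n.+1) wgt (n - a) * convolve P X a.+1 (ewens_op (n - a) f) x.
Proof.
move=> Lf; have nf0 m : m`!%:R != 0 :> R by rewrite pnatr_eq0 -lt0n fact_gt0.
apply: (mulfI (nf0 n)).
rewrite 2!mulrA -natrM [(n`! * _)%N]mulnC -factS.
rewrite (ewens_sumE _ (fun l => convolve_seq P X l f x)) cycle_sumS; last first.
  by move=> l l' /(convolve_seq_perm iX Lf) ->.
rewrite mulrCA; congr (_ * _); rewrite mulr_sumr; apply: eq_bigr => a _.
have an : (a <= n)%N by rewrite -ltnS.
have nfE : n`!%:R = (n ^_ a)%:R * (n - a)`!%:R :> R by rewrite -natrM ffact_fact.
rewrite nfE -!mulrA; congr (_ * _); rewrite mulrA (convolve_ewens_op _ _ _ Lf).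
by rewrite (ewens_sumE _ (fun l => convolve_seq P X (a.+1 :: l) f x)).
Qed.

Lemma ewens_op_lip L f n : lip L f -> lip L (ewens_op n f).
Proof.
move=> Lf x y; rewrite /ewens_op -sumrB (le_trans (ler_norm_sum _ _ _)) //.
rewrite -[leRHS]mul1r -(ewens_sum1 n) mulr_suml; apply: ler_sum => s _.
by rewrite -mulrBr normrM ger0_norm ?ewens_ge0 // ler_wpM2l ?ewens_ge0 //; exact: convolve_seq_lip.
Qed.

Lemma ewens_op_bound L f n c : lip L f -> (forall x, `|f x| <= c) ->
  forall x, `|ewens_op n f x| <= c.
Proof.
move=> Lf fc x; rewrite /ewens_op (le_trans (ler_norm_sum _ _ _)) //.
rewrite -[leRHS]mul1r -(ewens_sum1 n) mulr_suml; apply: ler_sum => s _.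
rewrite normrM ger0_norm ?ewens_ge0 // ler_wpM2l ?ewens_ge0 //.
exact: (convolve_seq_bound iX _ (L := L)).
Qed.

Lemma ewens_op_shift f n a x : ewens_op n (fun y => f (y + a)) x = ewens_op n f (x + a).
Proof. by apply: eq_bigr => s _; rewrite convolve_seq_shift. Qed.

Lemma ewens_opD L L' f g n x : lip L f -> lip L' g ->
  ewens_op n (fun y => f y + g y) x = ewens_op n f x + ewens_op n g x.
Proof.
move=> Lf Lg; rewrite /ewens_op -big_split; apply: eq_bigr => s _ /=.
by rewrite (convolve_seqD iX _ _ Lf Lg) mulrDr.
Qed.

Lemma ewens_opZ L c f n x : lip L f ->
  ewens_op n (fun y => c * f y) x = c * ewens_op n f x.
Proof.
move=> Lf; rewrite /ewens_op mulr_sumr; apply: eq_bigr => s _ /=.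
by rewrite (convolve_seqZ iX _ _ _ Lf) mulrCA.
Qed.

End EwensOperator.

Lemma exchange_triangle (V : nmodType) n (F : nat -> nat -> V) :
  \sum_(a < n) \sum_(k < n - a) F a k = \sum_(k < n) \sum_(a < n - k) F a k.
Proof.
have widen a (G : nat -> V) : \sum_(k < n - a) G k = \sum_(k < n | (a + k < n)%N) G k.
  rewrite (big_ord_widen _ _ (leq_subr a n)).
  by apply: eq_bigl => k; rewrite ltn_subRL.
under eq_bigr do rewrite widen.
rewrite (exchange_big_dep xpredT) //=; apply: eq_bigr => k _.
by rewrite (widen _ (fun a => F a k)); apply: eq_bigl => a; rewrite addnC.
Qed.

(** * Growth of the weights *)

Section Weights.
Context (R : realType) (theta : R) (theta_gt0 : 0 < theta).
Local Notation w := (wgt theta).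

Lemma wgt_rec n : n.+1%:R * w n.+1 = (theta + n%:R) * w n.
Proof. by rewrite wgtS; field; rewrite ?natr1 ?nat1r pnatr_eq0. Qed.

Lemma nwgt_le n m : (n <= m)%N -> n%:R * w n <= m%:R * w m.
Proof.
elim: m => [|m IH]; first by rewrite leqn0 => /eqP ->.
rewrite leq_eqVlt => /orP[/eqP -> //|/IH nm]; apply: le_trans nm _.
by rewrite wgt_rec mulrDl lerDr mulr_ge0 ?ltW ?wgt_gt0.
Qed.

(** By induction on [m], from [wgt_rec]. *)
Lemma nwgt_diff n m : (0 < n <= m)%N ->
  n%:R * (m%:R * w m - n%:R * w n) <= theta * (m - n)%:R * (m%:R * w m).
Proof.
move=> /andP[n0]; elim: m => [|m IH]; first by case: n n0.
rewrite leq_eqVlt => /orP[/eqP <-|nm]; first by rewrite subrr subnn !mulr0 mul0r.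
have {IH} := IH nm; rewrite subSn // wgt_rec -natr1.
have nmw : n%:R * w m <= m%:R * w m.
  by rewrite ler_pM2r ?wgt_gt0 // ler_nat.
have w0 : 0 < w m by exact: wgt_gt0.
set b := (m - n)%:R; set W := w m in nmw w0 *; set U := w n; have b0 : 0 <= b by rewrite ler0n.
have m0 : 0 <= m%:R :> R by rewrite ler0n.
have t1 : 0 <= theta * b * (theta * W) by rewrite !mulr_ge0 // ltW.
have t2 : 0 <= theta * (theta * W) by rewrite !mulr_ge0 // ltW.
have t3 : theta * (n%:R * W) <= theta * (m%:R * W) by rewrite ler_pM2l.
nra.
Qed.

(** The two cases are [N <= 2 a], where the right-hand side is large, and
    [a < N / 2], where [nwgt_diff] applies. *)
Lemma nwgt_ratio_le N a : (a <= N)%N -> (0 < N)%N ->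
  1 - (N - a)%:R * w (N - a) / (N%:R * w N) <= (2 + 2 * theta) * a%:R / N%:R.
Proof.
move=> aN N0; have NR : 0 < N%:R :> R by rewrite ltr0n.
have v0 : 0 < N%:R * w N by rewrite mulr_gt0 // wgt_gt0.
have aR : 0 <= a%:R :> R by rewrite ler0n.
have q0 : 0 <= (N - a)%:R * w (N - a) / (N%:R * w N).
  by rewrite divr_ge0 ?mulr_ge0 // ltW // wgt_gt0.
rewrite ler_pdivlMr //; have [Na|Na] := leqP N (a.*2).
  have : N%:R <= 2 * a%:R :> R by rewrite mulr_natl -mulrnA muln2 ler_nat.
  have := mulr_ge0 q0 (ltW NR); have := mulr_ge0 (ltW theta_gt0) aR.
  set q := _ / _; move: (N%:R : R) (a%:R : R) q => N' a' q; nra.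
have n0 : (0 < N - a)%N by lia.
have := @nwgt_diff (N - a) N; rewrite n0 leq_subr subKn // => /(_ isT).
have n2 : N%:R <= 2 * (N - a)%:R :> R by rewrite mulr_natl -mulrnA muln2 ler_nat; lia.
set v := N%:R * w N in v0 q0 *; set u := (N - a)%:R * w (N - a) in q0 *.
set n := (N - a)%:R in n2 * => nvu.
have nR : 0 < n by rewrite ltr0n.
have -> : 1 - u / v = (v - u) / v by field; rewrite gt_eqF.
rewrite mulrAC ler_pdivrMr //.
rewrite -(ler_pM2l nR); have : N%:R * (n * (v - u)) <= N%:R * (theta * a%:R * v) by rewrite ler_pM2l.
have : N%:R * (theta * a%:R * v) <= 2 * n * (theta * a%:R * v).
  apply: ler_wpM2r n2; apply: mulr_ge0; last exact: ltW.
  by apply: mulr_ge0; first exact: ltW.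
have : 0 <= n * (a%:R * v) by apply: mulr_ge0; [exact: ltW|apply: mulr_ge0 => //; exact: ltW].
clear nvu q0 n2 nR; clearbody v u n.
move: (N%:R : R) (a%:R : R) => N' a'; nra.
Qed.

End Weights.

(** * Comparison of permutations of different sizes *)

Section FellerComparison.
Context d (T : measurableType d) (R : realType) (P : probability T R).
Context (theta : R) (theta_gt0 : 0 < theta).
Context (X : nat -> T -> R).
Hypothesis iX : forall k, L1 P (X k).
Implicit Types f g : R -> R.
Local Notation w := (wgt theta).
Local Notation Eop := (ewens_op P theta X).
Local Notation m1 a := (mean P (fun t => `|X a t|)).

(** The analogue of [ewens_op n.+1] in which the cycle of the marked point does
    not contribute. *)
Definition feller_op n f x : R :=
  theta / (n.+1%:R * w n.+1) * \sum_(a < n.+1) w (n - a) * Eop (n - a) f x.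

(** The mean absolute contribution of the cycle of the marked point. *)
Definition first_cycle_mean n : R :=
  theta / (n.+1%:R * w n.+1) * \sum_(a < n.+1) w (n - a) * m1 a.+1.

Let nw_gt0 n : 0 < n.+1%:R * w n.+1 :> R.
Proof. by rewrite mulr_gt0 ?ltr0n // wgt_gt0. Qed.

Lemma first_cycle_mean_ge0 n : 0 <= first_cycle_mean n.
Proof.
rewrite /first_cycle_mean mulr_ge0 //; first by rewrite divr_ge0 // ltW.
apply: sumr_ge0 => a _; rewrite mulr_ge0 //; first by rewrite ltW // wgt_gt0.
by apply: mean_ge0.
Qed.

Lemma convolve_near L f k x : lip L f -> `|convolve P X k f x - f x| <= L * m1 k.
Proof.
move=> Lf; rewrite -[X in _ - X](mean_cst P) -meanB; first last.
- exact: L1_cst.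
- exact: (lip_L1 iX _ _ Lf).
rewrite -meanZ; last exact: L1_norm.
apply: norm_mean_le.
- by apply: L1B; [exact: (lip_L1 iX _ _ Lf)|exact: L1_cst].
- by apply: L1Z; exact: L1_norm.
- by move=> t; rewrite (le_trans (Lf _ _)) // addrAC subrr add0r.
Qed.

Lemma ewens_op_feller L f n x : lip L f ->
  `|Eop n.+1 f x - feller_op n f x| <= L * first_cycle_mean n.
Proof.
move=> Lf; have -> : Eop n.+1 f x = theta / (n.+1%:R * w n.+1) *
    \sum_(a < n.+1) w (n - a) * convolve P X a.+1 (Eop (n - a) f) x.
  apply: (mulfI (lt0r_neq0 (nw_gt0 n))).
  by rewrite (ewens_op_rec theta_gt0 iX _ _ Lf) mulrA [_ * (_ / _)]mulrC divfK // gt_eqF.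
rewrite /feller_op -mulrBr -sumrB normrM ger0_norm; last by rewrite divr_ge0 // ltW.
rewrite /first_cycle_mean mulrCA ler_wpM2l //; first by rewrite divr_ge0 // ltW.
rewrite (le_trans (ler_norm_sum _ _ _)) // mulr_sumr; apply: ler_sum => a _.
have w0 : 0 <= w (n - a) by rewrite ltW // wgt_gt0.
rewrite -mulrBr normrM ger0_norm // mulrCA ler_wpM2l //.
by apply: convolve_near; exact: ewens_op_lip.
Qed.

(** [feller_op n.+1] is a mixture of [feller_op n] and [ewens_op n.+1]: the
    latter has the weight [theta / (theta + n.+1)], which is the probability
    that a new point starts a new cycle. *)
Lemma feller_op_step L f n x : lip L f ->
  `|feller_op n.+1 f x - feller_op n f x| <=
  L * (theta / (theta + n.+1%:R) * first_cycle_mean n).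
Proof.
move=> Lf; have t0 : theta + n.+1%:R != 0 by rewrite gt_eqF // ltr_wpDr.
have -> : feller_op n.+1 f x - feller_op n f x =
    theta / (theta + n.+1%:R) * (Eop n.+1 f x - feller_op n f x).
  rewrite {1}/feller_op big_ord_recl subn0 wgt_rec //.
  under eq_bigr do rewrite lift0 subSS.
  set E1 := Eop n.+1 f x; set S := \sum_(i < n.+1) _.
  have -> : feller_op n f x = theta / (n.+1%:R * w n.+1) * S by [].
  have wn := wgt_gt0 theta_gt0 n.+1; have q0 : 0 < n.+1%:R :> R by rewrite ltr0n.
  move: (n.+1%:R : R) (w n.+1) wn q0 => q v v0 q0.
  by field; rewrite !gt_eqF // addr_gt0.
have q0 : 0 <= theta / (theta + n.+1%:R) by rewrite divr_ge0 ?addr_ge0 // ltW.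
rewrite normrM ger0_norm // mulrCA ler_wpM2l //.
exact: ewens_op_feller.
Qed.

(** Both [ewens_op] are close to the corresponding [feller_op], whose increments
    are summed up. *)
Lemma ewens_op_compare L f n m x : lip L f -> (n <= m)%N ->
  `|Eop n.+1 f x - Eop m.+1 f x| <=
  L * (first_cycle_mean n + first_cycle_mean m +
       \sum_(n <= j < m) theta / (theta + j.+1%:R) * first_cycle_mean j).
Proof.
move=> Lf nm; have L0 := lip_ge0 Lf.
have H : `|feller_op m f x - feller_op n f x| <=
    L * \sum_(n <= j < m) theta / (theta + j.+1%:R) * first_cycle_mean j.
  elim: m nm => [|m IH]; first by rewrite leqn0 => /eqP ->; rewrite subrr normr0 big_geq // mulr0.
  rewrite leq_eqVlt => /orP[/eqP <-|nm].
    by rewrite subrr normr0 big_geq // mulr0.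
  rewrite big_nat_recr //= mulrDr.
  have -> : feller_op m.+1 f x - feller_op n f x =
    (feller_op m f x - feller_op n f x) + (feller_op m.+1 f x - feller_op m f x) by ring.
  rewrite (le_trans (ler_normD _ _)) // lerD //; first exact: IH.
  exact: feller_op_step.
have := ewens_op_feller n x Lf; have := ewens_op_feller m x Lf.
rewrite !mulrDr; move: H; set A := Eop n.+1 f x; set B := Eop m.+1 f x.
set a := feller_op n f x; set b := feller_op m f x.
rewrite -(normrN (b - a)) opprB => H1 H2 H3.
have -> : A - B = (A - a) - (B - b) + (a - b) by ring.
rewrite (le_trans (ler_normD _ _)) // lerD // (le_trans (ler_normB _ _)) //.
exact: lerD.
Qed.

Section Truncated.
Variable N : nat.
Hypothesis X0 : forall k t, (N.+1 < k)%N -> X k t = 0.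

Let m10 a : (N < a)%N -> m1 a.+1 = 0.
Proof.
move=> Na; rewrite -[RHS](mean_cst P); congr mean.
by apply/funext => t; rewrite X0 // normr0.
Qed.

Lemma first_cycle_mean_trunc m : (N <= m)%N ->
  first_cycle_mean m =
  \sum_(a < N.+1) theta * w (m - a) / (m.+1%:R * w m.+1) * m1 a.+1.
Proof.
move=> Nm; rewrite /first_cycle_mean [in RHS](big_ord_widen m.+1
  (fun a => theta * w (m - a) / (m.+1%:R * w m.+1) * m1 a.+1)) //.
rewrite mulr_sumr [RHS]big_mkcond; apply: eq_bigr => a _.
by rewrite ltnS leqNgt; case: ltnP => /= Na; [rewrite m10 // !mulr0|ring].
Qed.

(** The sum over [j] telescopes, since each term is an increment of the ratio
    that [nwgt_ratio_le] compares with [1]. *)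
Lemma late_cycles_le m : (N <= m)%N ->
  \sum_(N <= j < m) theta / (theta + j.+1%:R) * first_cycle_mean j <=
  theta * (2 + 2 * theta) / N.+1%:R * \sum_(a < N.+1) m1 a.+1.
Proof.
move=> Nm; pose rho j a := (j - a)%:R * w (j - a) / (j%:R * w j).
have -> : \sum_(N <= j < m) theta / (theta + j.+1%:R) * first_cycle_mean j =
    \sum_(N <= j < m) \sum_(a < N.+1)
      theta / a.+1%:R * (rho j.+2 a.+1 - rho j.+1 a.+1) * m1 a.+1.
  apply: eq_big_nat => j /andP[Nj jm]; rewrite first_cycle_mean_trunc // mulr_sumr.
  apply: eq_bigr => a _; rewrite mulrA; congr (_ * _).
  have aj : (a <= j)%N by rewrite (leq_trans _ Nj) // -ltnS.
  rewrite /rho !subSS subSn // (wgt_rec theta (j - a)) (wgt_rec theta j.+1).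
  have -> : j.+1%:R = (j - a)%:R + a.+1%:R :> R by rewrite -natrD addnS subnK.
  have w1 := wgt_gt0 theta_gt0 j.+1; have b0 : 0 <= (j - a)%:R :> R by rewrite ler0n.
  have a0 : 0 < a.+1%:R :> R by rewrite ltr0n.
  move: (w j.+1) (w (j - a)) ((j - a)%:R : R) (a.+1%:R : R) w1 b0 a0 => u v b c u0 b0 c0.
  have bc : 0 < b + c by rewrite ltr_wpDl.
  have tbc : 0 < theta + (b + c) by rewrite addr_gt0.
  have tbc' : 0 < theta + b + c by rewrite -addrA.
  by field; rewrite !gt_eqF.
rewrite exchange_big /= mulr_sumr; apply: ler_sum => a _.
rewrite -mulr_suml -mulr_sumr ler_wpM2r ?mean_ge0 //.
rewrite (telescope_sumr (fun j => rho j.+1 a.+1)) //.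
have aN : (a.+1 <= N.+1)%N by [].
have rm : rho m.+1 a.+1 <= 1.
  rewrite ler_pdivrMr ?nw_gt0 // mul1r; apply: nwgt_le => //.
  exact: leq_subr.
have rN := nwgt_ratio_le theta_gt0 aN (ltn0Sn N).
have aR : 0 < a.+1%:R :> R by rewrite ltr0n.
rewrite mulrAC ler_pdivrMr //.
have -> : theta * (2 + 2 * theta) / N.+1%:R * a.+1%:R =
   theta * ((2 + 2 * theta) * a.+1%:R / N.+1%:R) by ring.
by rewrite ler_pM2l //; apply: le_trans rN; exact: lerB rm (lexx _).
Qed.

(** A bound, free of the larger size, for the Wasserstein distance between the
    statistics of permutations of size [N + 1] and of much larger size. *)
Definition feller_error : R :=
  theta / N.+1%:R * \sum_(a < N.+1) m1 a.+1 * (w (N - a) / w N.+1 + (2 + 2 * theta)).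

Lemma ewens_op_limit L f m x : lip L f -> (N <= m)%N ->
  `|Eop N.+1 f x - Eop m.+1 f x| <= L * (feller_error + first_cycle_mean m).
Proof.
move=> Lf Nm; have L0 := lip_ge0 Lf.
apply: le_trans (ewens_op_compare x Lf Nm) _; rewrite ler_wpM2l //.
rewrite addrAC lerD2r.
have -> : feller_error = first_cycle_mean N +
    theta * (2 + 2 * theta) / N.+1%:R * \sum_(a < N.+1) m1 a.+1.
  rewrite /feller_error first_cycle_mean_trunc // !mulr_sumr -big_split /=.
  apply: eq_bigr => a _; have wn := wgt_gt0 theta_gt0 N.+1.
  have n0 : 0 < N.+1%:R :> R by rewrite ltr0n.
  by move: (w N.+1) (N.+1%:R : R) wn n0 => v b v0 b0; field; rewrite !gt_eqF.
by rewrite lerD2l late_cycles_le.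
Qed.

Lemma first_cycle_mean_cvg0 : first_cycle_mean m @[m --> \oo] --> 0.
Proof.
pose S := theta * \sum_(a < N.+1) m1 a.+1.
have bound m : (N < m)%N -> first_cycle_mean m <= S / (m - N)%:R.
  move=> Nm; rewrite first_cycle_mean_trunc; last exact: ltnW.
  rewrite /S mulr_sumr mulr_suml; apply: ler_sum => a _.
  rewrite [leRHS]mulrAC ler_wpM2r ?mean_ge0 // -mulrA ler_pM2l //.
  have aN : (a <= N)%N by rewrite -ltnS.
  have mN : 0 < (m - N)%:R :> R by rewrite ltr0n subn_gt0.
  rewrite ler_pdivrMr // ler_pdivlMl //.
  apply: (@le_trans _ _ ((m - a)%:R * w (m - a))).
    by rewrite ler_pM2r ?wgt_gt0 // ler_nat leq_sub2l.
  by apply: nwgt_le => //; rewrite leqW // leq_subr.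
apply/cvgrPdist_le => e e0.
have S0 : 0 <= S.
  by apply: mulr_ge0; [exact: ltW|apply: sumr_ge0 => a _; exact: mean_ge0].
near=> m; rewrite sub0r normrN ger0_norm ?first_cycle_mean_ge0 //.
have Nm : (N < m)%N by near: m; exact: nbhs_infty_gt.
rewrite (le_trans (bound m Nm)) // ler_pdivrMr ?ltr0n ?subn_gt0 //.
rewrite natrB; last exact: ltnW.
rewrite -ler_pdivrMl // lerBrDr; near: m; exact: nbhs_infty_ger.
Unshelve. all: by end_near. Qed.

(** Changing a large size by a fixed amount is not noticed, uniformly over the
    test functions of given Lipschitz constant. *)
Lemma ewens_op_shift_cvg k : exists c : nat -> R, c @ \oo --> 0 /\
  forall L f m x, lip L f -> `|Eop (m.+1 + k)%N f x - Eop m.+1 f x| <= L * c m.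
Proof.
exists (fun m => first_cycle_mean m + first_cycle_mean (m + k)%N +
  \sum_(j < k) first_cycle_mean (m + j)%N); split.
  have fc i : first_cycle_mean (m + i)%N @[m --> \oo] --> 0.
    by rewrite (cvg_shiftn i (fun m => first_cycle_mean m)); exact: first_cycle_mean_cvg0.
  have sc : \sum_(j < k) first_cycle_mean (m + j)%N @[m --> \oo] --> 0.
    elim: k => [|k IH].
      by rewrite (_ : (fun m => _) = fun=> 0); [exact: cvg_cst|apply/funext => m; rewrite big_ord0].
    rewrite (_ : (fun m => _) = fun m => \sum_(j < k) first_cycle_mean (m + j)%N +
      first_cycle_mean (m + k)%N); last by apply/funext => m; rewrite big_ord_recr.
    by have := cvgD IH (fc k); rewrite addr0 => H; exact: H.
  by have := cvgD (cvgD first_cycle_mean_cvg0 (fc k)) sc; rewrite !addr0 => H; exact: H.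
move=> L f m x Lf; have L0 := lip_ge0 Lf; rewrite distrC addSn.
apply: (le_trans (ewens_op_compare x Lf (leq_addr k m))); rewrite ler_wpM2l // lerD2l.
rewrite -{1}[m]add0n big_addn addKn big_mkord; apply: ler_sum => j _.
rewrite [(j + m)%N]addnC ler_piMl ?first_cycle_mean_ge0 //.
by rewrite ler_pdivrMr ?mul1r ?lerDl // ltr_wpDr.
Qed.

End Truncated.

End FellerComparison.

Lemma wgt_ratio_cvg (R : realType) (theta : R) k : 0 < theta ->
  (wgt theta m / wgt theta (m + k)%N : R) @[m --> \oo] --> (1 : R).
Proof.
move=> t0; elim: k => [|k IH].
  rewrite (_ : (fun m => _) = fun=> 1); first exact: cvg_cst.
  by apply/funext => m; rewrite addn0 divff // gt_eqF // wgt_gt0.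
have step : (m.+1%:R / (theta + m%:R) : R) @[m --> \oo] --> (1 : R).
  apply/cvgrPdist_le => e e0; near=> m.
  have tm : 0 < theta + m%:R by rewrite ltr_wpDr.
  have -> : 1 - m.+1%:R / (theta + m%:R) = (theta - 1) / (theta + m%:R).
    by rewrite -natr1; field; rewrite gt_eqF.
  rewrite normrM normfV (gtr0_norm tm) ler_pdivrMr // -ler_pdivrMl //.
  apply: (@le_trans _ _ m%:R); last by rewrite lerDr ltW.
  near: m; exact: nbhs_infty_ger.
have stepk : ((m + k).+1%:R / (theta + (m + k)%:R) : R) @[m --> \oo] --> (1 : R).
  by rewrite (cvg_shiftn k (fun m : nat => (m.+1%:R / (theta + m%:R) : R))).
rewrite (_ : (fun m => wgt theta m / wgt theta (m + k.+1)%N) =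
  (fun m => wgt theta m / wgt theta (m + k)%N * ((m + k).+1%:R / (theta + (m + k)%:R)))).
  by rewrite -[X in _ --> X]mulr1; exact: cvgM IH stepk.
apply/funext => m /=; rewrite addnS wgtS.
have w1 := wgt_gt0 t0 (m + k); have tm : 0 < theta + (m + k)%:R by rewrite ltr_wpDr.
have n0 : 0 < (m + k).+1%:R :> R by rewrite ltr0n.
move: ((m + k).+1%:R : R) (theta + (m + k)%:R) (wgt theta (m + k)) n0 tm w1 => a b c ? ? ?.
by field; rewrite !gt_eqF.
Unshelve. all: by end_near. Qed.

(** * The size-bias identity *)

Section Palm.
Context d (T : measurableType d) (R : realType) (P : probability T R).
Context (theta : R) (theta_gt0 : 0 < theta).
Context (X : nat -> T -> R).
Hypothesis iX : forall k, L1 P (X k).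
Implicit Types f g : R -> R.
Local Notation w := (wgt theta).
Local Notation Eop := (ewens_op P theta X).
Local Notation m1 a := (mean P (fun t => `|X a t|)).
Local Notation conv := (convolve P X).

Let mX k : measurable_fun setT (X k). Proof. exact: L1_measurable (iX k). Qed.

(** Convolution with the law of [X k] weighted by [X k] itself, as in a
    size-biased distribution. *)
Definition biased k g x : R := mean P (fun t => X k t * g (x + X k t)).

Lemma biased_L1 L g c k x : lip L g -> (forall y, `|g y| <= c) ->
  L1 P (fun t => X k t * g (x + X k t)).
Proof.
move=> Lg gc; apply: (L1_le _ (L1Z c (L1_norm (iX k)))) => [|t].
  by apply: measurable_funM => //; exact: (lip_measurable_shift iX _ _ Lg).
by rewrite normrM mulrC ler_wpM2r.
Qed.

Lemma biased_bound L g c k x : lip L g -> (forall y, `|g y| <= c) ->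
  `|biased k g x| <= c * m1 k.
Proof.
move=> Lg gc; rewrite -meanZ; last exact: L1_norm.
apply: norm_mean_le; first exact: (biased_L1 _ _ Lg gc).
  exact: (L1Z _ (L1_norm (iX k))).
by move=> t; rewrite normrM mulrC ler_wpM2r.
Qed.

Lemma biasedB L L' g h c c' k x : lip L g -> lip L' h ->
  (forall y, `|g y| <= c) -> (forall y, `|h y| <= c') ->
  biased k g x - biased k h x = biased k (fun y => g y - h y) x.
Proof.
move=> Lg Lh gc hc; rewrite /biased -meanB.
- by congr mean; apply/funext => t; rewrite mulrBr.
- exact: (biased_L1 _ _ Lg gc).
- exact: (biased_L1 _ _ Lh hc).
Qed.

Lemma convolve_biased L g c j k x : lip L g -> (forall y, `|g y| <= c) ->
  conv j (biased k g) x = biased k (conv j g) x.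
Proof.
move=> Lg gc.
pose G (u : T * T) := X k u.2 * g (x + X j u.1 + X k u.2).
have m2 i : measurable_fun setT (fun u : T * T => X i u.2).
  by apply: (measurableT_comp (mX i)); exact: measurable_snd.
have mG : measurable_fun setT G.
  apply: measurable_funM => //; apply: (measurableT_comp (lip_measurable Lg)).
  apply: measurable_funD => //; apply: measurable_funD => //.
  by apply: (measurableT_comp (mX j)); exact: measurable_fst.
rewrite /convolve /biased [LHS](mean_swap mG (L1_cst P 0) (L1Z c (L1_norm (iX k)))).
  congr mean; apply/funext => t; rewrite /G /= -meanZ.
    by congr mean; apply/funext => t'; rewrite addrAC.
  by apply: (lip_L1 iX _ _ Lg).
by move=> u; rewrite add0r normrM mulrC ler_wpM2r.
Qed.

Lemma biased_sum L g c k x n (F : 'I_n -> R -> R) (a : 'I_n -> R) :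
  (forall i, lip L (F i)) -> (forall i y, `|F i y| <= c) ->
  (forall y, g y = \sum_i a i * F i y) ->
  biased k g x = \sum_i a i * biased k (F i) x.
Proof.
move=> LF Fc gE; rewrite /biased.
have -> : (fun t => X k t * g (x + X k t)) =
    fun t => \sum_i a i * (X k t * F i (x + X k t)).
  apply/funext => t; rewrite gE mulr_sumr.
  by apply: eq_bigr => i _; rewrite mulrCA.
rewrite mean_sum => [|i]; last by apply/L1Z/(biased_L1 _ _ (LF i) (Fc i)).
by apply: eq_bigr => i _; rewrite meanZ //; exact: (biased_L1 _ _ (LF i) (Fc i)).
Qed.

(** Summing over the cycles, each of them biased by its own contribution and
    removed from the permutation. The proof is an induction on [n] through
    [ewens_op_rec]. *)
Lemma palm L L' f c n x : lip L f -> lip L' (fun y => y * f y) ->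
  (forall y, `|f y| <= c) ->
  w n * (Eop n (fun y => y * f y) x - x * Eop n f x) =
  theta * \sum_(k < n) w (n.-1 - k) / k.+1%:R * biased k.+1 (Eop (n.-1 - k) f) x.
Proof.
move=> Lf Lxf fc.
have LE j : lip L (Eop j f) by exact: ewens_op_lip.
have Ec j y : `|Eop j f y| <= c by exact: ewens_op_bound Lf fc _.
elim/ltn_ind: n x => -[|n] IH x.
  rewrite big_ord0 mulr0 /ewens_op; rewrite !big_mkcond /= mulr_sumr -sumrB.
  rewrite big1 ?mulr0 // => s _.
  have -> : cycle_type s = [::] by rewrite /cycle_type /card_seq (_ : porbits s = finset.set0) ?enum_set0 //;
    apply/finset.setP => C; rewrite inE; apply/imsetP => -[[]].
  by rewrite /= mulrCA subrr.
have n0 : n.+1%:R != 0 :> R by rewrite pnatr_eq0.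
apply: (mulfI n0); rewrite mulrA mulrBr [in X in _ - X]mulrCA.
rewrite (ewens_op_rec theta_gt0 iX _ _ Lxf) (ewens_op_rec theta_gt0 iX _ _ Lf).
have rec a : (a <= n)%N -> w (n - a) * conv a.+1 (Eop (n - a) (fun y => y * f y)) x =
    x * (w (n - a) * conv a.+1 (Eop (n - a) f) x) + w (n - a) * biased a.+1 (Eop (n - a) f) x +
    theta * \sum_(k < n - a) w (n - a.+1 - k) / k.+1%:R *
      biased k.+1 (conv a.+1 (Eop (n - a.+1 - k) f)) x.
  move=> an.
  have Lg j : lip L' (fun y => y * f y) by [].
  have i0 : L1 P (fun t => Eop (n - a) f (x + X a.+1 t)) by exact: (lip_L1 iX _ _ (LE _)).
  have i1 : L1 P (fun t => X a.+1 t * Eop (n - a) f (x + X a.+1 t)).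
    exact: (biased_L1 _ _ (LE _) (Ec _)).
  have Lb k j : lip (L * m1 k) (biased k (Eop j f)).
    move=> y y'; rewrite /biased -meanB; try exact: (biased_L1 _ _ (LE _) (Ec _)).
    rewrite mulrAC -meanZ; last exact: L1_norm.
    apply: norm_mean_le.
    - by apply: L1B; exact: (biased_L1 _ _ (LE _) (Ec _)).
    - exact: (L1Z _ (L1_norm (iX k))).
    - move=> t; rewrite -mulrBr normrM mulrC ler_wpM2r //.
      exact: lip_shift.
  have ib k j : L1 P (fun t => biased k (Eop j f) (x + X a.+1 t)) by exact: (lip_L1 iX _ _ (Lb k j)).
  rewrite {1}/convolve -meanZ; last by apply: (lip_L1 iX _ _ (L := L')); exact: ewens_op_lip.
  have -> : (fun t => w (n - a) * Eop (n - a) (fun y => y * f y) (x + X a.+1 t)) =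
     fun t => (x * (w (n - a) * Eop (n - a) f (x + X a.+1 t)) +
               w (n - a) * (X a.+1 t * Eop (n - a) f (x + X a.+1 t))) +
       theta * \sum_(k < n - a) w (n - a.+1 - k) / k.+1%:R *
          biased k.+1 (Eop (n - a.+1 - k) f) (x + X a.+1 t).
    apply/funext => t; have := IH (n - a)%N _ (x + X a.+1 t).
    rewrite ltnS leq_subr => /(_ isT); rewrite mulrBr => /eqP; rewrite subr_eq => /eqP ->.
    by rewrite -subnS; ring.
  have iS : L1 P (fun t => \sum_(k < n - a) w (n - a.+1 - k) / k.+1%:R *
          biased k.+1 (Eop (n - a.+1 - k) f) (x + X a.+1 t)).
    by apply: L1_sum => k; exact: L1Z.
  rewrite meanD; [|by apply: L1D; do 2?[apply: L1Z]|exact: L1Z].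
  rewrite meanD; [|by do 2 apply: L1Z|exact: L1Z].
  rewrite !meanZ //; last exact: L1Z.
  congr (_ + _ * _); rewrite mean_sum => [|k]; last exact: L1Z.
  apply: eq_bigr => k _; rewrite meanZ //; congr (_ * _).
  exact: (convolve_biased _ _ _ (LE _) (Ec _)).
transitivity (theta * \sum_(a < n.+1) w (n - a) * biased a.+1 (Eop (n - a) f) x +
   theta * \sum_(a < n.+1) theta * \sum_(k < n - a) w (n - a.+1 - k) / k.+1%:R *
      biased k.+1 (conv a.+1 (Eop (n - a.+1 - k) f)) x).
  rewrite (eq_bigr _ (fun (a : 'I_n.+1) _ => rec a (leq_ord a))) !big_split /= -mulr_sumr.
  by ring.
have tri : \sum_(a < n.+1) theta * \sum_(k < n - a) w (n - a.+1 - k) / k.+1%:R *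
      biased k.+1 (conv a.+1 (Eop (n - a.+1 - k) f)) x =
   \sum_(k < n) (n - k)%:R / k.+1%:R * w (n - k) * biased k.+1 (Eop (n - k) f) x.
  rewrite big_ord_recr /= subnn big_ord0 mulr0 addr0 -mulr_sumr.
  rewrite (exchange_triangle n (fun a k => w (n - a.+1 - k) / k.+1%:R *
      biased k.+1 (conv a.+1 (Eop (n - a.+1 - k) f)) x)) mulr_sumr.
  apply: eq_bigr => k _; have kn : (k < n)%N by [].
  have w0 := wgt_gt0 theta_gt0 (n - k); have nk : 0 < (n - k)%:R :> R by rewrite ltr0n subn_gt0.
  have nkE : (n - k)%N = (n - k.+1).+1 by lia.
  rewrite (@biased_sum L (Eop (n - k) f) c k.+1 x (n - k)%N
    (fun a : 'I_(n - k) => conv a.+1 (Eop (n - a.+1 - k) f))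
    (fun a : 'I_(n - k) => theta / ((n - k)%:R * w (n - k)) * w (n - a.+1 - k))).
  - rewrite !mulr_sumr; apply: eq_bigr => a _.
    have k0 : 0 < k.+1%:R :> R by rewrite ltr0n.
    move: (w (n - k)) ((n - k)%:R : R) (k.+1%:R : R) w0 nk k0 => u v b u0 v0 b0.
    by field; rewrite !gt_eqF.
  - by move=> a; apply: convolve_lip.
  - by move=> a y; apply: (convolve_bound iX _ (LE _) (Ec _)).
  - move=> y; apply: (mulfI (x := (n - k)%:R * w (n - k))); first by rewrite gt_eqF // mulr_gt0.
    move: w0 nk; rewrite nkE => w0 nk.
    rewrite (ewens_op_rec theta_gt0 iX _ _ Lf) !mulr_sumr; apply: eq_bigr => a _.
    have -> : (n - a.+1 - k = n - k.+1 - a)%N by lia.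
    move: (w (n - k.+1).+1) ((n - k.+1).+1%:R : R) w0 nk => u v u0 v0.
    by field; rewrite !gt_eqF.
rewrite tri -mulrDr mulrCA; congr (_ * _); rewrite /= mulr_sumr.
have -> : \sum_(k < n) (n - k)%:R / k.+1%:R * w (n - k) * biased k.+1 (Eop (n - k) f) x =
   \sum_(k < n.+1) (n - k)%:R / k.+1%:R * w (n - k) * biased k.+1 (Eop (n - k) f) x.
  by rewrite big_ord_recr /= subnn !mul0r addr0.
rewrite -big_split /=; apply: eq_bigr => k _.
have kn : (k <= n)%N by rewrite -ltnS.
have -> : n.+1%:R = (n - k)%:R + k.+1%:R :> R by rewrite -natrD addnS subnK.
by field; rewrite ?natr1 ?nat1r pnatr_eq0.
Qed.

End Palm.

(** * Stein's inequality *)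

Section SteinInequality.
Context d (T : measurableType d) (R : realType) (P : probability T R).
Context (theta : R) (theta_gt0 : 0 < theta).
Context (X : nat -> T -> R).
Hypothesis iX : forall k, L1 P (X k).
Hypothesis iX2 : forall k, L1 P (fun t => X k t ^+ 2).
Implicit Types f g : R -> R.
Local Notation w := (wgt theta).
Local Notation Eop := (ewens_op P theta X).
Local Notation m1 a := (mean P (fun t => `|X a t|)).

Variable N : nat.

(** In large permutations the mean number of cycles of length [a] tends to
    [theta / a]. *)
Definition ewens_mean : R := theta * \sum_(a < N.+1) mean P (X a.+1) / a.+1%:R.
Definition ewens_variance : R :=
  theta * \sum_(a < N.+1) mean P (fun t => X a.+1 t ^+ 2) / a.+1%:R.

Hypothesis X0 : forall k t, (N.+1 < k)%N -> X k t = 0.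

Let biased0 k g x : (N.+1 < k)%N -> biased P X k g x = 0.
Proof.
move=> Nk; rewrite /biased -[RHS](mean_cst P); congr mean.
by apply/funext => t; rewrite X0 // mul0r.
Qed.

(** For large permutations the biasing weights of [palm] tend to one, and
    removing a cycle of bounded length is not noticed. *)
Lemma palm_limit L L' f c : lip L f -> lip L' (fun y => y * f y) ->
  (forall y, `|f y| <= c) ->
  exists e : nat -> R, e @ \oo --> 0 /\ forall m,
   `|Eop (m + N).+2 (fun y => y * f y) 0 -
     theta * \sum_(k < N.+1) biased P X k.+1 (Eop (m + N).+2 f) 0 / k.+1%:R| <= e m.
Proof.
move=> Lf Lxf fc.
have c0 : 0 <= c by apply: le_trans (fc 0).
have LE j : lip L (Eop j f) by exact: ewens_op_lip.
have Ec j y : `|Eop j f y| <= c by exact: ewens_op_bound Lf fc _.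
have shift k : exists u : nat -> R, u @ \oo --> 0 /\ forall m x,
    `|Eop (m.+1 + k.+1)%N f x - Eop m.+1 f x| <= u m.
  have [u [u0 uP]] := ewens_op_shift_cvg theta_gt0 iX X0 k.+1.
  exists (fun m => L * u m); split; last by move=> m x; exact: uP.
  by rewrite -(mulr0 L); apply: cvgM => //; exact: cvg_cst.
have {shift} [u uP] := choice shift.
pose e m := theta * \sum_(k < N.+1)
  (`|1 - w (m + (N - k)).+1 / w ((m + (N - k)).+1 + k.+1)| * c + u k (m + (N - k))%N) *
  m1 k.+1 / k.+1%:R.
exists e; split.
  rewrite -(mulr0 theta); apply: cvgM; first exact: cvg_cst.
  have term k : ((`|1 - w (m + (N - k)).+1 / w ((m + (N - k)).+1 + k.+1)| * c +
     u k (m + (N - k))%N) * m1 k.+1 / k.+1%:R) @[m --> \oo] --> 0.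
    have r1 : `|1 - w (m + (N - k)).+1 / w ((m + (N - k)).+1 + k.+1)| @[m --> \oo] --> 0.
      rewrite (_ : (fun m => _) = fun m =>
        `|1 - w (m + (N - k).+1) / w ((m + (N - k).+1) + k.+1)|); last first.
        by apply/funext => m; rewrite !addnS.
      rewrite (cvg_shiftn (N - k).+1 (fun m => `|1 - w m / w (m + k.+1)%N|)).
      have : (fun m => `|1 - w m / w (m + k.+1)%N|) @ \oo --> `|1 - 1 : R|.
        apply: cvg_norm; apply: cvgB; first exact: cvg_cst.
        exact: wgt_ratio_cvg.
      by rewrite subrr normr0.
    have u0 : u k (m + (N - k))%N @[m --> \oo] --> 0.
      by rewrite (cvg_shiftn (N - k) (u k)); exact: (uP k).1.
    have : ((`|1 - w (m + (N - k)).+1 / w ((m + (N - k)).+1 + k.+1)| * c +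
      u k (m + (N - k))%N) * (m1 k.+1 / k.+1%:R)) @[m --> \oo] -->
      (0 * c + 0) * (m1 k.+1 / k.+1%:R).
      apply: cvgM; last exact: cvg_cst.
      by apply: cvgD => //; apply: cvgM => //; exact: cvg_cst.
    rewrite mul0r addr0 mul0r => H; apply: cvg_trans H; apply: near_eq_cvg.
    by apply: nearW => m; rewrite /= mulrA.
  elim: (N.+1) => [|n IH].
    by rewrite (_ : (fun m => _) = fun=> 0); [exact: cvg_cst|apply/funext => m; rewrite big_ord0].
  rewrite (_ : (fun m => _) = fun m => \sum_(k < n)
    (`|1 - w (m + (N - k)).+1 / w ((m + (N - k)).+1 + k.+1)| * c + u k (m + (N - k))%N) *
    m1 k.+1 / k.+1%:R + (`|1 - w (m + (N - n)).+1 / w ((m + (N - n)).+1 + n.+1)| * c +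
     u n (m + (N - n))%N) * m1 n.+1 / n.+1%:R); last by apply/funext => m; rewrite big_ord_recr.
  by have := cvgD IH (term n); rewrite addr0 => H; exact: H.
move=> m; set M := (m + N).+1.
have wM : 0 < w M.+1 by exact: wgt_gt0.
have -> : Eop M.+1 (fun y => y * f y) 0 =
    theta * \sum_(k < N.+1) w (M - k) / w M.+1 * biased P X k.+1 (Eop (M - k) f) 0 / k.+1%:R.
  apply: (mulfI (lt0r_neq0 wM)).
  have := palm theta_gt0 iX M.+1 0 Lf Lxf fc; rewrite mul0r subr0 => ->.
  rewrite [RHS]mulrCA /=; congr (_ * _); rewrite mulr_sumr.
  rewrite [RHS](big_ord_widen M.+1 (fun k : nat => w M.+1 *
    (w (M - k) / w M.+1 * biased P X k.+1 (Eop (M - k) f) 0 / k.+1%:R))); last first.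
    by rewrite /M !ltnS leqW // leq_addl.
  rewrite [RHS]big_mkcond /=; apply: eq_bigr => k _; rewrite ltnS.
  case: leqP => Nk; last by rewrite biased0 ?mulr0.
  have k0 : 0 < k.+1%:R :> R by rewrite ltr0n.
  by move: (w M.+1) (k.+1%:R : R) wM k0 => v b v0 b0; field; rewrite !gt_eqF.
rewrite -mulrBr normrM gtr0_norm // ler_pM2l // -sumrB.
apply: (le_trans (ler_norm_sum _ _ _)); apply: ler_sum => k _.
have kN : (k <= N)%N by rewrite -ltnS.
have MkE : (M - k)%N = (m + (N - k)).+1 by rewrite /M; lia.
have ME : M.+1 = ((m + (N - k)).+1 + k.+1)%N by rewrite /M; lia.
have k0 : 0 < k.+1%:R :> R by rewrite ltr0n.
rewrite -mulrBl normrM normfV (gtr0_norm k0) ler_pM2r ?invr_gt0 //.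
rewrite MkE ME; set r := w _ / w _; set j := (m + (N - k)).+1.
set b1 := biased _ _ _ _ _; set b2 := biased _ _ _ _ _.
have -> : r * b1 - b2 = (b1 - b2) - (1 - r) * b1 by ring.
rewrite (le_trans (ler_normB _ _)) // addrC [leRHS]mulrDl lerD //.
  rewrite normrM -mulrA ler_wpM2l //.
  exact: (biased_bound iX _ _ (LE _) (Ec _)).
rewrite /b1 /b2 (biasedB iX _ _ (LE _) (LE _) (Ec _) (Ec _)).
have Lsub : lip (L + L) (fun y => Eop j f y - Eop (j + k.+1) f y).
  move=> y y'; have -> : Eop j f y - Eop (j + k.+1) f y - (Eop j f y' - Eop (j + k.+1) f y') =
    (Eop j f y - Eop j f y') - (Eop (j + k.+1) f y - Eop (j + k.+1) f y') by ring.
  by rewrite mulrDl (le_trans (ler_normB _ _)) // lerD //; exact: LE.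
apply: (biased_bound iX _ _ Lsub) => y; rewrite distrC.
exact: (uP k).2.
Qed.

(** Expanding [f (x + X_k)] to first order in the identity of [palm] gives Stein's
    identity for a Gaussian variable, up to [rho]. The expansion is made at a
    size tending to infinity, where the weights of the identity are
    [theta / k]; the return to size [N + 1] costs [feller_error]. *)
Theorem stein_inequality L L1' L2 L3 c (f f1 : R -> R) (rho : R -> R) :
  lip L f -> lip L1' f1 -> lip L2 (fun y => y * f y) -> (forall y, `|f y| <= c) ->
  (forall x y, `|f (x + y) - f x - y * f1 x| <= rho y) ->
  (forall k, L1 P (fun t => `|X k t| * rho (X k t))) ->
  lip L3 (fun x => ewens_variance * f1 x - (x - ewens_mean) * f x) ->
  `|Eop N.+1 (fun x => ewens_variance * f1 x - (x - ewens_mean) * f x) 0| <=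
  L3 * feller_error P theta X N +
  theta * \sum_(a < N.+1) mean P (fun t => `|X a.+1 t| * rho (X a.+1 t)) / a.+1%:R.
Proof.
move=> Lf Lf1 Lxf fc taylor irho; set h := (fun x => _) => Lh.
set Rem := theta * \sum_(a < N.+1) _.
have LE j : lip L (Eop j f) by exact: ewens_op_lip.
have Ec j y : `|Eop j f y| <= c by exact: ewens_op_bound Lf fc _.
have hE j : Eop j h 0 = ewens_variance * Eop j f1 0 -
    Eop j (fun y => y * f y) 0 + ewens_mean * Eop j f 0.
  rewrite -(ewens_opZ theta iX _ _ _ Lf) -(ewens_opZ theta iX _ _ _ Lf1) -mulN1r.
  rewrite -(ewens_opZ theta iX _ _ _ Lxf).
  rewrite -(ewens_opD theta iX _ _ (lipZ _ Lf1) (lipZ _ Lxf)).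
  rewrite -(ewens_opD theta iX _ _ (lipD (lipZ _ Lf1) (lipZ _ Lxf)) (lipZ _ Lf)).
  by congr (ewens_op _ _ _ _ _ _); apply/funext => x; rewrite /h; ring.
have main j : `|ewens_variance * Eop j f1 0 + ewens_mean * Eop j f 0 -
    theta * \sum_(k < N.+1) biased P X k.+1 (Eop j f) 0 / k.+1%:R| <= Rem.
  rewrite /ewens_variance /ewens_mean -!mulrA -mulrDr -mulrBr normrM gtr0_norm // ler_pM2l //.
  rewrite !mulr_suml -big_split -sumrB /= (le_trans (ler_norm_sum _ _ _)) //.
  apply: ler_sum => k _; have k0 : 0 < k.+1%:R :> R by rewrite ltr0n.
  set A := Eop j f1 0; set B := Eop j f 0.
  have -> : mean P (fun t => X k.+1 t ^+ 2) / k.+1%:R * A +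
      mean P (X k.+1) / k.+1%:R * B - biased P X k.+1 (Eop j f) 0 / k.+1%:R =
      (A * mean P (fun t => X k.+1 t ^+ 2) + B * mean P (X k.+1) - biased P X k.+1 (Eop j f) 0) / k.+1%:R.
    by ring.
  rewrite normrM normfV (gtr0_norm k0) ler_pM2r ?invr_gt0 //.
  have ib := biased_L1 iX k.+1 0 (LE j) (Ec j).
  rewrite /biased -!meanZ // -meanD; [|exact: L1Z|exact: L1Z].
  rewrite -meanB //; last by apply: L1D; exact: L1Z.
  apply: norm_mean_le => // [|t].
    by apply: L1B => //; apply: L1D; exact: L1Z.
  set y := X k.+1 t; rewrite add0r.
  have -> : A * y ^+ 2 + B * y - y * Eop j f y =
    - (y * (Eop j f y - B - y * A)) by ring.
  rewrite normrN normrM ler_wpM2l //.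
  have -> : Eop j f y - B - y * A =
      Eop j (fun x => f (x + y) + -1 * f x + - y * f1 x) 0.
    rewrite (ewens_opD theta iX _ _ (lipD (lip_shift y Lf) (lipZ _ Lf)) (lipZ _ Lf1)).
    rewrite (ewens_opD theta iX _ _ (lip_shift y Lf) (lipZ _ Lf)).
    rewrite (ewens_opZ theta iX _ _ _ Lf) (ewens_opZ theta iX _ _ _ Lf1).
    by rewrite ewens_op_shift add0r /A /B; ring.
  apply: (ewens_op_bound theta_gt0 iX _ (lipD (lipD (lip_shift y Lf) (lipZ _ Lf)) (lipZ _ Lf1))) => x.
  by rewrite mulN1r mulNr; exact: taylor.
have [e [e0 eP]] := palm_limit Lf Lxf fc.
have bound m : `|Eop N.+1 h 0| <= L3 * feller_error P theta X N + Rem +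
    (e m + L3 * first_cycle_mean P theta X (m + N).+1).
  have NM : (N <= (m + N).+1)%N by rewrite leqW // leq_addl.
  have := ewens_op_limit theta_gt0 iX X0 0 Lh NM; rewrite mulrDr.
  have := eP m; have := main (m + N).+2; rewrite (hE (m + N).+2).
  set S := theta * _; set A := ewens_variance * _; set B := ewens_mean * _.
  set D := Eop _ (fun y => y * f y) 0; set H := Eop N.+1 h 0 => mA mD mH.
  have -> : H = (H - (A - D + B)) + ((A + B - S) - (D - S)) by ring.
  rewrite (le_trans (ler_normD _ _)) //.
  have := ler_normB (A + B - S) (D - S); lra.
apply/ler_addgt0Pr => eta eta0.
have lim0 : (e m + L3 * first_cycle_mean P theta X (m + N).+1) @[m --> \oo] --> 0.
  have fc0 : first_cycle_mean P theta X (m + N.+1)%N @[m --> \oo] --> 0.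
    by rewrite (cvg_shiftn N.+1 (first_cycle_mean P theta X));
      exact: (first_cycle_mean_cvg0 P theta_gt0 X0).
  rewrite (_ : (fun m => _) = fun m => e m + L3 * first_cycle_mean P theta X (m + N.+1)%N).
    by have := cvgD e0 (cvgM (cvg_cst L3) fc0); rewrite mulr0 addr0 => H; exact: H.
  by apply/funext => m; rewrite addnS.
have /cvgrPdist_lt /(_ _ eta0) [m _ /(_ m (leqnn m)) /= em] := lim0.
move: em; rewrite sub0r normrN => em.
by have := bound m; have := ler_norm (e m + L3 * first_cycle_mean P theta X (m + N).+1); lra.
Qed.

End SteinInequality.

(** * Powers of the weights *)

Section WeightMoments.
Context (R : realType) (theta : R) (theta_gt0 : 0 < theta).
Local Notation w := (wgt theta).

(** Young's inequality with one of the factors equal to [1]. *)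
Lemma bernoulli_powR (x q : R) : 0 <= x -> 1 < q -> 1 + q * (x - 1) <= x `^ q.
Proof.
move=> x0 q1; have q0 : 0 < q by lra.
have qi : 0 < 1 - q^-1 by rewrite subr_gt0 invf_lt1.
have := @conjugate_powR R x 1 q (1 - q^-1)^-1 x0 ler01 q0.
rewrite invr_gt0 qi invrK subrKC => /(_ isT erefl); rewrite mulr1 powR1 mul1r.
rewrite -(ler_pM2l q0) mulrDr mulrCA mulfV ?gt_eqF // mulr1 mulrBr mulr1 mulfV ?gt_eqF //.
by lra.
Qed.

Lemma powRD_le (x y q : R) : 0 <= x -> 0 <= y -> 0 < q ->
  (x + y) `^ q <= 2 `^ q * (x `^ q + y `^ q).
Proof.
move=> x0 y0 q0; wlog xy : x y x0 y0 / x <= y => [hw|].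
  by have [|/ltW] := leP x y => xy; [|rewrite addrC [x `^ _ + _]addrC]; exact: hw.
apply: (@le_trans _ _ ((2 * y) `^ q)).
  by apply: ge0_ler_powR; rewrite ?nnegrE; lra.
by rewrite powRM // ler_wpM2l ?powR_ge0 // lerDr powR_ge0.
Qed.

(** By induction on [n]; the step is Bernoulli's inequality applied to
    [(theta + n) / (n + 1)], and [q * (1 - theta)] is the rate of decay that it
    produces. *)
Lemma wgt_powR_sum q n : 1 < q -> theta < 1 -> q * (1 - theta) < 1 ->
  \sum_(m < n.+1) w m `^ q <=
  (n.+1%:R - q * (1 - theta)) / (1 - q * (1 - theta)) * w n `^ q.
Proof.
move=> q1 t1; set b := q * (1 - theta) => b1; have b0 : 0 < 1 - b by lra.
elim: n => [|n IH]; first by rewrite big_ord1 mulfV ?mul1r // gt_eqF.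
rewrite big_ord_recr /= (le_trans (lerD IH (lexx _))) //.
have n0 : 0 < n.+1%:R :> R by rewrite ltr0n.
have xn0 : 0 <= (theta + n%:R) / n.+1%:R by rewrite divr_ge0 // addr_ge0 // ltW.
have key : (n.+1%:R - b) * w n `^ q <= n.+1%:R * w n.+1 `^ q.
  have wn : 0 <= w n by rewrite ltW // wgt_gt0.
  rewrite wgtS powRM // [leRHS]mulrCA [leLHS]mulrC ler_wpM2l ?powR_ge0 // -ler_pdivrMl //.
  apply: le_trans (bernoulli_powR xn0 q1); rewrite /b -natr1.
  by rewrite le_eqVlt; apply/orP; left; apply/eqP; field; rewrite natr1 pnatr_eq0.
have -> : (n.+2%:R - b) / (1 - b) * w n.+1 `^ q =
    (n.+1%:R * w n.+1 `^ q) / (1 - b) + w n.+1 `^ q.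
  by rewrite -[n.+2%:R]natr1; field; rewrite gt_eqF.
by rewrite lerD2r mulrAC ler_pM2r ?invr_gt0.
Qed.

Lemma wgt_le n m : 1 <= theta -> (n <= m)%N -> w n <= w m.
Proof.
move=> t1; elim: m => [|m IH]; first by rewrite leqn0 => /eqP ->.
rewrite leq_eqVlt => /orP[/eqP -> //|/IH nm]; apply: le_trans nm _.
rewrite wgtS ler_peMr //; first by rewrite ltW // wgt_gt0.
by rewrite ler_pdivlMr ?ltr0n // mul1r -natr1 addrC lerD2r.
Qed.

(** The weights increase when [1 <= theta], and then the ratios are at most [1].
    Otherwise [wgt_powR_sum] applies. *)
Lemma wgt_ratio_powR_bound q : 1 < q -> q * (1 - theta) < 1 ->
  exists C, forall N,
    N.+1%:R^-1 * \sum_(a < N.+1) (w (N - a) / w N.+1 + (2 + 2 * theta)) `^ q <= C.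
Proof.
move=> q1 b1; have q0 : 0 < q by lra.
suff [C HC] : exists C, forall N, N.+1%:R^-1 * \sum_(a < N.+1) (w (N - a) / w N.+1) `^ q <= C.
  exists (2 `^ q * (C + (2 + 2 * theta) `^ q)) => N.
  apply: (@le_trans _ _ (N.+1%:R^-1 * \sum_(a < N.+1) 2 `^ q *
      ((w (N - a) / w N.+1) `^ q + (2 + 2 * theta) `^ q))).
    rewrite ler_pM2l ?invr_gt0 ?ltr0n //; apply: ler_sum => a _.
    apply: powRD_le => //; first by rewrite divr_ge0 // ltW // wgt_gt0.
    by rewrite addr_ge0 // mulr_ge0 // ltW.
  rewrite -mulr_sumr mulrCA ler_pM2l ?powR_gt0 // big_split /= mulrDr lerD //.
  by rewrite sumr_const card_ord -[X in _ * X]mulr_natl mulKf // pnatr_eq0.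
have [t1|t1] := leP 1 theta.
  exists 1 => N; rewrite ler_pdivrMl ?ltr0n // mulr1.
  rewrite -[N.+1 in leRHS]card_ord -sumr_const; apply: ler_sum => a _.
  apply: (@le_trans _ _ (1 `^ q)); last by rewrite powR1.
  apply: ge0_ler_powR; rewrite ?nnegrE //; first exact: ltW.
    by rewrite ltW // divr_gt0 // wgt_gt0.
  rewrite ler_pdivrMr ?wgt_gt0 // mul1r.
  by apply: wgt_le => //; rewrite leqW // leq_subr.
exists (2 / (1 - q * (1 - theta))) => N.
have b0 : 0 < 1 - q * (1 - theta) by lra.
have w0 : 0 < w N.+1 by exact: wgt_gt0.
rewrite ler_pdivrMl ?ltr0n //.
have -> : \sum_(a < N.+1) (w (N - a) / w N.+1) `^ q = (\sum_(m < N.+1) w m `^ q) / w N.+1 `^ q.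
  rewrite mulr_suml (reindex_inj rev_ord_inj) /=; apply: eq_bigr => a _.
  have aN : (a <= N)%N by rewrite -ltnS.
  have wa : 0 <= w a by rewrite ltW // wgt_gt0.
  rewrite subSS subKn // powRM ?invr_ge0 ?(ltW w0) //; congr (_ * _).
  by rewrite -(powR_inv1 (ltW w0)) -powRrM mulN1r powRN.
rewrite ler_pdivrMr ?powR_gt0 //.
apply: (@le_trans _ _ (\sum_(m < N.+2) w m `^ q)).
  by rewrite [leRHS]big_ord_recr lerDl powR_ge0.
apply: (le_trans (wgt_powR_sum N.+1 q1 t1 b1)).
rewrite ler_pM2r ?powR_gt0 // mulrA ler_pM2r ?invr_gt0 //.
have qt : 0 <= q * (1 - theta) by rewrite mulr_ge0 ?(ltW q0) // subr_ge0 ltW.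
rewrite -natr1; have : 1 <= N.+1%:R :> R by rewrite ler1n.
by lra.
Qed.

End WeightMoments.

(** * Errors under the moment condition *)

Section Powers.
Context (R : realType).

Lemma le1D_powR (x r p : R) : 0 <= x -> 0 <= r -> r <= p -> x `^ r <= 1 + x `^ p.
Proof.
move=> x0 r0 rp; have [x1|/ltW x1] := leP x 1.
  rewrite (@le_trans _ _ 1) ?lerDl ?powR_ge0 //.
  apply: (@le_trans _ _ (1 `^ r)); last by rewrite powR1.
  by apply: ge0_ler_powR; rewrite ?nnegrE.
by rewrite (le_trans (ler_powR x1 rp)) // lerDr.
Qed.

(** The two terms dominate for [`|y|] below and above the threshold [eta]. *)
Lemma lindeberg_le (y eta p : R) : 0 < eta -> 2 < p ->
  `|y| * Num.min `|y| (y ^+ 2) <= eta * y ^+ 2 + eta `^ (2 - p) * `|y| `^ p.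
Proof.
move=> e0 p2; have y2 : y ^+ 2 = `|y| ^+ 2 by rewrite real_normK ?num_real.
have yp0 : 0 <= `|y| `^ p by exact: powR_ge0.
have [ye|ye] := leP `|y| eta.
  apply: (@le_trans _ _ (eta * y ^+ 2)).
    by rewrite ler_pM // ?le_min ?normr_ge0 ?sqr_ge0 // ge_min lexx orbT.
  by rewrite lerDl mulr_ge0 ?powR_ge0.
apply: (@le_trans _ _ (`|y| ^+ 2)).
  by rewrite expr2 ler_wpM2l // ge_min lexx.
apply: (@le_trans _ _ (eta `^ (2 - p) * `|y| `^ p)); last first.
  by rewrite lerDr mulr_ge0 ?sqr_ge0 // ltW.
have yy : 0 < `|y| by exact: lt_trans ye.
have -> : `|y| `^ p = `|y| ^+ 2 * `|y| `^ (p - 2).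
  rewrite -powR_mulrn // -powRD; last by rewrite (gt_eqF yy) implybT.
  by rewrite subrKC.
rewrite mulrCA ler_peMr ?sqr_ge0 //.
have -> : 2 - p = - (p - 2) by ring.
rewrite powRN ler_pdivlMl ?powR_gt0 // mulr1.
by apply: ge0_ler_powR; rewrite ?nnegrE ?subr_ge0 // ltW.
Qed.

End Powers.

Section Scaled.
Context d (T : measurableType d) (R : realType) (P : probability T R).
Context (theta : R) (theta_gt0 : 0 < theta).
Context (X : nat -> T -> R) (p : R).
Hypothesis mX : forall k, measurable_fun setT (X k).
Hypothesis p_gt2 : 2 < p.
Hypothesis p_theta : theta^-1 < p.
Hypothesis iXp : forall k, L1 P (fun t => `|X k t| `^ p).
Local Notation w := (wgt theta).

Let powR2 x : `|x| `^ 2 = x ^+ 2 :> R.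
Proof. by rewrite powR_mulrn // real_normK ?num_real. Qed.

Lemma moment_L1 : forall k, L1 P (X k).
Proof.
move=> k; apply: (L1_le (mX k) (L1D (L1_cst P 1) (iXp k))) => t.
by rewrite -[leLHS]powRr1 // le1D_powR //; have := p_gt2; lra.
Qed.

Lemma moment_L2 : forall k, L1 P (fun t => X k t ^+ 2).
Proof.
move=> k; apply: (L1_le _ (L1D (L1_cst P 1) (iXp k))) => [|t].
  exact: measurable_funX.
by rewrite ger0_norm ?sqr_ge0 // -powR2 le1D_powR //; have := p_gt2; lra.
Qed.

Definition ewens_moment N : R := \sum_(a < N.+1) mean P (fun t => `|X a.+1 t| `^ p) / a.+1%:R.

(** Young's inequality with exponents [p] and [q = p / (p - 1)] separates the
    moments of the contributions from the weights; [q * (1 - theta) < 1] is the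
    condition [theta^-1 < p]. *)
Lemma feller_error_le : exists C, forall N (l : R), 0 < l ->
  feller_error P theta X N <= theta * l * (ewens_moment N / l `^ p + C).
Proof.
pose q := (1 - p^-1)^-1; have p0 : 0 < p by have := p_gt2; lra.
have p1 : p^-1 < 1 by rewrite invf_lt1 //; have := p_gt2; lra.
have qi0 : 0 < 1 - p^-1 by lra.
have q0 : 0 < q by rewrite invr_gt0.
have ip0 : 0 < p^-1 by rewrite invr_gt0.
have q1 : 1 < q by rewrite invf_gt1 // ltrBlDr ltrDl.
have qb : q * (1 - theta) < 1.
  rewrite mulrC ltr_pdivrMr // mul1r ltrD2l ltrN2.
  by rewrite -[theta]invrK ltf_pV2 ?posrE ?invr_gt0.
have [C HC] := wgt_ratio_powR_bound theta_gt0 q1 qb.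
exists C => N l l0; have N0 : 0 < N.+1%:R :> R by rewrite ltr0n.
apply: (@le_trans _ _ (theta * l * (ewens_moment N / l `^ p + N.+1%:R^-1 *
   \sum_(a < N.+1) (w (N - a) / w N.+1 + (2 + 2 * theta)) `^ q))); last first.
  by rewrite ler_pM2l ?mulr_gt0 // lerD2l.
rewrite /feller_error -!mulrA ler_pM2l // /ewens_moment mulr_suml !mulr_sumr -big_split /=.
rewrite mulr_sumr; apply: ler_sum => a _; set e := _ + (2 + 2 * theta).
have e0 : 0 <= e.
  by rewrite addr_ge0 ?divr_ge0 ?addr_ge0 ?mulr_ge0 // ltW // wgt_gt0.
have a0 : 0 < a.+1%:R :> R by rewrite ltr0n.
have aN : a.+1%:R <= N.+1%:R :> R by rewrite ler_nat.
have iXa := moment_L1 a.+1.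
have lp0 : 0 < l `^ p by rewrite powR_gt0.
apply: (@le_trans _ _ (mean P (fun t => N.+1%:R^-1 * e * `|X a.+1 t|))).
  rewrite meanZ; last exact: L1_norm.
  by rewrite le_eqVlt; apply/orP; left; apply/eqP; ring.
have i1 := L1Z (a.+1%:R * l `^ p)^-1 (iXp a.+1).
have i2 := L1_cst P (N.+1%:R^-1 * e `^ q).
apply: (@le_trans _ _ (mean P (fun t => l *
    ((a.+1%:R * l `^ p)^-1 * `|X a.+1 t| `^ p + N.+1%:R^-1 * e `^ q)))); last first.
  rewrite meanZ ?meanD ?meanZ ?mean_cst //; last exact: L1D.
  rewrite le_eqVlt; apply/orP; left; apply/eqP.
  move: (a.+1%:R : R) (N.+1%:R : R) (l `^ p) a0 N0 lp0 => b n lp b0 n0 lp0.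
  by field; rewrite !gt_eqF.
  exact: L1_cst.
apply: mean_le => [||t]; first by apply/L1Z/L1_norm.
  by apply: L1Z; exact: L1D.
set x := `|X a.+1 t|; have x0 : 0 <= x by exact: normr_ge0.
have u0 : 0 <= a.+1%:R / N.+1%:R * e by rewrite mulr_ge0 // divr_ge0.
have young : x / l * (a.+1%:R / N.+1%:R * e) <=
    x `^ p / l `^ p + a.+1%:R / N.+1%:R * e `^ q.
  have xl0 : 0 <= x / l by rewrite divr_ge0 // ltW.
  have := conjugate_powR xl0 u0 p0 q0; rewrite invrK subrKC.
  move=> /(_ erefl) /le_trans; apply; apply: lerD.
    rewrite powRM ?invr_ge0 ?(ltW l0) // -(powR_inv1 (ltW l0)) -powRrM mulN1r powRN.
    by rewrite ler_piMr ?(ltW p1) // mulr_ge0 ?invr_ge0 ?powR_ge0.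
  apply: (@le_trans _ _ ((a.+1%:R / N.+1%:R * e) `^ q)).
    by rewrite ler_piMr ?powR_ge0 // lerBlDr lerDl ltW.
  rewrite powRM ?divr_ge0 // ler_wpM2r ?powR_ge0 //.
  by apply: ge1r_powR; rewrite ?(ltW q1) // divr_gt0 //= ler_pdivrMr // mul1r.
have -> : (N.+1%:R)^-1 * e * x = l / a.+1%:R * (x / l * (a.+1%:R / N.+1%:R * e)).
  move: (a.+1%:R : R) (N.+1%:R : R) a0 N0 => b n b0 n0.
  by field; rewrite !gt_eqF.
apply: (@le_trans _ _ (l / a.+1%:R * (x `^ p / l `^ p + a.+1%:R / N.+1%:R * e `^ q))).
  by rewrite ler_pM2l // divr_gt0.
rewrite le_eqVlt; apply/orP; left; apply/eqP.
move: (a.+1%:R : R) (N.+1%:R : R) (l `^ p) a0 N0 lp0 => b n lp b0 n0 lp0.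
by field; rewrite !gt_eqF.
Qed.

End Scaled.

Section Truncation.
Context d (T : measurableType d) (R : realType) (P : probability T R).
Context (theta : R) (X : nat -> T -> R).

(** Permutations of [N + 1] points have no longer cycles, so they do not see the
    truncation, while larger permutations become comparable with them. *)
Definition truncate N k t : R := if (k <= N.+1)%N then X k t else 0.

Lemma truncateS N a : (a < N.+1)%N -> truncate N a.+1 = X a.+1.
Proof. by move=> aN; apply/funext => t; rewrite /truncate aN. Qed.

Lemma all_cycle_type n (s : 'S_n) : all (fun k => (k <= n)%N) (cycle_type s).
Proof.
by apply/allP => _ /mapP[C _ ->]; rewrite (leq_trans (max_card _)) ?card_ord.
Qed.

Lemma ewens_op_truncate N f : ewens_op P theta (truncate N) N.+1 f = ewens_op P theta X N.+1 f.
Proof.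
apply/funext => x; apply: eq_bigr => s _; congr (_ * _).
elim: (cycle_type s) (all_cycle_type s) x => //= k l IH /andP[kN lN] x.
congr mean; apply/funext => t; rewrite IH //.
by rewrite /truncate kN.
Qed.

End Truncation.

Section ScaledStein.
Context d (T : measurableType d) (R : realType) (P : probability T R).
Context (theta : R) (theta_gt0 : 0 < theta).
Context (X : nat -> T -> R) (p : R).
Hypothesis mX : forall k, measurable_fun setT (X k).
Hypothesis p_gt2 : 2 < p.
Hypothesis p_theta : theta^-1 < p.
Hypothesis iXp : forall k, L1 P (fun t => `|X k t| `^ p).

Local Notation mu N := (ewens_mean P theta X N).
Local Notation V N := (ewens_variance P theta X N).
Local Notation Mp N := (ewens_moment P X p N).

Let iX k : L1 P (X k). Proof. exact: (moment_L1 mX p_gt2 iXp). Qed.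
Let iX2 k : L1 P (fun t => X k t ^+ 2). Proof. exact: (moment_L2 mX p_gt2 iXp). Qed.

Definition standardize N (x : R) : R := (x - mu N) / Num.sqrt (V N).

Lemma lip_standardize N K h : lip K h ->
  lip (K / Num.sqrt (V N)) (fun x => h (standardize N x)).
Proof.
move=> Kh x y; apply: (le_trans (Kh _ _)).
have -> : standardize N x - standardize N y = (x - y) / Num.sqrt (V N).
  by rewrite /standardize; ring.
by rewrite normrM normfV [`|Num.sqrt _|]ger0_norm ?sqrtr_ge0 // mulrA mulrAC.
Qed.

Lemma scaled_stein N Lg Lg1 L' LH c (g g1 rho : R -> R) A B :
  0 < V N ->
  lip Lg g -> lip Lg1 g1 -> lip L' (fun y => y * g y) -> (forall y, `|g y| <= c) ->
  (forall x y, `|g (x + y) - g x - y * g1 x| <= rho y) ->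
  measurable_fun setT rho -> (forall y, 0 <= rho y) ->
  (forall y, `|y| * rho y <= A * y ^+ 2 + B * `|y| `^ p) ->
  lip LH (fun y => g1 y - y * g y) ->
  `|ewens_op P theta X N.+1
      (fun x => g1 (standardize N x) - standardize N x * g (standardize N x)) 0| <=
  LH * (feller_error P theta X N / Num.sqrt (V N)) +
  (A + B * theta * (Mp N / Num.sqrt (V N) `^ p)).
Proof.
move=> V0 Lg0 Lg1' Lyg gc taylor mrho rho0 rhoAB LHH.
set s := Num.sqrt (V N); have s0 : 0 < s by rewrite sqrtr_gt0.
have sV : V N = s ^+ 2 by rewrite sqr_sqrtr // ltW.
set m := mu N; set Y := truncate X N.
have mY k : measurable_fun setT (Y k).
  rewrite /Y /truncate; case: (k <= N.+1)%N; [exact: mX|exact: measurable_cst].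
have iYp k : L1 P (fun t => `|Y k t| `^ p).
  rewrite /Y /truncate; case: (k <= N.+1)%N; [exact: iXp|exact: L1_cst].
have iY k : L1 P (Y k) by exact: (moment_L1 mY p_gt2 iYp).
have iY2 k : L1 P (fun t => Y k t ^+ 2) by exact: (moment_L2 mY p_gt2 iYp).
have Y0 k t : (N.+1 < k)%N -> Y k t = 0 by move=> Nk; rewrite /Y /truncate leqNgt Nk.
have YS (a : 'I_N.+1) : Y a.+1 = X a.+1 by exact: truncateS.
have mE : ewens_mean P theta Y N = m.
  by congr (_ * _); apply: eq_bigr => a _; rewrite YS.
have VE : ewens_variance P theta Y N = V N.
  by congr (_ * _); apply: eq_bigr => a _; rewrite YS.
have fE : feller_error P theta Y N = feller_error P theta X N.
  by congr (_ * _); apply: eq_bigr => a _; rewrite YS.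
pose u x := (x - m) / s.
have luf (h : R -> R) K : lip K h -> lip (K / s) (fun x => h (u x)) by exact: lip_standardize.
have ineq := stein_inequality theta_gt0 iY iY2 Y0 (L := Lg / s) (L1' := `|s^-1| * (Lg1 / s))
  (L2 := `|s| * (L' / s) + `|m| * (Lg / s)) (L3 := `|s| * (LH / s)) (c := c)
  (f := fun x => g (u x)) (f1 := fun x => s^-1 * g1 (u x)) (rho := fun y => rho (y / s)).
have hE x : V N * (s^-1 * g1 (u x)) - (x - m) * g (u x) = s * (g1 (u x) - u x * g (u x)).
  by rewrite sV /u; field; rewrite gt_eqF.
have Lh : lip (`|s| * (LH / s)) (fun x => V N * (s^-1 * g1 (u x)) - (x - m) * g (u x)).
  rewrite (_ : (fun x => _) = fun x => s * (g1 (u x) - u x * g (u x))); last exact/funext.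
  by apply: lipZ; exact: luf LHH.
have ibound k : L1 P (fun t => s * (A * (s^-2 * X k t ^+ 2) + B * (s `^ p)^-1 * `|X k t| `^ p)).
  apply: L1Z; apply: L1D; last exact: L1Z.
  by do 2 apply: L1Z.
have rbound x : `|x| * rho (x / s) <= s * (A * (s^-2 * x ^+ 2) + B * (s `^ p)^-1 * `|x| `^ p).
  have xE : `|x| = s * `|x / s|.
    by rewrite normrM normfV (gtr0_norm s0) mulrC divfK // gt_eqF.
  rewrite {1}xE -[leLHS]mulrA ler_pM2l //; apply: (le_trans (rhoAB _)).
  rewrite lerD //; first by rewrite exprMn exprVn [x ^+ 2 * _]mulrC.
  by rewrite xE powRM ?(ltW s0) // mulrA mulfVK // gt_eqF // powR_gt0.
have irho k : L1 P (fun t => `|X k t| * rho (X k t / s)).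
  apply: (L1_le _ (ibound k)) => [|t].
    apply: measurable_funM; first exact: measurableT_comp.
    apply: (measurableT_comp mrho); exact: measurable_funM.
  by rewrite ger0_norm ?mulr_ge0 //; exact: rbound.
have {}ineq : `|ewens_op P theta Y N.+1 (fun x => V N * (s^-1 * g1 (u x)) - (x - m) * g (u x)) 0| <=
    `|s| * (LH / s) * feller_error P theta Y N +
    theta * \sum_(a < N.+1) mean P (fun t => `|Y a.+1 t| * rho (Y a.+1 t / s)) / a.+1%:R.
  move: ineq; rewrite VE mE; apply => //.
  - exact: luf.
  - by apply: lipZ; exact: luf.
  - rewrite (_ : (fun y => y * g (u y)) = fun y => s * (u y * g (u y)) + m * g (u y)).
      apply: lipD; apply: lipZ; [exact: luf Lyg|exact: luf].
    by apply/funext => y; rewrite /u; field; rewrite gt_eqF.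
  - move=> x y; have -> : u (x + y) = u x + y / s by rewrite /u; field; rewrite gt_eqF.
    by rewrite mulrA; exact: taylor.
  - move=> k; rewrite /Y /truncate; case: (k <= N.+1)%N => //.
    by rewrite (_ : (fun t => _) = fun=> 0); [exact: L1_cst|apply/funext => t; rewrite normr0 mul0r].
rewrite fE in ineq.
have EE : ewens_op P theta Y N.+1 (fun x => V N * (s^-1 * g1 (u x)) - (x - m) * g (u x)) 0 =
   s * ewens_op P theta X N.+1 (fun x => g1 (u x) - u x * g (u x)) 0.
  rewrite /Y ewens_op_truncate (_ : (fun x => _) = fun x => s * (g1 (u x) - u x * g (u x))); last exact/funext.
  by rewrite (ewens_opZ theta iX _ _ _ (luf _ _ LHH)).
move: ineq; rewrite EE normrM (gtr0_norm s0) => ineq.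
rewrite -(ler_pM2l s0); apply: (le_trans ineq); rewrite mulrDr lerD //.
  by rewrite le_eqVlt; apply/orP; left; apply/eqP; field; rewrite gt_eqF.
apply: (@le_trans _ _ (theta * \sum_(a < N.+1) (s * (A * s^-2 * (mean P (fun t => X a.+1 t ^+ 2) / a.+1%:R) +
    B * (s `^ p)^-1 * (mean P (fun t => `|X a.+1 t| `^ p) / a.+1%:R))))).
  rewrite ler_pM2l //; apply: ler_sum => a _; rewrite YS.
  have a0 : 0 < a.+1%:R :> R by rewrite ltr0n.
  rewrite ler_pdivrMr //.
  apply: (le_trans (mean_le (irho a.+1) (ibound a.+1) (fun t => rbound (X a.+1 t)))).
  rewrite meanZ; last by apply: L1D; [do 2 apply: L1Z|exact: L1Z].
  rewrite meanD; [|by do 2 apply: L1Z|exact: L1Z].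
  rewrite meanZ; last exact: L1Z.
  rewrite meanZ // meanZ //.
  rewrite le_eqVlt; apply/orP; left; apply/eqP; field.
  by rewrite (gt_eqF (powR_gt0 p s0)) !gt_eqF.
rewrite -mulr_sumr big_split /= -!mulr_sumr mulrCA ler_pM2l // mulrDr lerD //.
  have -> : theta * (A * s^-2 * \sum_(i < N.+1) mean P (fun t => X i.+1 t ^+ 2) / i.+1%:R) =
      A * s^-2 * V N by rewrite /ewens_variance; ring.
  by rewrite sV mulfVK // gt_eqF // exprn_gt0.
by rewrite /ewens_moment le_eqVlt; apply/orP; left; apply/eqP; ring.
Qed.

End ScaledStein.

(** * Stein's identity in the limit *)

Section SteinLimit.
Context d (T : measurableType d) (R : realType) (P : probability T R).
Context (theta : R) (theta_gt0 : 0 < theta).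
Context (X : nat -> T -> R) (p : R).
Hypothesis mX : forall k, measurable_fun setT (X k).
Hypothesis p_gt2 : 2 < p.
Hypothesis p_theta : theta^-1 < p.
Hypothesis iXp : forall k, L1 P (fun t => `|X k t| `^ p).

Local Notation V N := (ewens_variance P theta X N).
Local Notation Mp N := (ewens_moment P X p N).
Local Notation std N := (standardize P theta X N).
Local Notation Eop := (ewens_op P theta X).

Hypothesis V_cvg : V N @[N --> \oo] --> +oo.
Hypothesis M_cvg : (Mp N / Num.sqrt (V N) `^ p) @[N --> \oo] --> 0.

(** The error [feller_error] is negligible with respect to the standard deviation
    [s], by [feller_error_le] with [l = eta * s] and [eta] small. *)
Lemma stein_limit Lg Lg1 L' LH c (g g1 rho : R -> R) A B e :
  lip Lg g -> lip Lg1 g1 -> lip L' (fun y => y * g y) -> (forall y, `|g y| <= c) ->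
  (forall x y, `|g (x + y) - g x - y * g1 x| <= rho y) ->
  measurable_fun setT rho -> (forall y, 0 <= rho y) ->
  (forall y, `|y| * rho y <= A * y ^+ 2 + B * `|y| `^ p) ->
  lip LH (fun y => g1 y - y * g y) -> 0 < e ->
  \forall N \near \oo,
  `|Eop N.+1 (fun x => g1 (std N x) - std N x * g (std N x)) 0| <= A + e.
Proof.
move=> Lg0 Lg1' Lyg gc taylor mrho rho0 rhoAB LHH e0.
have LH0 := lip_ge0 LHH.
have [C HC] := feller_error_le theta_gt0 mX p_gt2 p_theta iXp.
pose D := LH * theta * `|C|.
have D0 : 0 <= D by rewrite !mulr_ge0 // ltW.
pose eta := e / (2 * (D + 1)); have eta0 : 0 < eta by rewrite divr_gt0 // mulr_gt0 //; lra.
have De : D * eta <= e / 2.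
  rewrite /eta mulrA ler_pdivrMr; last by rewrite mulr_gt0 //; lra.
  have E : e / 2 * (2 * (D + 1)) - D * e = e by field.
  by rewrite -subr_ge0 E ltW.
pose b := LH * theta * eta / eta `^ p + B * theta.
have bM : (b * (Mp N / Num.sqrt (V N) `^ p)) @[N --> \oo] --> 0.
  by rewrite -(mulr0 b); apply: cvgM => //; exact: cvg_cst.
have e2 : 0 < e / 2 by lra.
near=> N.
have V0 : 0 < V N by near: N; apply: (cvgryPgt _).1.
have s0 : 0 < Num.sqrt (V N) by rewrite sqrtr_gt0.
apply: (le_trans (scaled_stein theta_gt0 mX p_gt2 iXp V0 Lg0 Lg1' Lyg gc taylor mrho rho0 rhoAB LHH)).
have bMe : b * (Mp N / Num.sqrt (V N) `^ p) <= e / 2.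
  near: N; move: bM => /cvgrPdist_le /(_ _ e2); apply: filterS => N.
  by rewrite sub0r normrN => /(le_trans (ler_norm _)).
set s := Num.sqrt (V N) in s0 bMe *; set k := Mp N / s `^ p in bMe *.
have es0 : 0 < eta * s by rewrite mulr_gt0.
have fe : feller_error P theta X N / s <= theta * eta * (k / eta `^ p + `|C|).
  rewrite ler_pdivrMr //; apply: (le_trans (HC N _ es0)).
  have -> : theta * eta * (k / eta `^ p + `|C|) * s = theta * (eta * s) * (k / eta `^ p + `|C|) by ring.
  rewrite ler_pM2l ?(mulr_gt0 theta_gt0 es0) //; apply: lerD; last exact: ler_norm.
  rewrite powRM ?(ltW eta0) ?(ltW s0) //.
  rewrite le_eqVlt; apply/orP; left; apply/eqP; rewrite /k; field.
  by rewrite !gt_eqF // powR_gt0.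
have : LH * (feller_error P theta X N / s) <= LH * (theta * eta * (k / eta `^ p + `|C|)).
  by rewrite ler_wpM2l.
have -> : LH * (theta * eta * (k / eta `^ p + `|C|)) = LH * theta * eta / eta `^ p * k + D * eta.
  by rewrite /D; ring.
by move: bMe; rewrite /b mulrDl; lra.
Unshelve. all: by end_near. Qed.

Theorem stein_cvg Lg Lg1 L' LH c (g g1 : R -> R) A :
  lip Lg g -> lip Lg1 g1 -> lip L' (fun y => y * g y) -> (forall y, `|g y| <= c) ->
  (forall x y, `|g (x + y) - g x - y * g1 x| <= A * Num.min `|y| (y ^+ 2)) ->
  lip LH (fun y => g1 y - y * g y) ->
  Eop N.+1 (fun x => g1 (std N x) - std N x * g (std N x)) 0 @[N --> \oo] --> 0.
Proof.
move=> Lg0 Lg1' Lyg gc taylor LHH; apply/cvgrPdist_le => e e0.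
have min0 (y : R) : 0 <= Num.min `|y| (y ^+ 2) by rewrite le_min normr_ge0 sqr_ge0.
have A0 : 0 <= A.
  have := le_trans (normr_ge0 _) (taylor 0 1).
  by rewrite normr1 expr1n minxx mulr1.
have e2 : 0 < e / 2 by lra.
pose eta := e / (2 * (A + 1)); have eta0 : 0 < eta by rewrite divr_gt0 // mulr_gt0 //; lra.
have Ae : A * eta <= e / 2.
  rewrite /eta mulrA ler_pdivrMr; last by rewrite mulr_gt0 //; lra.
  have E : e / 2 * (2 * (A + 1)) - A * e = e by field.
  by rewrite -subr_ge0 E ltW.
clearbody eta.
have := @stein_limit Lg Lg1 L' LH c g g1 (fun y => A * Num.min `|y| (y ^+ 2))
  (A * eta) (A * eta `^ (2 - p)) _ Lg0 Lg1' Lyg gc taylor _ _ _ LHH e2.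
have mrho : measurable_fun setT (fun y : R => A * Num.min `|y| (y ^+ 2)).
  apply: measurable_funM => //; apply: measurable_minr; first exact: normr_measurable.
  exact: measurable_funX.
move=> /(_ mrho) H; apply: filterS (H _ _) => [N|y|y].
- by rewrite sub0r normrN => /le_trans; apply; lra.
- by rewrite mulr_ge0.
- by rewrite mulrCA -!mulrA -mulrDr ler_wpM2l //; exact: lindeberg_le.
Qed.

(** The zero function serves as derivative term, so the whole increment of [g] is
    Taylor remainder; it is bounded by the Lipschitz constant. *)
Theorem stein_tight Lg L' c (g : R -> R) e :
  lip Lg g -> lip L' (fun y => y * g y) -> (forall y, `|g y| <= c) -> 0 < e ->
  \forall N \near \oo, `|Eop N.+1 (fun x => std N x * g (std N x)) 0| <= Lg + e.
Proof.
move=> Lg0 Lyg gc e0; have L0 := lip_ge0 Lg0.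
have L0c : lip 0 (fun=> 0 : R) by exact: lip_cst.
have LH : lip L' (fun y => 0 - y * g y).
  by move=> x y; rewrite !sub0r -opprD normrN; exact: Lyg.
have := @stein_limit Lg 0 L' L' c g (fun=> 0) (fun y => Lg * `|y|) Lg 0 _ Lg0 L0c Lyg gc _ _ _ _ LH e0.
move=> H; apply: filterS (H _ _ _ _) => [N|x y||y|y].
- rewrite (_ : (fun x => 0 - std N x * g (std N x)) = fun x => -1 * (std N x * g (std N x))).
    have Ls : lip (L' / Num.sqrt (V N)) (fun x => std N x * g (std N x)).
      exact: (lip_standardize P theta X N Lyg).
    rewrite (ewens_opZ theta (moment_L1 mX p_gt2 iXp) _ _ _ Ls).
    by rewrite mulN1r normrN.
  by apply/funext => x; rewrite sub0r mulN1r.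
- by rewrite mulr0 subr0 (le_trans (Lg0 _ _)) // addrAC subrr add0r.
- by apply: measurable_funM => //; exact: normr_measurable.
- by rewrite mulr_ge0.
- by rewrite mul0r addr0 mulrCA -expr2 real_normK ?num_real.
Qed.

End SteinLimit.

(** * Stein's equation *)

Section LipschitzCalculus.
Context (R : realType).
Implicit Types f g : R -> R.

Lemma lipM L L' c c' f g : lip L f -> lip L' g ->
  (forall x, `|f x| <= c) -> (forall x, `|g x| <= c') ->
  lip (L * c' + c * L') (fun x => f x * g x).
Proof.
move=> Lf Lg fc gc x y.
have -> : f x * g x - f y * g y = (f x - f y) * g x + f y * (g x - g y) by ring.
rewrite (le_trans (ler_normD _ _)) // !normrM mulrDl lerD //.
  by rewrite mulrAC ler_pM.
by rewrite -mulrA ler_pM.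
Qed.

Lemma lip_support_bound f L A : 0 < A -> lip L f ->
  (forall x, A <= `|x| -> f x = 0) -> forall x, `|f x| <= L * (2 * A).
Proof.
move=> A0 Lf fA x; have L0 := lip_ge0 Lf; have [xA|xA] := leP A `|x|.
  by rewrite fA // normr0 !mulr_ge0 // ltW.
have fA0 : f A = 0 by apply: fA; exact: ler_norm.
have := Lf x A; rewrite fA0 subr0 => /le_trans; apply; rewrite ler_wpM2l //.
by rewrite (le_trans (ler_normB _ _)) // (gtr0_norm A0) mulr_natl mulr2n lerD2r ltW.
Qed.

Definition clip (a b y : R) : R := Num.max a (Num.min b y).

Lemma clip_lip a b : lip 1 (clip a b).
Proof.
move=> x y; rewrite mul1r /clip /Num.max /Num.min.
by repeat case: ifPn; rewrite -?leNgt => *; rewrite ler_norml;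
  have := ler_norm (x - y); have := ler_norm (y - x); rewrite distrC => *;
  apply/andP; split; lra.
Qed.

Lemma clip_itv a b y : a <= b -> a <= clip a b y <= b.
Proof.
by move=> ab; rewrite /clip le_max lexx ge_max ab ge_min lexx.
Qed.

Lemma clip_id a b y : a <= y <= b -> clip a b y = y.
Proof. by move=> /andP[ay yb]; rewrite /clip (min_idPr yb) (max_idPr ay). Qed.

Lemma derive_lip c f f1 : (forall x : R, is_derive x (1 : R) f (f1 x)) ->
  (forall x, `|f1 x| <= c) -> lip c f.
Proof.
move=> df f1c x y.
have cf : continuous f by move=> z; apply/differentiable_continuous/derivable1_diffP; case: (df z).
wlog xy : x y / x <= y => [hw|].
  by have [|/ltW] := leP x y => xy; [|rewrite distrC [`|x - y|]distrC]; exact: hw.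
have [z _ fz] := MVT_segment xy (fun z _ => df z) (continuous_subspaceT cf).
by rewrite distrC fz normrM [`|x - y|]distrC ler_wpM2r.
Qed.

(** By the mean value theorem the remainder is [(f1 z - f1 x) * y] with [z] between
    [x] and [x + y]; the bound on [f1] serves for large [y], its Lipschitz
    constant for small [y]. *)
Lemma derive_taylor c L f f1 : (forall x : R, is_derive x (1 : R) f (f1 x)) ->
  (forall x, `|f1 x| <= c) -> lip L f1 -> forall x y,
  `|f (x + y) - f x - y * f1 x| <= (2 * c + L) * Num.min `|y| (y ^+ 2).
Proof.
move=> df f1c Lf1 x y; have L0 := lip_ge0 Lf1.
have c0 : 0 <= c by apply: le_trans (f1c 0).
have cf : continuous f by move=> z; apply/differentiable_continuous/derivable1_diffP; case: (df z).
have [z zx fz] : exists2 z, `|z - x| <= `|y| & f (x + y) - f x = f1 z * y.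
  have [y0|/ltW y0] := leP 0 y.
    have xy : x <= x + y by rewrite lerDl.
    have [z] := MVT_segment xy (fun z _ => df z) (continuous_subspaceT cf).
    rewrite in_itv /= => /andP[xz zy] ->; exists z; last by congr (_ * _); ring.
    by rewrite !ger0_norm ?subr_ge0 // lerBlDl.
  have xy : x + y <= x by rewrite gerDl.
  have [z] := MVT_segment xy (fun z _ => df z) (continuous_subspaceT cf).
  rewrite in_itv /= => /andP[xz zy] fE; exists z; last first.
    by rewrite -opprB fE; ring.
  by rewrite !ler0_norm ?subr_le0 // lerN2 lerBrDl.
have -> : f (x + y) - f x - y * f1 x = (f1 z - f1 x) * y by rewrite fz; ring.
rewrite normrM.
have H1 : `|f1 z - f1 x| * `|y| <= 2 * c * `|y|.
  rewrite ler_wpM2r // (le_trans (ler_normB _ _)) //.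
  by have := f1c z; have := f1c x; lra.
have H2 : `|f1 z - f1 x| * `|y| <= L * y ^+ 2.
  rewrite -real_normK ?num_real // expr2 mulrA ler_wpM2r //.
  by rewrite (le_trans (Lf1 _ _)) // ler_wpM2l.
have y2 : 0 <= y ^+ 2 by exact: sqr_ge0.
rewrite /Num.min; case: ifPn => _; rewrite mulrDl.
  by rewrite (le_trans H1) // lerDl mulr_ge0.
by rewrite (le_trans H2) // lerDr (mulr_ge0 _ y2) // mulr_ge0.
Qed.

End LipschitzCalculus.

Section SteinEquation.
Context (R : realType).
Local Notation pdf := (normal_pdf (0 : R) 1).
Local Notation leb := (@lebesgue_measure R).

Definition gauss (h : R -> R) : R := \int[leb]_x (h x * pdf x).

Lemma pdf_gt0 x : 0 < pdf x.
Proof.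
by rewrite normal_pdfE //= mulr_gt0 ?normal_peak_gt0 // expR_gt0.
Qed.

Lemma is_derive_pdf (x : R) : is_derive x (1 : R) pdf (- x * pdf x).
Proof.
pose q (y : R) : R := - 2^-1 *: y ^+ 2.
have dq : is_derive x (1 : R) q (- x).
  by apply: is_derive_eq; rewrite /GRing.scale /=; field.
have E : pdf = normal_peak 1 \*: (expR \o q).
  apply/funext => y; rewrite normal_pdfE ?oner_neq0 // /normal_fun /q /= subr0 expr1n.
  by congr (_ * expR _); rewrite /GRing.scale //=; field.
have Ex : pdf x = normal_peak 1 * expR (q x) by rewrite E.
rewrite Ex E; apply: is_derive_eq; rewrite /GRing.scale /=; ring.
Qed.

Lemma gauss_integrable (h : R -> R) c : measurable_fun setT h ->
  (forall x, `|h x| <= c) -> leb.-integrable setT (EFin \o (fun x => h x * pdf x)).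
Proof.
move=> mh hc.
have ic : leb.-integrable setT (fun x => (c%:E * (pdf x)%:E)%E).
  by apply: integrableZl => //; exact: integrable_normal_pdf.
apply: le_integrable ic => //.
  by apply/measurable_EFinP; apply: measurable_funM => //; exact: measurable_normal_pdf.
move=> x _ /=; rewrite lee_fin !normrM ler_wpM2r //.
by rewrite (le_trans (hc x)) // ler_norm.
Qed.

Lemma gaussD (h k : R -> R) c c' :
  measurable_fun setT h -> (forall x, `|h x| <= c) ->
  measurable_fun setT k -> (forall x, `|k x| <= c') ->
  gauss (fun x => h x + k x) = gauss h + gauss k.
Proof.
move=> mh hc mk kc; rewrite /gauss -RintegralD //.
- by apply: eq_Rintegral => x _; rewrite mulrDl.
- exact: gauss_integrable mh hc.
- exact: gauss_integrable mk kc.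
Qed.

Lemma gaussZ a (h : R -> R) c : measurable_fun setT h -> (forall x, `|h x| <= c) ->
  gauss (fun x => a * h x) = a * gauss h.
Proof.
move=> mh hc; rewrite /gauss -RintegralZl //; last exact: gauss_integrable mh hc.
by apply: eq_Rintegral => x _; rewrite mulrA.
Qed.

Lemma gauss_le (h k : R -> R) c c' :
  measurable_fun setT h -> (forall x, `|h x| <= c) ->
  measurable_fun setT k -> (forall x, `|k x| <= c') ->
  (forall x, h x <= k x) -> gauss h <= gauss k.
Proof.
move=> mh hc mk kc hk; apply: le_Rintegral => //.
- exact: gauss_integrable mh hc.
- exact: gauss_integrable mk kc.
- by move=> x _; rewrite ler_wpM2r ?(ltW (pdf_gt0 _)).
Qed.

Lemma gauss_ge0 (h : R -> R) : (forall x, 0 <= h x) -> 0 <= gauss h.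
Proof. by move=> h0; apply: Rintegral_ge0 => x _; rewrite mulr_ge0 // ltW ?pdf_gt0. Qed.

Lemma gauss_indic (S : set R) : measurable S -> gauss \1_S = fine (normal_prob 0 1 S).
Proof.
move=> mS; rewrite /gauss /normal_prob /Rintegral [in RHS]integral_mkcond; congr fine.
apply: eq_integral => x _; rewrite patchE indicE.
by case: (x \in S); rewrite ?mul1r ?mul0r.
Qed.

Lemma gauss1 : gauss (fun=> 1) = 1.
Proof.
rewrite (_ : (fun=> 1) = \1_[set: R]); last by apply/funext => x; rewrite indicE in_setT.
by rewrite gauss_indic // probability_setT.
Qed.

(** The quotient by the normal density of the primitive of [u * pdf] solves Stein's
    equation [g' - x g = u]. As [u] has zero Gaussian mean, the primitive vanishes
    on both sides of the support of [u], so [g] has compact support. *)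
Lemma stein_solution (u : R -> R) L A : 0 < A -> lip L u ->
  (forall x, A <= `|x| -> u x = 0) -> gauss u = 0 ->
  exists g : R -> R, exists2 c, (forall x, `|g x| <= c) &
    (forall x, A <= `|x| -> g x = 0) /\
    (forall x, is_derive x (1 : R) g (x * g x + u x)).
Proof.
move=> A0 Lu uA gu0.
have mu := lip_measurable Lu.
have uc := lip_support_bound A0 Lu uA.
pose f x := u x * pdf x.
have intf : leb.-integrable setT (EFin \o f) by exact: gauss_integrable mu uc.
pose I x := \int[leb]_(t in `]-oo, x]) f t.
have cf : continuous f.
  move=> x; apply: cvgM; first exact: (lip_continuous Lu).
  exact: continuous_normal_pdf.
have dI x : is_derive x (1 : R) I (f x).
  have xx : x < x + 1 by rewrite ltrDl.
  have iS : leb.-integrable [set` Interval -oo%O (BRight (x + 1))] (EFin \o f).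
    by apply: integrableS intf.
  have [dI1 dI2] := @continuous_FTC1 R f -oo%O x (x + 1) xx iS (ltNyr _) (cf x).
  by apply: DeriveDef => //; rewrite -derive1E.
have I0 x : A <= `|x| -> I x = 0.
  have [x0|x0] := leP 0 x.
    rewrite ger0_norm // => Ax; rewrite -gu0 /gauss /I Rintegral_mkcond.
    apply: eq_Rintegral => t _; rewrite patchE; case: ifPn => //.
    rewrite notin_setE /= in_itv /= => /negP; rewrite -ltNge => xt.
    by rewrite uA ?mul0r // (le_trans _ (ler_norm t)) // (le_trans Ax) // ltW.
  rewrite ltr0_norm // => Ax; rewrite /I.
  have -> : \int[leb]_(t in `]-oo, x]) f t = \int[leb]_(t in `]-oo, x]) (fun=> 0) t.
    apply: eq_Rintegral => t; rewrite inE /= in_itv /= => tx.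
    rewrite /f uA ?mul0r // ler0_norm; first by lra.
    by lra.
  by rewrite Rintegral_cst // mul0r.
pose g x := I x / pdf x.
have g0 x : A <= `|x| -> g x = 0 by move=> /I0; rewrite /g => ->; rewrite mul0r.
have dg x : is_derive x (1 : R) g (x * g x + u x).
  have p0 : pdf x != 0 by rewrite gt_eqF // pdf_gt0.
  have dp := is_derive_pdf x.
  have dV : is_derive x (1 : R) (fun y => (pdf y)^-1) (- (pdf x) ^- 2 *: (- x * pdf x)).
    exact: is_deriveV.
  have := @is_deriveM _ _ I (fun y => (pdf y)^-1) x 1 _ _ (dI x) dV.
  move/is_derive_eq; apply; rewrite /GRing.scale /= /g /f.
  by field.
have cg : continuous g.
  by move=> x; apply/differentiable_continuous/derivable1_diffP; case: (dg x).
have AA : - A <= A by lra.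
have [a aA amax] := EVT_max AA (continuous_subspaceT cg).
have [b bA bmin] := EVT_min AA (continuous_subspaceT cg).
exists g, (`|g a| + `|g b|) => // x.
have [xA|xA] := leP A `|x|; first by rewrite g0 // normr0 addr_ge0.
have xin : x \in `[(- A), A] by rewrite in_itv /= -ler_norml ltW.
have := amax _ xin; have := bmin _ xin; rewrite ler_norml => h1 h2.
have := ler_norm (g a); have := ler_norm (- g b); rewrite normrN.
have := normr_ge0 (g a); have := normr_ge0 (g b).
by move=> *; apply/andP; split; lra.
Qed.

End SteinEquation.

(** * From Stein's identity to distribution functions *)

Section TestFunctions.
Context (R : realType).
Implicit Types (u g : R -> R) (K : R).

(** The compact support of [g] allows [x * g x] to be replaced by
    [clip (- A) A x * g x], a product of bounded Lipschitz functions. *)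
Lemma stein_test_function u L A : 0 < A -> lip L u ->
  (forall x, A <= `|x| -> u x = 0) -> gauss u = 0 ->
  exists g g1 : R -> R, exists Lg Lg1 L' LH c B : R,
  [/\ lip Lg g, lip Lg1 g1, lip L' (fun y => y * g y) & forall y, `|g y| <= c] /\
  [/\ forall x y, `|g (x + y) - g x - y * g1 x| <= B * Num.min `|y| (y ^+ 2),
      lip LH (fun y => g1 y - y * g y) & forall y, g1 y - y * g y = u y].
Proof.
move=> A0 Lu uA gu0.
have [g [c gc [gA dg]]] := stein_solution A0 Lu uA gu0.
have c0 : 0 <= c by apply: le_trans (gc 0).
have uc := lip_support_bound A0 Lu uA.
have xgE x : x * g x = clip (- A) A x * g x.
  have [xA|xA] := leP A `|x|; first by rewrite gA // !mulr0.
  by rewrite clip_id // -ler_norml ltW.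
have clipA x : `|clip (- A) A x| <= A by rewrite ler_norml clip_itv //; lra.
have g1c x : `|x * g x + u x| <= A * c + L * (2 * A).
  by rewrite (le_trans (ler_normD _ _)) // lerD // xgE normrM ler_pM.
have Lg := derive_lip dg g1c.
have Lyg : lip (1 * c + A * (A * c + L * (2 * A))) (fun y => y * g y).
  have := lipM (clip_lip (- A) A) Lg clipA gc.
  by move=> H x y; rewrite xgE (xgE y); exact: H.
have Lg1 := lipD Lyg Lu.
exists g, (fun x => x * g x + u x); do 6!eexists.
split; [split; [exact: Lg|exact: Lg1|exact: Lyg|exact: gc]|].
split; [exact: (derive_taylor dg g1c Lg1)| |by move=> y; rewrite addrAC subrr add0r].
by apply: (_ : lip L _) => x y; rewrite [_ - x * _]addrAC subrr add0r [_ - y * _]addrAC subrr add0r.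
Qed.

Definition plateau K (y : R) : R := clip 0 1 (K + 1 - `|y|).

Lemma plateau_lip K : lip 1 (plateau K).
Proof.
move=> x y; rewrite (le_trans (clip_lip _ _ _ _)) // !mul1r.
rewrite (_ : _ - _ - _ = `|y| - `|x|); last by ring.
by rewrite (le_trans (ler_dist_dist _ _)) // distrC.
Qed.

Lemma plateau_itv K y : 0 <= plateau K y <= 1. Proof. exact: clip_itv. Qed.

Lemma plateau_norm K y : `|plateau K y| <= 1.
Proof. by case/andP: (plateau_itv K y) => b0 b1; rewrite ger0_norm. Qed.

Lemma plateau0 K y : K + 1 <= `|y| -> plateau K y = 0.
Proof.
move=> Ky; rewrite /plateau /clip; apply/max_idPl.
by rewrite ge_min; apply/orP; right; lra.
Qed.

Lemma plateau1 K y : `|y| <= K -> plateau K y = 1.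
Proof.
move=> Ky; rewrite /plateau /clip (min_idPl _); last by lra.
by apply/max_idPr; lra.
Qed.

(** A test function for the mass that escapes from [-K, K]: [y] times it is at least
    [1 / 2] outside, and its Lipschitz constant [K ^- 2] is small. *)
Definition escape K (y : R) : R := y / (K ^+ 2 + y ^+ 2).

Section Escape.
Context K (K0 : 0 < K).

Let den_gt0 y : 0 < K ^+ 2 + y ^+ 2.
Proof. by rewrite ltr_wpDr ?sqr_ge0 // exprn_gt0. Qed.

Lemma escape_lip : lip (K ^- 2) (escape K).
Proof.
move=> x y; have dx := den_gt0 x; have dy := den_gt0 y.
have -> : escape K x - escape K y =
    (K ^+ 2 - x * y) / ((K ^+ 2 + x ^+ 2) * (K ^+ 2 + y ^+ 2)) * (x - y).
  by rewrite /escape; field; rewrite !gt_eqF.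
have K2 : 0 < K ^+ 2 by rewrite exprn_gt0.
rewrite normrM ler_wpM2r // normrM normfV [X in _ / X]gtr0_norm ?mulr_gt0 //.
rewrite ler_pdivrMr ?mulr_gt0 // [leRHS]mulrC ler_pdivlMr //.
have x2 := sqr_ge0 x; have y2 := sqr_ge0 y; have xy := sqr_ge0 (x - y).
have xy' := sqr_ge0 (x + y).
have h1 : `|K ^+ 2 - x * y| <= K ^+ 2 + (x ^+ 2 + y ^+ 2).
  by rewrite ler_norml; apply/andP; split; nra.
apply: (le_trans (ler_wpM2r (ltW K2) h1)).
by move: (K ^+ 2) (x ^+ 2) (y ^+ 2) K2 x2 y2 => *; nra.
Qed.

Lemma escapeM_lip : lip K^-1 (fun y => y * escape K y).
Proof.
move=> x y; have dx := den_gt0 x; have dy := den_gt0 y.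
have -> : x * escape K x - y * escape K y =
    (K ^+ 2 * (x + y)) / ((K ^+ 2 + x ^+ 2) * (K ^+ 2 + y ^+ 2)) * (x - y).
  by rewrite /escape; field; rewrite !gt_eqF.
rewrite normrM ler_wpM2r // normrM normfV [X in _ / X]gtr0_norm ?mulr_gt0 //.
rewrite ler_pdivrMr ?mulr_gt0 // [leRHS]mulrC ler_pdivlMr // normrM ger0_norm ?sqr_ge0 //.
have K2 : 0 < K ^+ 2 by rewrite exprn_gt0.
have x2 := sqr_ge0 x; have y2 := sqr_ge0 y.
have h1 : `|x + y| * K <= K ^+ 2 + x ^+ 2 + y ^+ 2.
  rewrite -[X in _ * X](gtr0_norm K0) -normrM ler_norml.
  have := sqr_ge0 (K - x - y); have := sqr_ge0 (K + x + y).
  have := sqr_ge0 (K - x); have := sqr_ge0 (K + x).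
  have := sqr_ge0 (K - y); have := sqr_ge0 (K + y).
  by move=> *; apply/andP; split; nra.
rewrite -mulrA; apply: (le_trans (ler_wpM2l (ltW K2) h1)).
by move: (K ^+ 2) (x ^+ 2) (y ^+ 2) K2 x2 y2 => *; nra.
Qed.

Lemma escape_norm y : `|escape K y| <= K^-1.
Proof.
have dy := den_gt0 y.
rewrite /escape normrM normfV (gtr0_norm dy) ler_pdivrMr // [leRHS]mulrC ler_pdivlMr //.
rewrite -[X in _ * X](gtr0_norm K0) -normrM ler_norml.
have := sqr_ge0 (K - y); have := sqr_ge0 (K + y).
by move=> *; apply/andP; split; nra.
Qed.

Lemma escapeM_norm y : `|y * escape K y| <= 1.
Proof.
have dy := den_gt0 y; rewrite /escape mulrA -expr2 ger0_norm; last first.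
  by rewrite divr_ge0 ?sqr_ge0 // ltW.
by rewrite ler_pdivrMr // mul1r lerDr sqr_ge0.
Qed.

Lemma plateau_escape y : 1 - plateau K y <= 2 * (y * escape K y).
Proof.
have dy := den_gt0 y; have [yK|Ky] := leP `|y| K.
  rewrite plateau1 // subrr mulr_ge0 // /escape mulrA -expr2 divr_ge0 ?sqr_ge0 //.
  exact: ltW.
have /andP[b0 _] := plateau_itv K y.
apply: (@le_trans _ _ 1); first by lra.
rewrite /escape !mulrA ler_pdivlMr // mul1r -mulrA -expr2.
have : K ^+ 2 <= y ^+ 2 by rewrite -[leRHS]real_normK ?num_real // ler_pXn2r ?nnegrE // ltW.
by move=> *; lra.
Qed.

End Escape.

End TestFunctions.

Section NormalLimit.
Context d (T : measurableType d) (R : realType) (P : probability T R).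
Context (W : nat -> T -> R) (mW : forall N, measurable_fun setT (W N)).

Hypothesis stein : forall (Lg Lg1 L' LH c c' A : R) (g g1 : R -> R),
  lip Lg g -> lip Lg1 g1 -> lip L' (fun y => y * g y) -> (forall y, `|g y| <= c) ->
  (forall x y, `|g (x + y) - g x - y * g1 x| <= A * Num.min `|y| (y ^+ 2)) ->
  lip LH (fun y => g1 y - y * g y) -> (forall y, `|g1 y - y * g y| <= c') ->
  mean P (fun t => g1 (W N t) - W N t * g (W N t)) @[N --> \oo] --> 0.
Hypothesis tight : forall (Lg L' c c' e : R) (g : R -> R),
  lip Lg g -> lip L' (fun y => y * g y) -> (forall y, `|g y| <= c) ->
  (forall y, `|y * g y| <= c') -> 0 < e ->
  \forall N \near \oo, `|mean P (fun t => W N t * g (W N t))| <= Lg + e.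

Local Notation Lam N h := (mean P (fun t => h (W N t))).

Lemma gauss_tight (e : R) : 0 < e -> exists2 K0 : R, 0 < K0 &
  forall K, K0 <= K -> gauss (fun y => 1 - plateau K y) <= e.
Proof.
move=> e0.
pose F (n : nat) : set R := `[- n%:R, n%:R]%classic.
have mF n : measurable (F n) by exact: measurable_itv.
have F_nd : {homo F : n m / (n <= m)%N >-> (n <= m)%O}.
  move=> n m nm; apply/subsetPset => y; rewrite /F /= !in_itv /= => /andP[h1 h2].
  have nmR : n%:R <= m%:R :> R by rewrite ler_nat.
  by apply/andP; split; lra.
have FT : \bigcup_n F n = setT.
  rewrite -subTset => y _; have [n yn] : exists n : nat, `|y| <= n%:R :> R.
    by exists (Num.bound `|y|); rewrite ltW // archi_boundP.
  by exists n => //; rewrite /F /= in_itv /= -ler_norml.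
have := @nondecreasing_cvg_mu _ _ _ (normal_prob (0 : R) 1) F mF _ F_nd.
rewrite FT => /(_ measurableT) /=.
rewrite (_ : normal_prob 0 1 [set: R] = 1%:E); last exact: probability_setT.
move/fine_cvgP => [_ /cvgrPdist_le /(_ e e0) [n _ /(_ n (leqnn n)) Fn]].
exists n.+1%:R; first by rewrite ltr0n.
move=> K nK.
have mB : measurable_fun setT (fun y => 1 - plateau K y).
  by apply: measurable_funB => //; exact: lip_measurable (plateau_lip K).
have i1 : forall y : R, `|1 - plateau K y| <= 1.
  by move=> y; have := plateau_itv K y => /andP[? ?]; rewrite ger0_norm; lra.
have mI : measurable_fun setT (fun y : R => 1 + (-1) * \1_(F n) y : R).
  by apply: measurable_funD => //; apply: measurable_funM.
have indN y : `|\1_(F n) y : R| <= 1.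
  by rewrite indicE; case: (_ \in _); rewrite ?normr1 ?normr0.
have ind2 y : `|1 + (-1) * \1_(F n) y : R| <= 1.
  by rewrite indicE; case: (_ \in _); rewrite ?mulr1 ?mulr0 ?addr0 ?subrr ?normr1 ?normr0.
have c1 : forall y : R, `|1 : R| <= 1 by move=> _; rewrite normr1.
have mN : measurable_fun setT (fun y : R => (-1) * \1_(F n) y : R) by apply: measurable_funM.
have bN y : `|(-1) * \1_(F n) y : R| <= 1 by rewrite mulN1r normrN.
apply: (@le_trans _ _ (gauss (fun y : R => 1 + (-1) * \1_(F n) y))).
  apply: gauss_le mB i1 mI ind2 _ => y.
  have /andP[b0 _] := plateau_itv K y.
  rewrite indicE; have [yF|_] := boolP (y \in F n); last by rewrite mulr0 addr0 gerBl.
  rewrite plateau1 ?subrr ?mulr1 ?subrr //.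
  move: yF; rewrite inE /F /= in_itv /= -ler_norml => yn.
  by rewrite (le_trans yn) // (le_trans _ nK) // ler_nat.
rewrite (gaussD _ c1 mN bN) // (gaussZ _ _ indN) // gauss1 gauss_indic // mulN1r.
by have := ler_norm (1 - fine (normal_prob 0 1 (F n))); move: Fn => /= Fn /le_trans; apply.
Qed.

Lemma L1_comp N (h : R -> R) c : measurable_fun setT h -> (forall y, `|h y| <= c) ->
  L1 P (fun t => h (W N t)).
Proof.
by move=> mh hc; apply: (@L1_bounded _ _ _ _ _ c) => //; exact: measurableT_comp.
Qed.

Lemma mass_escape (K e : R) : 0 < K -> 0 < e ->
  \forall N \near \oo, Lam N (fun y => 1 - plateau K y) <= 2 * (K ^- 2 + e).
Proof.
move=> K0 e0.
apply: filterS (tight (escape_lip K0) (escapeM_lip K0) (escape_norm K0) (escapeM_norm K0) e0) => N H.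
apply: (@le_trans _ _ (mean P (fun t => 2 * (W N t * escape K (W N t))))).
  apply: mean_le.
  - apply: (@L1_comp N (fun y => 1 - plateau K y) 1).
      by apply: measurable_funB => //; exact: lip_measurable (plateau_lip K).
    by move=> y; have /andP[? ?] := plateau_itv K y; rewrite ger0_norm; lra.
  - apply: L1Z; apply: (@L1_comp N (fun y => y * escape K y) 1).
      exact: lip_measurable (escapeM_lip K0).
    exact: escapeM_norm.
  - by move=> t; exact: plateau_escape.
rewrite meanZ; last first.
  apply: (@L1_comp N (fun y => y * escape K y) 1).
    exact: lip_measurable (escapeM_lip K0).
  exact: escapeM_norm.
by rewrite ler_pM2l // (le_trans _ H) // ler_norm.
Qed.

Let plat_meas K : measurable_fun setT (plateau K : R -> R).
Proof. exact: lip_measurable (plateau_lip K). Qed.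

Let m1 K : measurable_fun setT (fun y : R => 1 - plateau K y).
Proof. exact: measurable_funB. Qed.

Let b1 (K : R) y : `|1 - plateau K y| <= 1.
Proof. by have /andP[? ?] := plateau_itv K y; rewrite ger0_norm; lra. Qed.

Let gauss_plateau (K : R) : gauss (plateau K) = 1 - gauss (fun y => 1 - plateau K y).
Proof.
have mC : measurable_fun setT (fun y : R => (-1) * plateau K y) by exact: measurable_funM.
have bC y : `|(-1) * plateau K y| <= 1 by rewrite mulN1r normrN plateau_norm.
have c1 : forall y : R, `|1 : R| <= 1 by move=> _; rewrite normr1.
have -> : (fun y => 1 - plateau K y) = fun y => 1 + (-1) * plateau K y.
  by apply/funext => y; rewrite mulN1r.
rewrite (gaussD _ c1 mC bC) // gauss1 (gaussZ _ (plat_meas K) (plateau_norm K)); ring.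
Qed.

Let final_estimate (q v1 v2 c G K' r e : R) : `|G - c| <= r -> r <= e / 8 -> K' <= e / 16 ->
  v2 <= 2 * (K' + e / 16) -> 0 <= v1 <= v2 -> 0 <= c * v2 <= v2 -> `|q| <= e / 16 ->
  `|G - (q + v1 + c * (1 - v2))| <= e.
Proof.
rewrite mulrBr mulr1; move: (c * v2) => w.
by rewrite !ler_norml => /andP[? ?] ? ? ? /andP[? ?] /andP[? ?] /andP[? ?]; apply/andP; split; lra.
Qed.

(** With [b] a plateau function and [c] the ratio of the Gaussian means of [h b] and
    [b], Stein's equation applies to [h b - c b]; what remains is bounded by the
    mass outside the plateau, under both laws. *)
Lemma near_gauss (h : R -> R) (L e : R) : lip L h -> (forall y, 0 <= h y <= 1) ->
  0 < e -> \forall N \near \oo, `|gauss h - Lam N h| <= e.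
Proof.
move=> Lh h01 e0.
have e8 : 0 < e / 8 by lra.
have [K0 K00 gK0] := gauss_tight e8.
(* the bound [1 / 2] keeps the Gaussian mean of the plateau positive *)
pose s := Num.min (e / 8) (1 / 2); have s0 : 0 < s by rewrite lt_min; apply/andP; split; lra.
have [K1 K10 gK1] := gauss_tight s0.
have [K2 K20 K2e] : exists2 K : R, 0 < K & K ^- 2 <= e / 16.
  exists (1 + 16 / e) => [|]; first by rewrite addr_gt0 // divr_gt0.
  have q0 : 0 < 16 / e by rewrite divr_gt0.
  rewrite -[leRHS]invrK lef_pV2 ?posrE ?exprn_gt0 ?invr_gt0 ?divr_gt0 //; last by rewrite addr_gt0.
  by rewrite invf_div; move: (16 / e) q0 => v *; nra.
pose K := Num.max K1 K2.
have K1K : K1 <= K by rewrite /K le_max lexx.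
have K2K : K2 <= K by rewrite /K le_max lexx orbT.
have Kpos : 0 < K by exact: lt_le_trans K1K.
have Ke : K ^- 2 <= e / 16.
  apply: le_trans K2e; rewrite lef_pV2 ?posrE ?exprn_gt0 // ler_pXn2r ?nnegrE //; exact: ltW.
have := gK1 K K1K; clearbody K; move: Kpos Ke => Kpos Ke gs.
have [se s2] : s <= e / 8 /\ s <= 1 / 2 by rewrite /s !ge_min !lexx orbT.
pose b := plateau K; pose hb y := h y * b y.
have hn y : `|h y| <= 1 by case/andP: (h01 y) => ? ?; rewrite ger0_norm.
have Lhb : lip (L * 1 + 1 * 1) hb by apply: lipM (plateau_lip K) hn (plateau_norm K).
have hb1 y : `|hb y| <= 1.
  by rewrite normrM -[leRHS]mulr1 ler_pM // plateau_norm.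
pose Gb := gauss b; pose Ghb := gauss hb; pose r := gauss (fun y => 1 - b y).
have r0 : 0 <= r.
  by apply: gauss_ge0 => y; have /andP[? ?] := plateau_itv K y; rewrite /b; lra.
have GbE : Gb = 1 - r by exact: gauss_plateau.
have GhbE : gauss h = Ghb + gauss (fun y => h y * (1 - b y)).
  have mh := lip_measurable Lh.
  have m2 : measurable_fun setT (fun y => h y * (1 - b y)) by exact: measurable_funM (m1 K).
  have b2 y : `|h y * (1 - b y)| <= 1 by rewrite normrM -[leRHS]mulr1 ler_pM //; exact: b1.
  rewrite -(gaussD (lip_measurable Lhb) hb1 m2 b2); congr gauss; apply/funext => y.
  by rewrite /hb; ring.
have b01 y : 0 <= b y <= 1 by exact: plateau_itv.
have pos2 (y : R) : 0 <= h y * (1 - b y).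
  by case/andP: (h01 y) => ? _; case/andP: (b01 y) => _ ?; rewrite mulr_ge0 // subr_ge0.
have small2 (y : R) : h y * (1 - b y) <= 1 - b y.
  by case/andP: (h01 y) => _ ?; case/andP: (b01 y) => _ ?; rewrite ler_piMl // subr_ge0.
have m2 : measurable_fun setT (fun y => h y * (1 - b y)).
  exact: measurable_funM (lip_measurable Lh) (m1 K).
have b2 y : `|h y * (1 - b y)| <= 1 by rewrite normrM -[leRHS]mulr1 ler_pM //; exact: b1.
have r2 : 0 <= gauss (fun y => h y * (1 - b y)) <= r.
  by rewrite gauss_ge0 //=; exact: gauss_le m2 b2 (m1 K) (b1 K) small2.
pose c := Ghb / Gb.
have rs : r <= e / 8 by exact: le_trans se.
have r12 : r <= 1 / 2 by exact: le_trans s2.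
have Gb0 : 0 < Gb by rewrite GbE subr_gt0 (le_lt_trans r12) // ltr_pdivrMr // mul1r ltr1n.
have Ghb0 : 0 <= Ghb.
  by apply: gauss_ge0 => y; rewrite mulr_ge0 //; [case/andP: (h01 y)|case/andP: (b01 y)].
have GhbGb : Ghb <= Gb.
  apply: gauss_le (lip_measurable Lhb) hb1 (plat_meas K) (plateau_norm K) _ => y.
  by rewrite ler_piMl //; [case/andP: (b01 y)|case/andP: (h01 y)].
have c0 : 0 <= c by rewrite divr_ge0 // ltW.
have c1 : c <= 1 by rewrite ler_pdivrMr // mul1r.
have cE : c * Gb = Ghb by rewrite /c divfK // gt_eqF.
have hc : `|gauss h - c| <= r.
  rewrite GhbE; have -> : c = c * Gb + c * r by rewrite GbE; ring.
  have : 0 <= c * r <= r by rewrite mulr_ge0 // ler_piMl.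
  move: r2; rewrite cE.
  by move: (gauss _) (c * r) => u v /andP[? ?] /andP[? ?]; rewrite ler_norml; apply/andP; split; lra.
pose u y := hb y + (- c) * b y.
have Lu : lip (L * 1 + 1 * 1 + `|- c| * 1) u by apply: lipD Lhb (lipZ (- c) (plateau_lip K)).
have K10' : 0 < K + 1 by lra.
have uK (y : R) : K + 1 <= `|y| -> u y = 0.
  by move=> yK; rewrite /u /hb /b plateau0 // !mulr0 addr0.
have mcb : measurable_fun setT (fun y => - c * b y) by exact: measurable_funM (plat_meas K).
have bcb y : `|- c * b y| <= 1.
  by rewrite normrM normrN (ger0_norm c0) -[leRHS]mulr1 ler_pM // plateau_norm.
have gu0 : gauss u = 0.
  rewrite (gaussD (lip_measurable Lhb) hb1 mcb bcb).
  by rewrite (gaussZ _ (plat_meas K) (plateau_norm K)) -/Ghb -/Gb -cE mulNr subrr.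
have [g [g1 [Lg [Lg1 [L' [LH [c' [B [[H1 H2 H3 H4] [H5 H6 H7]]]]]]]]]] := stein_test_function K10' Lu uK gu0.
have e16 : 0 < e / 16 by lra.
have H8 y : `|g1 y - y * g y| <= 2.
  by rewrite H7 (le_trans (ler_normD _ _)) // -[leRHS](natrD R 1 1) lerD.
have := stein H1 H2 H3 H4 H5 H6 H8; move/cvgrPdist_le => /(_ (e / 16) e16) cvu.
apply: filterS2 cvu (mass_escape Kpos e16) => N HN esc.
have LuE : Lam N h = mean P (fun t => g1 (W N t) - W N t * g (W N t)) +
    Lam N (fun y => h y * (1 - b y)) + c * (1 - Lam N (fun y => 1 - b y)).
  have i1 := L1_comp N (m1 K) (b1 K).
  have i2 := L1_comp N m2 b2.
  have i3 := L1_comp N (lip_measurable Lhb) hb1.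
  have i4 := L1_comp N mcb bcb.
  have i5 := L1_comp N (plat_meas K) (plateau_norm K).
  have -> : (fun t => g1 (W N t) - W N t * g (W N t)) = fun t => hb (W N t) + (- c * b (W N t)).
    by apply/funext => t; rewrite H7.
  rewrite meanD // meanZ // mulNr.
  have -> : Lam N (fun y => 1 - b y) = 1 - Lam N b by rewrite meanB ?mean_cst //; exact: L1_cst.
  have -> : Lam N h = Lam N hb + Lam N (fun y => h y * (1 - b y)).
    by rewrite -meanD //; congr mean; apply/funext => t; rewrite /hb; ring.
  by ring.
set q := mean P (fun t => g1 _ - _) in HN LuE.
have l2 : 0 <= Lam N (fun y => h y * (1 - b y)) <= Lam N (fun y => 1 - b y).
  rewrite mean_ge0 //=; apply: mean_le => //.
    exact: (L1_comp N m2 b2).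
  exact: (L1_comp N (m1 K) (b1 K)).
have l0 : 0 <= c * Lam N (fun y => 1 - b y) <= Lam N (fun y => 1 - b y).
  have l1 : 0 <= Lam N (fun y => 1 - b y) by case/andP: l2; exact: le_trans.
  by rewrite mulr_ge0 // ler_piMl.
rewrite LuE; apply: (final_estimate hc rs Ke esc l2 l0).
by move: HN; rewrite sub0r normrN.
Qed.

End NormalLimit.

Section CdfLimit.
Context (R : realType).

Definition ramp (a b y : R) : R := clip 0 1 ((b - y) / (b - a)).

Lemma ramp_lip a b : a < b -> lip (b - a)^-1 (ramp a b).
Proof.
move=> ab x y; rewrite (le_trans (clip_lip _ _ _ _)) // mul1r.
have ba : 0 < b - a by rewrite subr_gt0.
rewrite -mulrBl normrM normfV (gtr0_norm ba) mulrC ler_wpM2l ?invr_ge0 ?(ltW ba) //.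
by rewrite (_ : b - x - (b - y) = y - x) 1?distrC //; ring.
Qed.

Lemma ramp_itv a b y : 0 <= ramp a b y <= 1. Proof. exact: clip_itv. Qed.

Lemma indic_le_ramp a b y : a < b -> \1_[set x | x <= a] y <= ramp a b y.
Proof.
move=> ab; have /andP[r0 _] := ramp_itv a b y.
rewrite indicE; have [|_] := boolP (y \in _); last by [].
rewrite inE /= => ya; rewrite /ramp /clip (min_idPl _) ?le_max ?lexx ?orbT //.
by rewrite ler_pdivlMr ?subr_gt0 // mul1r lerD2l lerN2.
Qed.

Lemma ramp_le_indic a b y : a < b -> ramp a b y <= \1_[set x | x <= b] y.
Proof.
move=> ab; have /andP[_ r1] := ramp_itv a b y.
rewrite indicE; have [//|] := boolP (y \in _).
rewrite notin_setE /= => /negP; rewrite -ltNge => yb.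
rewrite /ramp /clip ge_max lexx ge_min; apply/orP; right.
by rewrite pmulr_lle0 ?invr_gt0 ?subr_gt0 // subr_le0 ltW.
Qed.

Context d (T : measurableType d) (P : probability T R).
Context (W : nat -> T -> R) (mW : forall N, measurable_fun setT (W N)).

Let mray (x : R) : measurable [set y | y <= x].
Proof. by rewrite -set_itvNyc; exact: measurable_itv. Qed.

Let indic_norm (x y : R) : `|\1_[set z | z <= x] y : R| <= 1.
Proof. by rewrite indicE; case: (_ \in _); rewrite ?normr1 ?normr0. Qed.

Lemma mean_ray N x : mean P (fun t => \1_[set y | y <= x] (W N t)) = fine (P [set t | W N t <= x]).
Proof.
rewrite /mean /Rintegral; congr fine.
have mS : measurable [set t | W N t <= x].
  by rewrite -[X in measurable X]setTI; exact: (mW N measurableT (mray x)).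
by rewrite -[in RHS](setIT [set t | W N t <= x]) -(integral_indic P measurableT mS).
Qed.

(** Convergence of the means of Lipschitz functions with values in [0, 1]
    gives convergence of the distribution functions: the indicator of a
    half-line is squeezed between two ramps. *)
Theorem cvg_cdf (x : R) :
  (forall (h : R -> R) (L e : R), lip L h -> (forall y, 0 <= h y <= 1) ->
    0 < e -> \forall N \near \oo, `|gauss h - mean P (fun t => h (W N t))| <= e) ->
  {for x, continuous (fun y : R => normal_prob 0 1 `]-oo, y]%classic)} ->
  P [set t | W N t <= x] @[N --> \oo] --> normal_prob 0 1 `]-oo, x]%classic.
Proof.
move=> near_gauss cx.
pose Phi (y : R) := fine (normal_prob 0 1 `]-oo, y]%classic).
have PE N : P [set t | W N t <= x] = (mean P (fun t => \1_[set y | y <= x] (W N t)))%:E.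
  rewrite mean_ray fineK // fin_num_measure //.
  by rewrite -[X in measurable X]setTI; exact: (mW N measurableT (mray x)).
have GE y : gauss \1_[set z | z <= y] = Phi y.
  by rewrite gauss_indic // /Phi set_itvNyc.
rewrite -[X in _ --> X]fineK; last by rewrite fin_num_measure.
under eq_cvg do rewrite PE.
apply: cvg_EFin; first by apply: nearW.
suff H (e : R) : 0 < e -> \forall N \near \oo,
    `|Phi x - mean P (fun t => \1_[set y | y <= x] (W N t))| <= e.
  by apply/cvgrPdist_le => e e0; exact: H.
move=> e_gt0.
have e2 : 0 < e / 2 by lra.
have : normal_prob 0 1 `]-oo, y]%classic @[y --> x] --> (Phi x)%:E.
  by rewrite /Phi fineK ?fin_num_measure //; exact: cx.
move=> /fine_cvgP[_] /cvgrPdist_le => /(_ _ e2) [delta /= d0 near_x].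
have dx y : `|x - y| < delta -> `|Phi x - Phi y| <= e / 2 by exact: near_x.
pose s := delta / 2; have s0 : 0 < s by rewrite /s divr_gt0.
have sd : s < delta by rewrite /s ltr_pdivrMr // ltr_pMr // ltr1n.
have up : x < x + s by rewrite ltrDl.
have dn : x - s < x by rewrite gtrBl.
have := dx (x + s); rewrite opprD addNKr normrN gtr0_norm // => /(_ sd) Pup.
have := dx (x - s); rewrite opprB addrC subrK gtr0_norm // => /(_ sd) Pdn.
apply: filterS2 (near_gauss _ _ _ (ramp_lip up) (ramp_itv x (x + s)) e2)
  (near_gauss _ _ _ (ramp_lip dn) (ramp_itv (x - s) x) e2) => N hup hdn.
have mI (y : R) : measurable_fun setT (\1_[set z | z <= y] : R -> R).
  by apply: measurable_indic.
have iI y : L1 P (fun t => \1_[set z | z <= y] (W N t)).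
  apply: (@L1_bounded _ _ _ _ _ 1) => //.
  exact: (measurableT_comp (mI y) (mW N)).
have iR a b : a < b -> L1 P (fun t => ramp a b (W N t)).
  move=> ab; apply: (@L1_bounded _ _ _ _ _ 1).
    exact: (measurableT_comp (lip_measurable (ramp_lip ab)) (mW N)).
  by move=> t; have /andP[? ?] := ramp_itv a b (W N t); rewrite ger0_norm.
have u1 : mean P (fun t => \1_[set y | y <= x] (W N t)) <= mean P (fun t => ramp x (x + s) (W N t)).
  by apply: mean_le => // [|t]; [exact: iR|exact: indic_le_ramp].
have u2 : mean P (fun t => ramp (x - s) x (W N t)) <= mean P (fun t => \1_[set y | y <= x] (W N t)).
  by apply: mean_le => // [|t]; [exact: iR|exact: ramp_le_indic].
have rn a b y : `|ramp a b y| <= 1.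
  by have /andP[? ?] := ramp_itv a b y; rewrite ger0_norm.
have u3 : gauss (ramp x (x + s)) <= Phi (x + s).
  rewrite -GE; apply: (gauss_le (lip_measurable (ramp_lip up)) (rn _ _) _ (indic_norm _)) => // y.
  exact: ramp_le_indic.
have u4 : Phi (x - s) <= gauss (ramp (x - s) x).
  rewrite -GE; apply: (gauss_le _ (indic_norm _) (lip_measurable (ramp_lip dn)) (rn _ _)) => // y.
  exact: indic_le_ramp.
move: hup hdn Pup Pdn u1 u2 u3 u4; rewrite -/(Phi x).
move: (mean P _) (mean P _) (mean P _) (gauss _) (gauss _) (Phi _) (Phi _) (Phi _).
by move=> a1 a2 a3 a4 a5 a6 a7 a8; rewrite !ler_norml => /andP[? ?] /andP[? ?] /andP[? ?] /andP[? ?] *;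
  apply/andP; split; lra.
Qed.

End CdfLimit.

(** * The law of the trace *)

Section BlockStatistics.
Context d (T : measurableType d) (R : realType).
Local Notation C := R[i].
Context (F : C -> R) (z : nat -> T -> borelC R).

Definition block_prod (s : seq nat) (t : T) : borelC R := \prod_(j <- s) (z j t : C).

Definition block_stat (s : seq nat) (t : T) : R :=
  (size s)%:R * Delta (size s) F (block_prod s t).

Definition blocks_stat (ss : seq (seq nat)) (t : T) : R := \sum_(s <- ss) block_stat s t.

Hypothesis mF : measurable_fun [set: borelC R] (F : borelC R -> R).

Lemma measurable_block_prod s : (forall j, j \in s -> measurable_fun setT (z j)) ->
  measurable_fun setT (block_prod s).
Proof.
rewrite /block_prod; elim: s => [_|j s IH mz].
  rewrite (_ : (fun t => _) = cst (1 : C)); last by apply/funext => t; rewrite big_nil.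
  exact: measurable_cst.
rewrite (_ : (fun t => _) = fun t => (z j t : C) * block_prod s t : borelC R).
  apply: measurable_mulC; first by apply: mz; rewrite mem_head.
  by apply: IH => i si; apply: mz; rewrite inE si orbT.
by apply/funext => t; rewrite /block_prod big_cons.
Qed.

Lemma measurable_block_stat s : (forall j, j \in s -> measurable_fun setT (z j)) ->
  measurable_fun setT (block_stat s).
Proof.
move=> mz; rewrite /block_stat; have [s0|s0] := posnP (size s).
  rewrite (_ : (fun t => _) = cst 0); first exact: measurable_cst.
  by apply/funext => t; rewrite s0 mul0r.
apply: measurable_funM => //.
exact: (measurableT_comp (measurable_Delta s0 mF) (measurable_block_prod mz)).
Qed.

Lemma measurable_blocks_stat ss : (forall j, j \in flatten ss -> measurable_fun setT (z j)) ->
  measurable_fun setT (blocks_stat ss).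
Proof.
rewrite /blocks_stat; elim: ss => [_|s ss IH mz].
  rewrite (_ : (fun t => _) = cst 0); last by apply/funext => t; rewrite big_nil.
  exact: measurable_cst.
rewrite (_ : (fun t => _) = fun t => block_stat s t + blocks_stat ss t).
  apply: measurable_funD.
    by apply: measurable_block_stat => j sj; apply: mz; rewrite /= mem_cat sj.
  by apply: IH => j sj; apply: mz; rewrite /= mem_cat sj orbT.
by apply/funext => t; rewrite /blocks_stat big_cons.
Qed.

End BlockStatistics.

Section BlockIndependence.
Context d (T : measurableType d) (R : realType) (P : probability T R).
Local Notation C := R[i].
Context (z : nat -> T -> borelC R).
Hypothesis mz : forall j, measurable_fun setT (z j).
Hypothesis z_indep : mutually_independent P z.

(** The events generating the sigma-algebra of the [z j] with [j] in [s], closed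
    under intersection. *)
Definition block_system (s : seq nat) : set (set T) :=
  [set A | exists2 B : nat -> set (borelC R), (forall j, measurable (B j)) &
           A = \big[setI/setT]_(j <- s) (z j @^-1` B j)].

Let mzB j (B : set (borelC R)) : measurable B -> measurable (z j @^-1` B).
Proof. by move=> mB; rewrite -[X in measurable X]setTI; exact: mz. Qed.

Lemma block_system_setI s : setI_closed (block_system s).
Proof.
move=> _ _ [B mB ->] [B' mB' ->]; exists (fun j => B j `&` B' j).
  by move=> j; exact: measurableI.
by rewrite -big_split; apply: eq_bigr => j _; rewrite preimage_setI.
Qed.

Lemma block_system_measurable s : block_system s `<=` measurable.
Proof. by move=> _ [B mB ->]; apply: bigsetI_measurable => j _; exact: mzB. Qed.

(** As the two lists are disjoint, the two families of events combine into one,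
    indexed by the concatenation. *)
Lemma block_system_indep s1 s2 A B : uniq (s1 ++ s2) ->
  block_system s1 A -> block_system s2 B -> P (A `&` B) = (P A * P B)%E.
Proof.
move=> us [B1 mB1 ->] [B2 mB2 ->].
pose B' j := if j \in s1 then B1 j else B2 j.
have mB' j : measurable (B' j) by rewrite /B'; case: ifP.
have [us1 dj us2] : [/\ uniq s1, ~~ has (mem s1) s2 & uniq s2].
  by move: us; rewrite cat_uniq => /and3P[].
have e1 : \big[setI/setT]_(j <- s1) (z j @^-1` B1 j) = \big[setI/setT]_(j <- s1) (z j @^-1` B' j).
  by apply: eq_big_seq => j js; rewrite /B' js.
have e2 : \big[setI/setT]_(j <- s2) (z j @^-1` B2 j) = \big[setI/setT]_(j <- s2) (z j @^-1` B' j).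
  apply: eq_big_seq => j js; rewrite /B'; case: ifP => // js1.
  by case/negP: dj; apply/hasP; exists j.
rewrite e1 e2 -big_cat /= !z_indep // big_cat //.
Qed.

Local Notation block_space s := (g_sigma_algebraType (block_system s)).

Lemma block_measurable s j : j \in s ->
  measurable_fun setT (z j : block_space s -> borelC R).
Proof.
move=> js _ B mB; rewrite setTI; apply: sub_gen_smallest.
exists (fun i => if i == j then B else setT).
  by move=> i; case: ifP => // _; exact: measurableT.
have jE : forall l : seq nat, \big[setI/setT]_(i <- l) (z i @^-1` (if i == j then B else setT)) =
    if j \in l then z j @^-1` B else setT.
  elim=> [|i l IH]; first by rewrite big_nil.
  rewrite big_cons IH inE eq_sym; case: eqP => [->|_] /=.
    by case: ifP => _; rewrite ?setIid ?setIT.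
  by rewrite preimage_setT setTI.
by rewrite jE js.
Qed.

Lemma block_indep s1 s2 d1 d2 (T1 : measurableType d1) (T2 : measurableType d2)
    (Y1 : T -> T1) (Y2 : T -> T2) : uniq (s1 ++ s2) ->
  measurable_fun setT (Y1 : block_space s1 -> T1) ->
  measurable_fun setT (Y2 : block_space s2 -> T2) -> indep_fun P Y1 Y2.
Proof.
move=> us m1 m2 A B mA mB.
apply: (indep_generated (@block_system_setI s1) (@block_system_setI s2)
  (@block_system_measurable s1) (@block_system_measurable s2)).
- by move=> A' B'; exact: block_system_indep.
- by have := m1 measurableT A mA; rewrite setTI.
- by have := m2 measurableT B mB; rewrite setTI.
Qed.

Hypothesis z_law : forall j, eq_in_law P (z j) (z 0%N).

(** By induction on the length: the first factor is independent of the product of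
    the others, so the law of the pair is determined. *)
Lemma block_prod_law s s' : uniq s -> uniq s' -> size s = size s' ->
  eq_in_law P (block_prod z s) (block_prod z s').
Proof.
elim: s s' => [|j s IH] [|j' s'] //= us us' [ss'].
have mb r : measurable_fun setT (block_prod z r) by apply: measurable_block_prod => *; exact: mz.
have ind i r : uniq (i :: r) -> indep_fun P (z i) (block_prod z r).
  move=> uir; apply: (@block_indep [:: i] r) => //.
    by apply: block_measurable; rewrite mem_head.
  by apply: measurable_block_prod => k kr; exact: block_measurable.
have zz : eq_in_law P (z j) (z j') by move=> B mB; rewrite (z_law j mB) (z_law j' mB).
have [us1 us1'] : uniq s /\ uniq s' by case/andP: us; case/andP: us'.
have := joint_law_eq (mz j) (mb s) (mz j') (mb s') (ind _ _ us) (ind _ _ us') zz (IH _ us1 us1' ss').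
move=> law B mB; pose M (u : borelC R * borelC R) : borelC R := (u.1 : C) * u.2.
have mM : measurable_fun setT M.
  by apply: measurable_mulC; [exact: measurable_fst|exact: measurable_snd].
have := law (M @^-1` B); rewrite -[X in measurable X]setTI => /(_ (mM measurableT B mB)).
by congr (P _ = P _); apply/seteqP; split => t; rewrite /= /M /block_prod /= !big_cons.
Qed.

End BlockIndependence.

Section MeanLaw.
Context d (T : measurableType d) (R : realType) (P : probability T R).

Lemma mean_eq_in_law d1 (T1 : measurableType d1) (Y Y' : T -> T1) (f : T1 -> R) c :
  measurable_fun setT Y -> measurable_fun setT Y' -> eq_in_law P Y Y' ->
  measurable_fun setT f -> (forall y, `|f y| <= c) ->
  mean P (fun t => f (Y t)) = mean P (fun t => f (Y' t)).
Proof.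
move=> mY mY' YY' mf fc.
pose W : {RV P >-> T1} := mfun_Sub (mem_set mY).
pose W' : {RV P >-> T1} := mfun_Sub (mem_set mY').
rewrite -[LHS]/(mean P (fun t => f (W t))) -(mean_distribution W mf fc).
rewrite -[RHS]/(mean P (fun t => f (W' t))) -(mean_distribution W' mf fc).
rewrite /mean /Rintegral; congr fine; apply: eq_measure_integral => A mA _; exact: YY'.
Qed.

End MeanLaw.

Section TraceLaw.
Context d (T : measurableType d) (R : realType) (P : probability T R).
Local Notation C := R[i].
Context (theta : R) (theta_gt0 : 0 < theta).
Context (F : C -> R) (z Z : nat -> T -> borelC R).
Hypothesis mF : measurable_fun [set: borelC R] (F : borelC R -> R).
Hypothesis mz : forall j, measurable_fun setT (z j).
Hypothesis mZ : forall j, measurable_fun setT (Z j).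
Hypothesis z_indep : mutually_independent P z.
Hypothesis z_law : forall j, eq_in_law P (z j) (z 0%N).
Hypothesis Z_law : forall k : nat, (0 < k)%N ->
  eq_in_law P (Z k) (fun t => \prod_(j < k) (z j t : C) : borelC R).

(** With this factor [k] the normalizing sequences become sums of moments of
    [cycle_stat k] weighted by [1 / k]. *)
Definition cycle_stat (k : nat) (t : T) : R := k%:R * Delta k F (Z k t).

Hypothesis iX : forall k, L1 P (cycle_stat k).

Lemma block_prod_law_Z s : uniq s -> (0 < size s)%N ->
  eq_in_law P (Z (size s)) (block_prod z s).
Proof.
move=> us s0 B mB; rewrite (Z_law s0 mB).
rewrite (_ : (fun t => _) = block_prod z (iota 0 (size s))).
  by apply: block_prod_law mB => //; rewrite ?iota_uniq // size_iota.
apply/funext => t; rewrite /block_prod -(big_mkord xpredT (fun j => z j t : C)) /index_iota.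
by rewrite subn0.
Qed.

Let mblock_stat s : measurable_fun setT (block_stat F z s).
Proof. by apply: measurable_block_stat => // *; exact: mz. Qed.

Let mblocks_stat ss : measurable_fun setT (blocks_stat F z ss).
Proof. by apply: measurable_blocks_stat => // *; exact: mz. Qed.

(** The blocks are independent, and are integrated out one at a time. *)
Lemma mean_blocks L c h ss x : lip L h -> (forall y, `|h y| <= c) ->
  uniq (flatten ss) -> (forall s, s \in ss -> (0 < size s)%N) ->
  mean P (fun t => h (x + blocks_stat F z ss t)) =
  convolve_seq P cycle_stat (map size ss) h x.
Proof.
move=> Lh hc; elim: ss x => [|s ss IH] x uss ss0.
  rewrite -[RHS](mean_cst P); congr mean; apply/funext => t.
  by rewrite /blocks_stat big_nil addr0.
have us : uniq s by move: uss; rewrite /= cat_uniq => /andP[].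
have ufl : uniq (flatten ss) by move: uss; rewrite /= cat_uniq => /and3P[].
have s0 : (0 < size s)%N by apply: ss0; rewrite mem_head.
have IH' y := IH y ufl (fun r rs => ss0 r (mem_behead (s := s :: ss) rs)).
pose g (u : R * R) := h (x + u.1 + u.2).
have mg : measurable_fun setT g.
  apply: (measurableT_comp (lip_measurable Lh)); apply: measurable_funD; last exact: measurable_snd.
  by apply: measurable_funD => //; exact: measurable_fst.
have ind : indep_fun P (block_stat F z s) (blocks_stat F z ss).
  apply: (block_indep mz z_indep uss).
    by apply: measurable_block_stat => // j js; exact: block_measurable.
  by apply: measurable_blocks_stat => // j js; exact: block_measurable.
transitivity (mean P (fun t => g (block_stat F z s t, blocks_stat F z ss t))).
  by congr mean; apply/funext => t; rewrite /g /blocks_stat big_cons addrA.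
rewrite (mean_indep (mblock_stat s) (mblocks_stat ss) ind mg (fun u => hc _)).
transitivity (mean P (fun t => convolve_seq P cycle_stat (map size ss) h (x + block_stat F z s t))).
  by congr mean; apply/funext => t; rewrite -IH'.
have Lc := convolve_seq_lip iX (map size ss) Lh.
have bc := convolve_seq_bound iX (map size ss) Lh hc.
pose f (w : borelC R) := convolve_seq P cycle_stat (map size ss) h
  (x + (size s)%:R * Delta (size s) F w).
have mf : measurable_fun setT f.
  apply: (measurableT_comp (lip_measurable Lc)); apply: measurable_funD => //.
  by apply: measurable_funM => //; exact: measurable_Delta.
apply: esym; apply: (@mean_eq_in_law _ _ _ P _ _ _ _ f c) => //.
- by apply: measurable_block_prod => *; exact: mz.
- exact: block_prod_law_Z.
- by move=> w; exact: bc.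
Qed.

Definition cycle_blocks n (s : 'S_n) : seq (seq nat) :=
  [seq [seq val i | i <- enum c] | c : {set 'I_n} <- enum (porbits s)].

Lemma size_cycle_blocks n (s : 'S_n) : map size (cycle_blocks s) = cycle_type s.
Proof.
rewrite -map_comp /cycle_type /card_seq; apply: eq_map => c /=.
by rewrite size_map -cardE.
Qed.

Lemma cycle_blocks_gt0 n (s : 'S_n) b : b \in cycle_blocks s -> (0 < size b)%N.
Proof.
case/mapP => c; rewrite mem_enum => /imsetP[i _ ->] ->.
by rewrite size_map -cardE; apply/card_gt0P; exists i; rewrite porbit_id.
Qed.

Lemma cycle_blocks_uniq n (s : 'S_n) : uniq (flatten (cycle_blocks s)).
Proof.
rewrite /cycle_blocks (_ : flatten _ = map val (flatten [seq enum c | c : {set 'I_n} <- enum (porbits s)])).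
  rewrite map_inj_uniq; last exact: val_inj.
  have : uniq (enum (porbits s)) by exact: enum_uniq.
  have : {subset enum (porbits s) <= porbits s} by move=> c; rewrite mem_enum.
  elim: (enum (porbits s)) => //= c cs IH sub /andP[ccs ucs].
  rewrite cat_uniq enum_uniq IH ?andbT //=; last by move=> b bcs; apply: sub; rewrite inE bcs orbT.
  apply/hasPn => i /flattenP[_ /mapP[b bcs ->]]; rewrite mem_enum => ib.
  rewrite /= mem_enum; apply/negP => ic; case/negP: ccs.
  have /imsetP[i1 _ c1] : c \in porbits s by apply: sub; rewrite mem_head.
  have /imsetP[i2 _ b2] : b \in porbits s by apply: sub; rewrite inE bcs orbT.
  suff -> : c = b by [].
  move: ic ib; rewrite c1 b2 -!eq_porbit_mem => /eqP -> /eqP ->.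
  by [].
by rewrite map_flatten -map_comp.
Qed.

Lemma Tr_blocks n (s : 'S_n) t : (forall j, (z j t : C) != 0) ->
  Tr F (modified_permutation_matrix (fun j : 'I_n => z j t) s) =
  blocks_stat F z (cycle_blocks s) t.
Proof.
move=> z0; rewrite Tr_cycles // /blocks_stat big_map big_enum; apply: eq_bigr => c _.
by rewrite /block_stat /block_prod size_map -cardE big_map big_enum.
Qed.

Hypothesis z_neq0 : forall j t, (z j t : C) != 0.
Context (n : nat) (sigma : T -> 'S_n).
Hypothesis sigma_ewens : ewens_distributed P theta sigma.
Hypothesis sigma_indep : independent_of_seq P sigma z.

Definition linear_stat (t : T) : R :=
  Tr F (modified_permutation_matrix (fun j : 'I_n => z j t) (sigma t)).

Let linear_statE (h : R -> R) t : h (linear_stat t) =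
  \sum_(s : 'S_n) (if sigma t == s then h (blocks_stat F z (cycle_blocks s) t) else 0).
Proof.
rewrite (bigD1 (sigma t)) //= eqxx big1 ?addr0 => [|s /negPf]; last by rewrite eq_sym => ->.
by rewrite -Tr_blocks // => j; exact: z_neq0.
Qed.

Let msigma s : measurable_fun setT (fun t => sigma t == s).
Proof.
move=> _ B _; rewrite setTI.
have -> : (fun t => sigma t == s) @^-1` B =
    (if true \in B then sigma @^-1` [set s] else set0) `|`
    (if false \in B then ~` (sigma @^-1` [set s]) else set0).
  apply/seteqP; split => t /=.
    move=> Bt; case: (eqVneq (sigma t) s) Bt => [st|st] Bt.
      by left; rewrite (mem_set Bt).
    by right; rewrite (mem_set Bt) /=; exact/eqP.
  case; case: ifPn => //; rewrite inE => BT /=; first by move=> ->; rewrite eqxx.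
  by move/eqP/negPf => ->.
have [ms _] := sigma_ewens s.
by apply: measurableU; case: ifP => // _; exact: measurableC.
Qed.

Lemma measurable_linear_stat : measurable_fun setT linear_stat.
Proof.
rewrite (_ : linear_stat = fun t => \sum_(s : 'S_n)
    (if sigma t == s then blocks_stat F z (cycle_blocks s) t else 0)).
  apply: measurable_sum => s; exact: measurable_fun_ifT.
by apply/funext => t; exact: (linear_statE id).
Qed.

(** The law of the trace: given the permutation, each cycle of length [k]
    contributes an independent copy of [k * Delta_k(F, Z_k)]. *)
Theorem mean_linear_stat L c h : lip L h -> (forall y, `|h y| <= c) ->
  mean P (fun t => h (linear_stat t)) = ewens_op P theta cycle_stat n h 0.
Proof.
move=> Lh hc.
pose g (u : bool * R) := if u.1 then h u.2 else 0.
have mg : measurable_fun setT g.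
  apply: measurable_fun_ifT; first exact: measurable_fst.
    exact: (measurableT_comp (lip_measurable Lh) measurable_snd).
  exact: measurable_cst.
have c0 : 0 <= c by apply: le_trans (hc 0).
have gc u : `|g u| <= c by rewrite /g; case: ifP => // _; rewrite normr0.
transitivity (mean P (fun t => \sum_(s : 'S_n) g (sigma t == s, blocks_stat F z (cycle_blocks s) t))).
  by congr mean; apply/funext => t; rewrite linear_statE.
rewrite mean_sum => [|s]; last first.
  apply: (@L1_bounded _ _ _ _ _ c) => //.
  by apply: (measurableT_comp mg); apply: measurable_fun_pair.
apply: eq_bigr => s _.
have ind : indep_fun P (fun t => sigma t == s) (blocks_stat F z (cycle_blocks s)).
  move=> A B _ mB; apply: (@sigma_indep ((fun s' => s' == s) @^-1` A)).
  have mzs j : measurable_fun setT (z j : g_sigma_algebraType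
      (\bigcup_j preimage_set_system setT (z j) measurable) -> borelC R).
    move=> _ D mD; rewrite setTI; apply: sub_gen_smallest; exists j => //.
    by exists D => //; rewrite setTI.
  have := measurable_blocks_stat mF (fun j (_ : j \in flatten (cycle_blocks s)) => mzs j).
  by move=> /(_ measurableT B mB); rewrite setTI.
rewrite (mean_indep (msigma s) (mblocks_stat _) ind mg gc).
have [ms Ps] := sigma_ewens s.
have i1 : L1 P (\1_(sigma @^-1` [set s])).
  apply: (@L1_bounded _ _ _ _ _ 1); first exact: measurable_indic.
  by move=> t; rewrite indicE; case: (_ \in _); rewrite ?normr1 ?normr0.
transitivity (mean P (fun t => convolve_seq P cycle_stat (cycle_type s) h 0 *
    \1_(sigma @^-1` [set s]) t)).
  congr mean; apply/funext => t; rewrite /g /= indicE.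
  case: eqP => st.
    rewrite mem_set //= mulr1 -size_cycle_blocks.
    rewrite -(mean_blocks 0 Lh hc (cycle_blocks_uniq s) (@cycle_blocks_gt0 _ s)).
    by congr mean; apply/funext => t'; rewrite add0r.
  by rewrite memNset //= mulr0 mean_cst.
rewrite meanZ // mulrC; congr (_ * _).
by rewrite /mean /Rintegral integral_indic // setIT -[RHS]/(fine (ewens theta s)%:E) -Ps.
Qed.

End TraceLaw.

(** * The central limit theorem *)

Section Normalization.
Context d (T : measurableType d) (R : realType) (P : probability T R).
Local Notation C := R[i].
Context (theta : R) (F : C -> R) (Z : nat -> T -> borelC R) (p : R).
Hypothesis mF : measurable_fun [set: borelC R] (F : borelC R -> R).
Hypothesis mZ : forall j, measurable_fun setT (Z j).
Hypothesis p_gt2 : 2 < p.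
Hypothesis moment_fin : forall N, moment_seq P F Z p N \is a fin_num.

Local Notation X := (cycle_stat F Z).
Local Notation D k := (fun t => Delta k F (Z k t)).

Let p0 : p != 0. Proof. by rewrite gt_eqF // (lt_trans _ p_gt2). Qed.

Lemma measurable_Delta_Z k : measurable_fun setT (D k.+1).
Proof. exact: (measurableT_comp (measurable_Delta (ltn0Sn k) mF) (mZ _)). Qed.

Lemma measurable_cycle_stat k : measurable_fun setT (X k).
Proof.
case: k => [|k].
  rewrite (_ : X 0%N = cst 0); first exact: measurable_cst.
  by apply/funext => t; rewrite /cycle_stat mul0r.
by apply: measurable_funM => //; exact: measurable_Delta_Z.
Qed.

Let mDp k : measurable_fun setT (fun t => `|D k.+1 t| `^ p).
Proof.
apply: (measurableT_comp (f := fun x => x `^ p)); first exact: measurable_powR.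
by apply: measurableT_comp => //; exact: measurable_Delta_Z.
Qed.

Let L1_Dp k : L1 P (fun t => `|D k.+1 t| `^ p).
Proof.
have E0 j : (0 <= 'E_P[(fun t => `|D j t| `^ p)%R])%E.
  by rewrite unlock; apply: integral_ge0 => t _; rewrite lee_fin powR_ge0.
have kp : 0 < k.+1%:R `^ (p - 1) :> R by rewrite powR_gt0 // ltr0n.
have := moment_fin k.+1; rewrite /moment_seq big_nat_recr //= fin_numD => /andP[_].
rewrite unlock => fE; apply/integrableP; split; first exact/measurable_EFinP.
have -> : (\int[P]_t `|(EFin \o (fun t => `|D k.+1 t| `^ p)%R) t| =
    \int[P]_t (`|D k.+1 t| `^ p)%:E)%E.
  by apply: eq_integral => t _ /=; rewrite ger0_norm ?powR_ge0.
have := E0 k.+1; rewrite unlock; move: (\int[P]_t _)%E fE => [r _ _|+ _|//].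
  exact: ltry.
by rewrite mulry gtr0_sg // mul1e.
Qed.

Lemma L1_cycle_stat_powR k : L1 P (fun t => `|X k t| `^ p).
Proof.
case: k => [|k].
  rewrite (_ : (fun t => _) = cst 0); first exact: L1_cst.
  by apply/funext => t; rewrite /cycle_stat mul0r normr0 powR0.
rewrite (_ : (fun t => _) = fun t => k.+1%:R `^ p * `|D k.+1 t| `^ p).
  by apply: L1Z; exact: L1_Dp.
by apply/funext => t; rewrite /cycle_stat normrM powRM // normr_nat.
Qed.

Let L1_X k : L1 P (X k).
Proof. exact: (moment_L1 measurable_cycle_stat p_gt2 L1_cycle_stat_powR). Qed.

Let L1_X2 k : L1 P (fun t => X k t ^+ 2).
Proof. exact: (moment_L2 measurable_cycle_stat p_gt2 L1_cycle_stat_powR). Qed.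

Let expectation_mean f : L1 P f -> ('E_P[f] = (mean P f)%:E)%E.
Proof. by move=> if1; rewrite mean_EFin // unlock. Qed.

Let kR k : k.+1%:R != 0 :> R. Proof. by rewrite pnatr_eq0. Qed.

Let DE k : D k.+1 = fun t => k.+1%:R^-1 * X k.+1 t.
Proof. by apply/funext => t; rewrite /cycle_stat mulKf. Qed.

Lemma mean_seqE N : mean_seq P theta F Z N.+1 = (ewens_mean P theta X N)%:E.
Proof.
rewrite /mean_seq /ewens_mean EFinM; congr (_ * _)%E; rewrite -sumEFin.
rewrite big_add1 big_mkord; apply: eq_bigr => k _.
by rewrite (DE k) expectation_mean; [rewrite meanZ // mulrC|exact: L1Z].
Qed.

Lemma variance_seqE N : variance_seq P theta F Z N.+1 = (ewens_variance P theta X N)%:E.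
Proof.
rewrite /variance_seq /ewens_variance EFinM; congr (_ * _)%E; rewrite -sumEFin.
rewrite big_add1 big_mkord; apply: eq_bigr => k _.
have -> : (fun t => (D k.+1 t) ^+ 2) = fun t => k.+1%:R^-1 ^+ 2 * X k.+1 t ^+ 2.
  by apply/funext => t; rewrite -exprMn; congr (_ ^+ 2); rewrite /cycle_stat mulKf.
rewrite expectation_mean; last exact: L1Z.
by rewrite meanZ // -EFinM; congr EFin; move: (k.+1%:R) (kR k) => v v0; field.
Qed.

Lemma moment_seqE N : fine (moment_seq P F Z p N.+1) = ewens_moment P X p N.
Proof.
apply: EFin_inj; rewrite fineK // /moment_seq /ewens_moment -sumEFin.
rewrite big_add1 big_mkord; apply: eq_bigr => k _.
rewrite expectation_mean // -EFinM; congr EFin.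
have -> : (fun t => `|X k.+1 t| `^ p) = fun t => k.+1%:R `^ p * `|D k.+1 t| `^ p.
  by apply/funext => t; rewrite /cycle_stat normrM powRM // normr_nat.
rewrite meanZ // mulrAC; congr (_ * _).
by rewrite powRD ?kR ?implybT // powR_inv1.
Qed.

End Normalization.

Section CentralLimit.
Context (R : realType) (d : measure_display) (T : measurableType d).
Context (P : probability T R) (theta : R) (theta_gt0 : 0 < theta) (F : R[i] -> R).
Context (z Z : nat -> {RV P >-> borelC R}) (sigma : forall N : nat, T -> 'S_N) (p : R).
Hypothesis mF : measurable_fun [set: borelC R] (F : borelC R -> R).
Hypothesis z_circle : forall (j : nat) (t : T), `|z j t : R[i]| = 1.
Hypothesis z_iid : iid P (fun j => z j : T -> borelC R).
Hypothesis sigma_ewens : forall N : nat, ewens_distributed P theta (sigma N).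
Hypothesis sigma_indep : forall N : nat,
  independent_of_seq P (sigma N) (fun j => z j : T -> borelC R).
Hypothesis Z_law : forall k : nat, (0 < k)%N ->
  eq_in_law P (Z k : T -> borelC R)
    (fun t => \prod_(j < k) (z j t : R[i]) : borelC R).
Hypothesis V_cvg : variance_seq P theta F Z N @[N --> \oo] --> +oo%E.
Hypothesis p_gt : Num.max theta^-1 2 < p.
Hypothesis moment_fin : forall N : nat, moment_seq P F Z p N \is a fin_num.
Hypothesis moment_o : (fun N => fine (moment_seq P F Z p N)) =o_\oo
  (fun N => fine (variance_seq P theta F Z N) `^ (p / 2)).

Local Notation X := (cycle_stat F Z).
Local Notation V N := (ewens_variance P theta X N).
Local Notation M N := (ewens_moment P X p N).

Let p_gt2 : 2 < p. Proof. by move: p_gt; rewrite gt_max => /andP[]. Qed.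
Let p_theta : theta^-1 < p. Proof. by move: p_gt; rewrite gt_max => /andP[]. Qed.
Let mz j : measurable_fun setT (z j). Proof. exact: measurable_funPT. Qed.
Let mZ j : measurable_fun setT (Z j). Proof. exact: measurable_funPT. Qed.
Let mX := measurable_cycle_stat mF mZ.
Let iXp := L1_cycle_stat_powR mF mZ p_gt2 moment_fin.
Let iX := moment_L1 mX p_gt2 iXp.

Let z_neq0 j t : (z j t : R[i]) != 0.
Proof. by rewrite -normr_gt0 z_circle. Qed.

Lemma ewens_variance_cvg : V N @[N --> \oo] --> +oo.
Proof.
apply/cvgeryP.
under eq_cvg do rewrite -(variance_seqE theta mF mZ p_gt2 moment_fin).
have H := V_cvg; rewrite -cvg_shiftS in H; exact: H.
Qed.

Lemma ewens_moment_cvg : (M N / Num.sqrt (V N) `^ p) @[N --> \oo] --> 0.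
Proof.
apply/cvgrPdist_le => e e0.
have [n0 _ Hn0] : \forall N \near \oo, 0 < V N.
  by have /cvgryPgt := ewens_variance_cvg; apply.
have /eqoP /(_ _ e0) [n1 _ Hn1] := moment_o.
exists (maxn n0 n1) => // N /=; rewrite geq_max => /andP[N0 N1].
have V0 := Hn0 N N0; have := Hn1 N.+1 (leqW N1).
rewrite (moment_seqE mF mZ moment_fin) (variance_seqE theta mF mZ p_gt2 moment_fin) /=.
rewrite [p / 2]mulrC powRrM powR12_sqrt ?(ltW V0) // => H.
have s0 : 0 < Num.sqrt (V N) `^ p by rewrite powR_gt0 // sqrtr_gt0.
rewrite sub0r normrN normrM normfV (gtr0_norm s0) ler_pdivrMr //.
by rewrite (gtr0_norm s0) in H.
Qed.

Local Notation W N t := ((Tr F (modified_permutation_matrix (fun j : 'I_N => z j t) (sigma N t))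
  - fine (mean_seq P theta F Z N)) / Num.sqrt (fine (variance_seq P theta F Z N))).

Let mW N : measurable_fun setT (fun t => W N t).
Proof.
apply: measurable_funM => //; apply: measurable_funB => //.
exact: (measurable_linear_stat mF mz z_neq0 (@sigma_ewens N)).
Qed.

Let W_std N t : W N.+1 t = standardize P theta X N (linear_stat F z (sigma N.+1) t).
Proof.
by rewrite (mean_seqE theta mF mZ p_gt2 moment_fin) (variance_seqE theta mF mZ p_gt2 moment_fin).
Qed.

Let mean_W N (h : R -> R) L c : lip L h -> (forall y, `|h y| <= c) ->
  mean P (fun t => h (W N.+1 t)) =
  ewens_op P theta X N.+1 (fun x => h (standardize P theta X N x)) 0.
Proof.
move=> Lh hc; have [z_law z_indep] := z_iid.
have Ls := lip_standardize P theta X N Lh.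
rewrite -(mean_linear_stat mF mz mZ z_indep z_law Z_law iX z_neq0 (@sigma_ewens N.+1)
  (@sigma_indep N.+1) Ls (fun x => hc _)).
by congr mean; apply/funext => t; rewrite W_std.
Qed.

Theorem central_limit : cvg_in_distribution P (fun N t => W N t) (normal_prob 0 1).
Proof.
split=> [|x cx]; first exact: mW.
rewrite -(cvg_shiftS (fun N => P [set t | W N t <= x])).
apply: (@cvg_cdf _ _ _ P (fun N t => W N.+1 t)) cx => // h L e.
apply: (@near_gauss _ _ _ P (fun N t => W N.+1 t)) => //.
- move=> Lg Lg1 L' LH c c' A g g1 H1 H2 H3 H4 H5 H6 H7.
  have := stein_cvg theta_gt0 mX p_gt2 p_theta iXp ewens_variance_cvg ewens_moment_cvg H1 H2 H3 H4 H5 H6.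
  by under eq_cvg do rewrite -(mean_W _ H6 H7).
- move=> Lg L' c c' e' g H1 H2 H3 H4 e0.
  have := stein_tight theta_gt0 mX p_gt2 p_theta iXp ewens_variance_cvg ewens_moment_cvg H1 H2 H3 e0.
  by apply: filterS => N; rewrite -(mean_W _ H2 H4).
Qed.

End CentralLimit.

Unset Implicit Arguments.
Set Strict Implicit.
Set Printing Implicit Defensive.

(* The sequence (z_j)_{j >= 1} is indexed from 0: z_{j+1} is [z j].            *)
(* [moment_seq] is required to be a sequence of real numbers; as p > 2, this   *)
(* makes [variance_seq] and [mean_seq] real-valued as well.                    *)
Theorem theorem6p2 (R : realType) (d : measure_display) (T : measurableType d)
    (P : probability T R) (theta : R) (F : R[i] -> R)
    (z : nat -> {RV P >-> borelC R}) (sigma : forall N : nat, T -> 'S_N)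
    (Z : nat -> {RV P >-> borelC R})
    (theta_gt0 : 0 < theta)
    (F_measurable : measurable_fun [set: borelC R] F)
    (z_circle : forall (j : nat) (t : T), `|z j t : R[i]| = 1)
    (z_iid : iid P (fun j => z j : T -> borelC R))
    (sigma_ewens : forall N : nat, ewens_distributed P theta (sigma N))
    (sigma_indep : forall N : nat,
       independent_of_seq P (sigma N) (fun j => z j : T -> borelC R))
    (Z_law : forall k : nat, (0 < k)%N ->
       eq_in_law P (Z k : T -> borelC R)
         (fun t => \prod_(j < k) (z j t : R[i]) : borelC R))
    (V_cvg : variance_seq P theta F Z N @[N --> \oo] --> +oo%E)
    (moment_littleo : exists p : R,
       [/\ Num.max theta^-1 2 < p,
           forall N : nat, moment_seq P F Z p N \is a fin_num
         & (fun N => fine (moment_seq P F Z p N)) =o_\oo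
           (fun N => fine (variance_seq P theta F Z N) `^ (p / 2))]) :
  cvg_in_distribution P
    (fun (N : nat) (t : T) =>
       (Tr F (modified_permutation_matrix (fun j : 'I_N => z j t) (sigma N t))
          - fine (mean_seq P theta F Z N))
       / Num.sqrt (fine (variance_seq P theta F Z N)))
    (normal_prob 0 1).
Proof.
case: moment_littleo => p [p_gt moment_fin moment_o].
exact: (central_limit theta_gt0 F_measurable z_circle z_iid sigma_ewens sigma_indep Z_law
  V_cvg p_gt moment_fin moment_o).
Qed.
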